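(* Assume that $D^\varepsilon$ is infinite, let $M_1,M_2$ be $-\varepsilon$-hermitian hyperbolic modules over $D$ and put $M=M_1\oplus M_2$ (orthogonal direct sum). Then the restriction map $$H^2(\mathbf U(M);W^\varepsilon(D,J))\longrightarrow H^2(\mathbf U(M_1);W^\varepsilon(D,J))$$ along the natural inclusion $\mathbf U(M_1)\to\mathbf U(M)$ maps the Maslov class $[\mathsf m]$ for $\mathbf U(M)$ onto the Maslov class $[\mathsf m_1]$ for $\mathbf U(M_1)$.
   Context: $D$ is a field or division ring of arbitrary characteristic with an involution $J$ (an antiautomorphism with $J^2=\mathrm{id}$; $J=\mathrm{id}$ is allowed if $D$ is commutative), $\varepsilon\in\{1,-1\}$, and $D^\varepsilon=\{a\in D\mid a-a^J\varepsilon=0\}$. Modules are finite dimensional right $D$-modules. For a matrix $a$, $a^J$ denotes the transpose with $J$ applied to all entries, and $a^{-J}=(a^J)^{-1}$. For $\delta=\pm1$, a $\delta$-hermitian form on $M$ is a biadditive map $h:M\times M\to D$ with $h(ua,vb)=a^Jh(u,v)b$ and $h(u,v)=h(v,u)^J\delta$. For a right $D$-module $X$, $X^J$ is its dual space made into a right $D$-module by $(\xi a)(v)=a^J\xi(v)$. The hyperbolic $\delta$-hermitian module on $X$ is $X\oplus X^J$ with $h_X((x,\xi),(y,\eta))=\xi(y)+\eta(x)^J\delta$; every isometric module is also called hyperbolic, of rank $\dim X$. $\mathbf U(M)$ is the isometry group. A Lagrangian is a subspace $X$ with $X=X^\perp$; two Lagrangians $X,Y$ are opposite if $X\cap Y=0$.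 The Witt group $W^\varepsilon(D,J)$ is the group completion of the monoid of isomorphism classes of nondegenerate $\varepsilon$-hermitian forms over $(D,J)$ modulo the subgroup generated by the $\varepsilon$-hermitian hyperbolic modules. For a $-\varepsilon$-hermitian hyperbolic module $M$ of rank $n$ with form $h$ and pairwise opposite Lagrangians $X,Y,Z$, choose a basis $x_1,\dots,x_n$ of $X$ and let $y_1,\dots,y_n$ be the basis of $Y$ with $h(y_\mu,x_\nu)=\delta_{\mu\nu}$; then $Z$ has a unique basis $y_\nu+\sum_\mu x_\mu t_{\mu\nu}$ with $t$ nonsingular and $\varepsilon$-hermitian ($t=t^J\varepsilon$), and $\kappa(X,Y,Z)$ is the isomorphism class of $t$ (well defined). The opposition graph $\Gamma$ of $M$ has the Lagrangians as vertices and pairs of opposite Lagrangians as edges. $Fl(\Gamma)$ is the simplicial set whose $k$-simplices are tuples of vertices that are pairwise equal or adjacent, with $\mathbb Z$-free chain complex $C_*=C_*(Fl(\Gamma))$, and $\tilde C_*$ is its quotient complex of alternating chains $\langle x_0,\dots,x_k\rangle$ (antisymmetric in the entries, zero if two entries coincide). The Maslov cocycle is the $\mathbf U(M)$-invariant $2$-cocycle $\mathsf m:\langle X,Y,Z\rangle\mapsto[\kappa(X,Y,Z)]\in W^\varepsilon(D,J)$. For a group $G$ acting on $C_*$, a projective resolution $P_*\to\mathbb Z$ of $G$ with augmentation $\eta:P_0\to\mathbb Z$, and a coefficient group $A$ with trivial action, $H^*_G(C_*;A)$ is the cohomology of $\mathrm{Hom}_{\mathbb Z}(P_*\otimes_GC_*,A)$;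 a $G$-invariant cochain $c$ on $C_*$ is viewed as the cochain $p\otimes z\mapsto\eta(p)c(z)$ on $P_0\otimes_G C_*$ (zero on the other components). If $D^\varepsilon$ is infinite, $Fl(\Gamma)$ is acyclic and the constant map $Fl(\Gamma)\to pt$ induces an isomorphism $H^*(\mathbf U(M);A)\cong H^*_{\mathbf U(M)}(Fl(\Gamma);A)$; via this isomorphism the Maslov cocycle defines the Maslov class $[\mathsf m]\in H^2(\mathbf U(M);W^\varepsilon(D,J))$. *)

(* Defs.v *)
From HB Require Import structures.
From mathcomp Require Import all_boot all_order all_algebra.
From mathcomp Require Import boolp classical_sets functions cardinality.
From mathcomp Require Import freeg zify.

Set Implicit Arguments.
Unset Strict Implicit.
Unset Printing Implicit Defensive.

Import GRing.Theory.
Local Open Scope ring_scope.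
Local Open Scope quotient_scope.

Record involution (D : nzRingType) := Involution {
  inv_fun :> D -> D;
  inv_add : {morph inv_fun : a b / a + b};
  inv_mul : forall a b, inv_fun (a * b) = inv_fun b * inv_fun a;
  inv_inv : involutive inv_fun }.

Lemma inv0 (D : nzRingType) (J : involution D) : J 0 = 0.
Proof. by apply: (addrI (J 0)); rewrite -inv_add !addr0. Qed.

Lemma invN (D : nzRingType) (J : involution D) a : J (- a) = - J a.
Proof. by apply: (addrI (J a)); rewrite -inv_add !subrr inv0. Qed.

Lemma inv1 (D : nzRingType) (J : involution D) : J 1 = 1.
Proof. by rewrite -[LHS]mulr1 -[X in _ * X](inv_inv J) -inv_mul mulr1 inv_inv. Qed.

(* Right D-modules are left modules over the opposite ring D^c: [a *: v]
   stands for the vector v a, and [a *: (b *: v) = (b * a) *: v]. *)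
Notation rmodType D := (lmodType D^c).

Section RightModules.
Variable D : nzRingType.

Definition is_basis (M : rmodType D) (S : set M) n (e : 'I_n -> M) : Prop :=
  S = [set v | exists a : 'I_n -> D^c, v = \sum_i a i *: e i]%classic /\
  forall a : 'I_n -> D^c, \sum_i a i *: e i = 0 -> forall i, a i = 0.

Definition fin_dim (M : rmodType D) : Prop :=
  exists n (e : 'I_n -> M), is_basis setT e.

Definition is_submodule (M : rmodType D) (S : set M) : Prop :=
  [/\ S 0, forall u v, S u -> S v -> S (u + v) &
      forall (a : D^c) u, S u -> S (a *: u)].

Definition isometric (M M' : rmodType D) (h : M -> M -> D) (h' : M' -> M' -> D) :=
  exists f : {linear M -> M'},
    bijective f /\ forall u v, h' (f u) (f v) = h u v.

Definition nondegenerate (M : rmodType D) (h : M -> M -> D) : Prop :=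
  forall u, (forall v, h u v = 0) -> u = 0.

Definition osum (M1 M2 : rmodType D) (h1 : M1 -> M1 -> D) (h2 : M2 -> M2 -> D)
    (u v : M1 * M2) : D := h1 u.1 v.1 + h2 u.2 v.2.

Lemma isometric_refl (M : rmodType D) (h : M -> M -> D) : isometric h h.
Proof. by exists idfun; split=> //; exists idfun. Qed.

Lemma isometric_sym (M M' : rmodType D) (h : M -> M -> D) (h' : M' -> M' -> D) :
  isometric h h' -> isometric h' h.
Proof.
move=> [f [[g fK gK] fh]].
have gl : linear g by move=> a u v; apply: (can_inj fK); rewrite linearP !gK.
pose gL := HB.pack_for {linear M' -> M} g (GRing.isLinear.Build _ _ _ _ g gl).
by exists gL; split=> [|u v]; [exists f | rewrite -fh /= !gK].
Qed.

Lemma isometric_trans (M M' M'' : rmodType D) (h : M -> M -> D)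
    (h' : M' -> M' -> D) (h'' : M'' -> M'' -> D) :
  isometric h h' -> isometric h' h'' -> isometric h h''.
Proof.
move=> [f [fb fh]] [g [gb gh]]; exists (g \o f); split; first exact: bij_comp.
by move=> u v /=; rewrite gh fh.
Qed.

Lemma isometric_osum (M1 M2 N1 N2 : rmodType D) (h1 : M1 -> M1 -> D)
    (h2 : M2 -> M2 -> D) (k1 : N1 -> N1 -> D) (k2 : N2 -> N2 -> D) :
  isometric h1 k1 -> isometric h2 k2 -> isometric (osum h1 h2) (osum k1 k2).
Proof.
move=> [f [[f' fK f'K] fh]] [g [[g' gK g'K] gh]].
pose F (u : M1 * M2) : N1 * N2 := (f u.1, g u.2).
have Fl : linear F by move=> a u v; rewrite /F /= !linearP.
exists (HB.pack_for {linear (M1 * M2)%type -> (N1 * N2)%type} F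
  (GRing.isLinear.Build _ _ _ _ F Fl)); split=> /= [|u v]; last first.
  by rewrite /osum /= fh gh.
exists (fun u => (f' u.1, g' u.2)) => -[a b]; rewrite /F /=.
  by rewrite fK gK.
by rewrite f'K g'K.
Qed.

Lemma isometric_osumC (M1 M2 : rmodType D) (h1 : M1 -> M1 -> D)
    (h2 : M2 -> M2 -> D) : isometric (osum h1 h2) (osum h2 h1).
Proof.
pose F (u : M1 * M2) : M2 * M1 := (u.2, u.1).
have Fl : linear F by move=> a u v.
exists (HB.pack_for {linear (M1 * M2)%type -> (M2 * M1)%type} F
  (GRing.isLinear.Build _ _ _ _ F Fl)); split=> /= [|u v]; last first.
  by rewrite /osum /= addrC.
by exists (fun u => (u.2, u.1)) => -[].
Qed.

Lemma isometric_osumA (M1 M2 M3 : rmodType D) (h1 : M1 -> M1 -> D)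
    (h2 : M2 -> M2 -> D) (h3 : M3 -> M3 -> D) :
  isometric (osum h1 (osum h2 h3)) (osum (osum h1 h2) h3).
Proof.
pose F (u : M1 * (M2 * M3)) : M1 * M2 * M3 := (u.1, u.2.1, u.2.2).
have Fl : linear F by move=> a u v.
exists (HB.pack_for {linear (M1 * (M2 * M3))%type -> (M1 * M2 * M3)%type} F
  (GRing.isLinear.Build _ _ _ _ F Fl)); split=> /= [|u v]; last first.
  by rewrite /osum /= addrA.
by exists (fun u => (u.1.1, (u.1.2, u.2))) => [[? []]|[[]]].
Qed.

End RightModules.

Section Hermitian.
Variables (D : nzRingType) (J : involution D).

Definition hermitian (delta : D) (M : rmodType D) (h : M -> M -> D) : Prop :=
  [/\ forall u v w, h (u + v) w = h u w + h v w,
      forall u v w, h u (v + w) = h u v + h u w,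
      forall (a b : D^c) u v, h (a *: u) (b *: v) = J a * h u v * b &
      forall u v, h u v = J (h v u) * delta].

Section Dual.
Variable X : rmodType D.

Definition is_linear_form (xi : X -> D) : Prop :=
  {morph xi : u v / u + v} /\ forall (a : D^c) v, xi (a *: v) = xi v * a.

Record dual := Dual { dual_fun :> X -> D; dualP : is_linear_form dual_fun }.

Lemma dual_eq (xi eta : dual) : xi =1 eta -> xi = eta.
Proof.
case: xi eta => [f fP] [g gP] /= /funext fg; case: _ / fg gP => gP.
by congr Dual; exact: Prop_irrelevance.
Qed.

HB.instance Definition _ := gen_eqMixin dual.
HB.instance Definition _ := gen_choiceMixin dual.

Fact dual_zero_subproof : is_linear_form (fun=> 0).
Proof. by split=> [u v|a v]; rewrite ?addr0 ?mul0r. Qed.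

Fact dual_opp_subproof (xi : dual) : is_linear_form (fun v => - xi v).
Proof.
by case: (dualP xi) => xiD xiZ; split=> [u v|a v]; rewrite ?xiD ?opprD ?xiZ ?mulNr.
Qed.

Fact dual_add_subproof (xi eta : dual) : is_linear_form (fun v => xi v + eta v).
Proof.
case: (dualP xi) (dualP eta) => xiD xiZ [etaD etaZ].
by split=> [u v|a v]; rewrite ?xiD ?etaD 1?addrACA ?xiZ ?etaZ ?mulrDl.
Qed.

Fact dual_scale_subproof (a : D) (xi : dual) : is_linear_form (fun v => J a * xi v).
Proof.
case: (dualP xi) => xiD xiZ.
by split=> [u v|b v]; rewrite ?xiD ?mulrDr ?xiZ ?mulrA.
Qed.

Definition dual_zero := Dual dual_zero_subproof.
Definition dual_opp xi := Dual (dual_opp_subproof xi).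
Definition dual_add xi eta := Dual (dual_add_subproof xi eta).
Definition dual_scale (a : D^c) xi := Dual (dual_scale_subproof a xi).

Fact dual_addA : associative dual_add.
Proof. by move=> x y z; apply: dual_eq => v /=; rewrite addrA. Qed.
Fact dual_addC : commutative dual_add.
Proof. by move=> x y; apply: dual_eq => v /=; rewrite addrC. Qed.
Fact dual_add0 : left_id dual_zero dual_add.
Proof. by move=> x; apply: dual_eq => v /=; rewrite add0r. Qed.
Fact dual_addN : left_inverse dual_zero dual_opp dual_add.
Proof. by move=> x; apply: dual_eq => v /=; rewrite addNr. Qed.

HB.instance Definition _ :=
  GRing.isZmodule.Build dual dual_addA dual_addC dual_add0 dual_addN.

Fact dual_scaleA (a b : D^c) xi :
  dual_scale a (dual_scale b xi) = dual_scale (a * b) xi.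
Proof.
by apply: dual_eq => v /=; rewrite mulrA -inv_mul.
Qed.
Fact dual_scale1 : left_id 1 dual_scale.
Proof. by move=> x; apply: dual_eq => v /=; rewrite inv1 mul1r. Qed.
Fact dual_scaleDr : right_distributive dual_scale +%R.
Proof. by move=> a x y; apply: dual_eq => v /=; rewrite mulrDr. Qed.
Fact dual_scaleDl xi : {morph dual_scale^~ xi : a b / a + b}.
Proof. by move=> a b; apply: dual_eq => v /=; rewrite inv_add mulrDl. Qed.

HB.instance Definition _ := GRing.Zmodule_isLmodule.Build D^c dual
  dual_scaleA dual_scale1 dual_scaleDr dual_scaleDl.

Definition hyp_form (delta : D) (u v : X * dual) : D :=
  u.2 v.1 + J (v.2 u.1) * delta.

End Dual.

Definition hyperbolic (delta : D) (M : rmodType D) (h : M -> M -> D) : Prop :=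
  hermitian delta h /\
  exists X : rmodType D, fin_dim X /\ isometric (@hyp_form X delta) h.

(* The form u^J t v on the right module D^n of column vectors. *)
Definition mx_form n (t : 'M[D]_n) (u v : 'cV[D^c]_n) : D :=
  \sum_i \sum_j J (u i 0) * t i j * v j 0.

End Hermitian.

(* Every finite dimensional form is isometric to a matrix form on some D^n,
   so matrix forms represent all isomorphism classes. *)
Section WittMonoid.
Variables (D : nzRingType) (J : involution D) (eps : D).

Record mform := MForm {
  mf_dim : nat;
  mf_mx : 'M[D]_mf_dim;
  mf_herm : forall i j, mf_mx i j = J (mf_mx j i) * eps;
  mf_nondeg : nondegenerate (mx_form J mf_mx) }.

HB.instance Definition _ := gen_eqMixin mform.
HB.instance Definition _ := gen_choiceMixin mform.

Definition mf_form (a : mform) := mx_form J (mf_mx a).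
Arguments mf_form : clear implicits.

Definition mf_iso (a b : mform) : bool := `[< isometric (mf_form a) (mf_form b) >].

Fact mf_iso_equiv : equiv_class_of mf_iso.
Proof.
split=> [a|a b|b a c].
- by apply/asboolP; exact: isometric_refl.
- by apply/asboolP/asboolP; exact: isometric_sym.
- move=> /asboolP ab /asboolP bc; apply/asboolP; exact: isometric_trans ab bc.
Qed.

Canonical mf_iso_equivRel := EquivRelPack mf_iso_equiv.
Canonical mf_iso_encModRel := defaultEncModRel mf_iso.

Definition iso_class := {eq_quot mf_iso}.

HB.instance Definition _ : EqQuotient mform mf_iso iso_class :=
  EqQuotient.on iso_class.
HB.instance Definition _ := Choice.on iso_class.

Lemma iso_classP (a b : mform) :
  \pi_iso_class a = \pi_iso_class b <-> isometric (mf_form a) (mf_form b).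
Proof.
split=> [/eqP|ab]; first by rewrite piE => /asboolP.
by apply/eqP; rewrite piE; apply/asboolP.
Qed.

Lemma mx_form_block m n (s : 'M[D]_m) (t : 'M[D]_n) (u v : 'cV[D^c]_(m + n)) :
  mx_form J (block_mx s 0 0 t) u v =
  mx_form J s (usubmx u) (usubmx v) + mx_form J t (dsubmx u) (dsubmx v).
Proof.
rewrite /mx_form big_split_ord /=; congr (_ + _); apply: eq_bigr => i _.
  rewrite big_split_ord /= [X in _ + X]big1 ?addr0 => [|j _].
    by apply: eq_bigr => j _; rewrite block_mxEul !mxE.
  by rewrite block_mxEur mxE mulr0 mul0r.
rewrite big_split_ord /= big1 ?add0r => [|j _].
  by apply: eq_bigr => j _; rewrite block_mxEdr !mxE.
by rewrite block_mxEdl mxE mulr0 mul0r.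
Qed.

Lemma mx_form0r n (t : 'M[D]_n) u : mx_form J t u 0 = 0.
Proof. by rewrite /mx_form big1 // => i _; rewrite big1 // => j _; rewrite mxE mulr0. Qed.

Lemma isometric_block m n (s : 'M[D]_m) (t : 'M[D]_n) :
  isometric (mx_form J (block_mx s 0 0 t)) (osum (mx_form J s) (mx_form J t)).
Proof.
pose F (u : 'cV[D^c]_(m + n)) : 'cV[D^c]_m * 'cV[D^c]_n := (usubmx u, dsubmx u).
have Fl : linear F by move=> a u v; congr pair; apply/matrixP => i j; rewrite !mxE.
exists (HB.pack_for {linear 'cV[D^c]_(m + n) -> ('cV[D^c]_m * 'cV[D^c]_n)%type} F
  (GRing.isLinear.Build _ _ _ _ F Fl)); split=> /= [|u v]; last first.
  by rewrite mx_form_block.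
exists (fun u => col_mx u.1 u.2) => [u|[u1 u2]]; rewrite /F /= ?vsubmxK //.
by rewrite col_mxKu col_mxKd.
Qed.

Fact mf_add_herm (a b : mform) i j :
  block_mx (mf_mx a) 0 0 (mf_mx b) i j =
  J (block_mx (mf_mx a) 0 0 (mf_mx b) j i) * eps.
Proof.
case: (split_ordP i) (split_ordP j) => i' -> [] j' ->;
by rewrite ?block_mxEul ?block_mxEur ?block_mxEdl ?block_mxEdr -?mf_herm //
  !mxE inv0 mul0r.
Qed.

Fact mf_add_nondeg (a b : mform) :
  nondegenerate (mx_form J (block_mx (mf_mx a) 0 0 (mf_mx b))).
Proof.
move=> u u0; rewrite -[u]vsubmxK.
have -> : usubmx u = 0.
  apply: (mf_nondeg (m := a)) => v; have := u0 (col_mx v 0).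
  by rewrite mx_form_block col_mxKu col_mxKd mx_form0r addr0.
have -> : dsubmx u = 0.
  apply: (mf_nondeg (m := b)) => v; have := u0 (col_mx 0 v).
  by rewrite mx_form_block col_mxKu col_mxKd mx_form0r add0r.
by rewrite col_mx0.
Qed.

Definition mf_add (a b : mform) : mform :=
  MForm (@mf_add_herm a b) (@mf_add_nondeg a b).

Fact mf_zero_herm i j : (0 : 'M[D]_0) i j = J ((0 : 'M[D]_0) j i) * eps.
Proof. by case: i. Qed.

Fact mf_zero_nondeg : nondegenerate (mx_form J (0 : 'M[D]_0)).
Proof. by move=> u _; apply/matrixP => -[]. Qed.

Definition mf_zero : mform := MForm mf_zero_herm mf_zero_nondeg.

Lemma mf_addE a b :
  isometric (mf_form (mf_add a b)) (osum (mf_form a) (mf_form b)).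
Proof. exact: isometric_block. Qed.

Definition iso_add (x y : iso_class) : iso_class :=
  \pi_iso_class (mf_add (repr x) (repr y)).

Lemma iso_addE a b :
  iso_add (\pi_iso_class a) (\pi_iso_class b) = \pi_iso_class (mf_add a b).
Proof.
apply/iso_classP; apply: isometric_trans (mf_addE _ _) _.
apply: isometric_trans (isometric_sym (mf_addE _ _)).
by apply: isometric_osum; apply/iso_classP; rewrite reprK.
Qed.

Fact iso_addA : associative iso_add.
Proof.
elim/quotW=> x; elim/quotW=> y; elim/quotW=> z.
rewrite (iso_addE y z) (iso_addE x y) !iso_addE; apply/iso_classP.
apply: isometric_trans (mf_addE _ _) _.
apply: isometric_trans; first exact: isometric_osum (isometric_refl _) (mf_addE _ _).
apply: isometric_trans (isometric_osumA _ _ _) _.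
apply: isometric_trans (isometric_sym (mf_addE _ _)).
by apply: isometric_osum; [apply: isometric_sym; apply: mf_addE | exact: isometric_refl].
Qed.

Fact iso_addC : commutative iso_add.
Proof.
elim/quotW=> x; elim/quotW=> y; rewrite !iso_addE; apply/iso_classP.
apply: isometric_trans (mf_addE _ _) _.
apply: isometric_trans (isometric_sym (mf_addE _ _)).
exact: isometric_osumC.
Qed.

Fact iso_add0 : left_id (\pi_iso_class mf_zero) iso_add.
Proof.
elim/quotW=> a; rewrite iso_addE; apply/iso_classP.
apply: isometric_trans (mf_addE _ _) _.
pose F (u : 'cV[D^c]_0 * 'cV[D^c]_(mf_dim a)) := u.2.
have Fl : linear F by [].
exists (HB.pack_for {linear ('cV[D^c]_0 * 'cV[D^c]_(mf_dim a))%type ->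
  'cV[D^c]_(mf_dim a)} F (GRing.isLinear.Build _ _ _ _ F Fl)).
split=> /= [|u v]; last by rewrite /osum /= /mf_form {2}/mx_form big_ord0 add0r.
exists (fun u => (0, u)) => [[u v]|//]; rewrite /F /=; congr pair.
by apply/matrixP => -[].
Qed.

HB.instance Definition _ :=
  GRing.isNmodule.Build iso_class iso_addA iso_addC iso_add0.

End WittMonoid.

Arguments mf_form {D J eps} a.

Section GroupCompletion.
Variable N : nmodType.

Definition gc_rel (x y : N * N) : bool :=
  `[< exists e, x.1 + y.2 + e = y.1 + x.2 + e >].

Fact gc_rel_equiv : equiv_class_of gc_rel.
Proof.
split=> [x|x y|y x z].
- by apply/asboolP; exists 0.
- by apply/asboolP/asboolP => -[e xy]; exists e.
move=> /asboolP[e xy] /asboolP[f yz]; apply/asboolP; exists (e + f + y.1 + y.2).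
rewrite ((@GRing.add N).[AC (2*4) ((1*6*3)*(5*2*4))]) xy yz.
by rewrite ((@GRing.add N).[AC (3*3) ((4*2)*(3*6*1*5))]).
Qed.

Canonical gc_equivRel := EquivRelPack gc_rel_equiv.
Canonical gc_encModRel := defaultEncModRel gc_rel.

Definition group_completion := {eq_quot gc_rel}.

HB.instance Definition _ : EqQuotient (N * N)%type gc_rel group_completion :=
  EqQuotient.on group_completion.
HB.instance Definition _ := Choice.on group_completion.

Local Notation gcl := \pi_group_completion.

Lemma group_completionP (x y : N * N) :
  gcl x = gcl y <-> exists e, x.1 + y.2 + e = y.1 + x.2 + e.
Proof.
split=> [/eqP|xy]; first by rewrite piE => /asboolP.
by apply/eqP; rewrite piE; apply/asboolP.
Qed.

Definition gc_add (x y : group_completion) : group_completion :=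
  gcl ((repr x).1 + (repr y).1, (repr x).2 + (repr y).2).

Definition gc_opp (x : group_completion) : group_completion :=
  gcl ((repr x).2, (repr x).1).

Lemma gc_addE x y : gc_add (gcl x) (gcl y) = gcl (x.1 + y.1, x.2 + y.2).
Proof.
rewrite /gc_add.
have /group_completionP[e xe] : gcl (repr (gcl x)) = gcl x by rewrite reprK.
have /group_completionP[f yf] : gcl (repr (gcl y)) = gcl y by rewrite reprK.
apply/group_completionP; exists (e + f) => /=.
rewrite ((@GRing.add N).[AC (2*2*2) ((1*3*5)*(2*4*6))]) xe yf.
by rewrite ((@GRing.add N).[AC (3*3) ((1*4)*(2*5)*(3*6))]).
Qed.

Lemma gc_oppE x : gc_opp (gcl x) = gcl (x.2, x.1).
Proof.
rewrite /gc_opp.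
have /group_completionP[e xe] : gcl (repr (gcl x)) = gcl x by rewrite reprK.
by apply/group_completionP; exists e => /=; rewrite [_ + x.1]addrC -xe [x.2 + _]addrC.
Qed.

Fact gc_addA : associative gc_add.
Proof.
elim/quotW=> x; elim/quotW=> y; elim/quotW=> z.
by rewrite (gc_addE y z) (gc_addE x y) !gc_addE /= !addrA.
Qed.
Fact gc_addC : commutative gc_add.
Proof.
by elim/quotW=> x; elim/quotW=> y; rewrite !gc_addE [x.1 + _]addrC [x.2 + _]addrC.
Qed.
Fact gc_add0 : left_id (gcl (0, 0)) gc_add.
Proof. by elim/quotW=> -[x y]; rewrite gc_addE /= !add0r. Qed.
Fact gc_addN : left_inverse (gcl (0, 0)) gc_opp gc_add.
Proof.
elim/quotW=> x; rewrite gc_oppE gc_addE; apply/group_completionP.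
by exists 0; rewrite /= !addr0 !add0r addrC.
Qed.

HB.instance Definition _ := GRing.isZmodule.Build group_completion
  gc_addA gc_addC gc_add0 gc_addN.

Definition to_completion (x : N) : group_completion := gcl (x, 0).

End GroupCompletion.

Section GeneratedSubgroup.
Variables (V : zmodType) (S : set V).

Definition is_subgroup (H : set V) : Prop :=
  H 0 /\ forall x y, H x -> H y -> H (x - y).

Definition generated : {pred V} :=
  [pred x | `[< forall H : set V, is_subgroup H -> (S `<=` H)%classic -> H x >]].

Fact generated_zmod_closed : zmod_closed generated.
Proof.
split=> [|x y /asboolP Sx /asboolP Sy].
  by apply/asboolP=> H [].
by apply/asboolP => H Hg SH; apply: Hg.2; [apply: Sx | apply: Sy].
Qed.

HB.instance Definition _ := GRing.isZmodClosed.Build V generated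
  generated_zmod_closed.

End GeneratedSubgroup.

Section Witt.
Variables (D : nzRingType) (J : involution D) (eps : D).

Definition hyperbolic_classes : set (group_completion (iso_class J eps)) :=
  [set x | exists a : mform J eps, hyperbolic J eps (mf_form a) /\
     x = to_completion (\pi_(iso_class J eps) a)]%classic.

Definition witt := {ideal_quot generated hyperbolic_classes}.

HB.instance Definition _ := GRing.Zmodule.on witt.

Definition witt_class (x : iso_class J eps) : witt := \pi_witt (to_completion x).

End Witt.

Section GModules.
Variable G : groupType.

Record gmodule := GModule {
  gm_sort :> zmodType;
  gm_act : G -> gm_sort -> gm_sort;
  gm_actD : forall g, {morph gm_act g : x y / x + y};
  gm_act1 : gm_act 1%g =1 id;
  gm_actM : forall g h x, gm_act (g * h)%g x = gm_act g (gm_act h x) }.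

Definition is_ghom (M N : gmodule) (f : M -> N) : Prop :=
  {morph f : x y / x + y} /\ forall g x, f (gm_act g x) = gm_act g (f x).

Definition projective (P : gmodule) : Prop :=
  forall (M N : gmodule) (p : M -> N) (f : P -> N),
    is_ghom p -> (forall y, exists x, p x = y) -> is_ghom f ->
  exists2 f' : P -> M, is_ghom f' & forall x, p (f' x) = f x.

Section Trivial.
Variable A : zmodType.
Fact triv_actD (g : G) : {morph (fun x : A => x) : x y / x + y}.
Proof. by []. Qed.
Definition triv_gmodule : gmodule :=
  @GModule A (fun _ x => x) triv_actD (frefl id) (fun _ _ _ => erefl).
End Trivial.

Record gcomplex := GComplex {
  gc_mod :> nat -> gmodule;
  gc_d : forall n, gc_mod n.+1 -> gc_mod n;
  gc_ghom : forall n, is_ghom (@gc_d n);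
  gc_dd : forall n x, gc_d (gc_d (n := n.+1) x) = 0 }.

Record resolution := Resolution {
  res_cx :> gcomplex;
  res_aug : res_cx 0%N -> triv_gmodule int;
  res_aug_ghom : is_ghom res_aug;
  res_aug_surj : forall k, exists x, res_aug x = k;
  res_aug_d : forall x, res_aug (gc_d x) = 0;
  res_exact0 : forall x, res_aug x = 0 -> exists y, x = gc_d y;
  res_exact : forall n (x : res_cx n.+1), gc_d x = 0 -> exists y, x = gc_d y;
  res_proj : forall n, projective (res_cx n) }.

(* The complex with Z in degree 0 and zero modules ['rV_0] elsewhere. *)
Definition Z_mod (n : nat) : gmodule :=
  if n is 0 then triv_gmodule int else triv_gmodule 'rV[int]_0.

Definition Z_d n (x : Z_mod n.+1) : Z_mod n := 0.

Fact Z_ghom n : is_ghom (@Z_d n).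
Proof. by case: n => [|n]; split=> [x y|g x]; rewrite /Z_d ?addr0. Qed.

Definition Z_complex : gcomplex :=
  @GComplex Z_mod Z_d Z_ghom (fun n x => erefl).

End GModules.

Arguments gc_d {G} _ {n} _.

(* [Hom_Z(P_* (x)_G C_*, A)]: by the universal property of the tensor product
   over Z[G], a homomorphism from [P_p (x)_G C_q] to [A] is a biadditive map
   [f] with [f (g x) (g z) = f x z], the left modules [P_p] being made into
   right modules by inversion.  A cochain of degree [n] is a family [f] of such
   maps, indexed by [p] and [q], which is zero outside of [p + q = n]. *)
Section EquivariantCohomology.
Variables (G : groupType) (P : resolution G) (C : gcomplex G) (A : zmodType).

Definition bicochain : Type := forall p q : nat, P p -> C q -> A.

HB.instance Definition _ := gen_eqMixin bicochain.
HB.instance Definition _ := gen_choiceMixin bicochain.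

Lemma bicochain_eq (f g : bicochain) :
  (forall p q x z, f p q x z = g p q x z) -> f = g.
Proof.
by move=> fg; do 2![apply: functional_extensionality_dep => ?]; apply/funeq2P.
Qed.

Definition bc_zero : bicochain := fun p q x z => 0.
Definition bc_opp (f : bicochain) : bicochain := fun p q x z => - f p q x z.
Definition bc_add (f g : bicochain) : bicochain :=
  fun p q x z => f p q x z + g p q x z.

Fact bc_addA : associative bc_add.
Proof. by move=> f g h; apply: bicochain_eq => *; rewrite /bc_add addrA. Qed.
Fact bc_addC : commutative bc_add.
Proof. by move=> f g; apply: bicochain_eq => *; rewrite /bc_add addrC. Qed.
Fact bc_add0 : left_id bc_zero bc_add.
Proof. by move=> f; apply: bicochain_eq => *; rewrite /bc_add add0r. Qed.
Fact bc_addN : left_inverse bc_zero bc_opp bc_add.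
Proof. by move=> f; apply: bicochain_eq => *; rewrite /bc_add addNr. Qed.

HB.instance Definition _ :=
  GRing.isZmodule.Build bicochain bc_addA bc_addC bc_add0 bc_addN.

Definition is_cochain (n : nat) (f : bicochain) : Prop :=
  [/\ forall p q x x' z, f p q (x + x') z = f p q x z + f p q x' z,
      forall p q x z z', f p q x (z + z') = f p q x z + f p q x z',
      forall p q (g : G) x z, f p q (gm_act g x) (gm_act g z) = f p q x z &
      forall p q x z, (p + q)%N <> n -> f p q x z = 0].

(* [f] composed with the differential
   [d (x (x) z) = d x (x) z + (-1)^p x (x) d z] of the total complex. *)
Definition total_d (f : bicochain) : bicochain := fun p q x z =>
  match p return P p -> A with
  | 0 => fun=> 0
  | p'.+1 => fun x => f p' q (gc_d P x) z
  end x +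
  match q return C q -> A with
  | 0 => fun=> 0
  | q'.+1 => fun z => f p q' x (gc_d C z) *~ (-1) ^+ p
  end z.

Definition cocycles (n : nat) : {pred bicochain} :=
  [pred f | `[< is_cochain n f /\ total_d f = 0 >]].

Lemma is_cochainB n f g :
  is_cochain n f -> is_cochain n g -> is_cochain n (f - g).
Proof.
have subE p q x z : (f - g) p q x z = f p q x z - g p q x z by [].
move=> [f1 f2 f3 f4] [g1 g2 g3 g4]; split=> *; rewrite !subE.
- by rewrite f1 g1 opprD addrACA.
- by rewrite f2 g2 opprD addrACA.
- by rewrite f3 g3.
- by rewrite f4 ?g4 ?subr0.
Qed.

Lemma is_cochain0 n : is_cochain n 0.
Proof. by split=> *; rewrite [LHS]/(0 : A) ?[RHS]addr0. Qed.

Lemma total_dB f g : total_d (f - g) = total_d f - total_d g.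
Proof.
have subE (h k : bicochain) p q x z : (h - k) p q x z = h p q x z - k p q x z by [].
apply: bicochain_eq => -[|p] [|q] x z; rewrite subE /total_d ?subE ?mulrzBl.
- by rewrite !addr0 subr0.
- by rewrite !add0r.
- by rewrite !addr0.
- by rewrite opprD addrACA.
Qed.

Lemma total_d0 : total_d 0 = 0.
Proof. by rewrite -[X in total_d X](subrr 0) total_dB subrr. Qed.

Fact cocycles_zmod_closed n : zmod_closed (cocycles n).
Proof.
split=> [|f g /asboolP[fn f0] /asboolP[gn g0]]; apply/asboolP.
  by split; [exact: is_cochain0 | exact: total_d0].
by split; [exact: is_cochainB | rewrite total_dB f0 g0 subrr].
Qed.

HB.instance Definition _ n := GRing.isZmodClosed.Build bicochain (cocycles n)
  (cocycles_zmod_closed n).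

Record cocycle n := Cocycle {
  cocycle_val :> bicochain;
  cocycleP : cocycle_val \in cocycles n }.

HB.instance Definition _ n := [isSub for @cocycle_val n].
HB.instance Definition _ n := [Choice of cocycle n by <:].
HB.instance Definition _ n := [SubChoice_isSubZmodule of cocycle n by <:].

Definition coboundaries n : {pred cocycle n} :=
  [pred f | `[< if n is m.+1
                then exists2 g, is_cochain m g & \val f = total_d g
                else f = 0 >]].
Arguments coboundaries : clear implicits.

Fact coboundaries_zmod_closed n : zmod_closed (coboundaries n).
Proof.
split=> [|f g /asboolP fB /asboolP gB]; apply/asboolP.
  by case: n => // n; exists 0; rewrite ?total_d0 //; exact: is_cochain0.
case: n f g fB gB => [f g -> ->|n f g [f' f'n fE] [g' g'n gE]]; first by rewrite subr0.
exists (f' - g'); first exact: is_cochainB.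
by rewrite raddfB /= fE gE total_dB.
Qed.

HB.instance Definition _ n := GRing.isZmodClosed.Build (cocycle n)
  (coboundaries n) (coboundaries_zmod_closed n).

Definition cohomology n := {ideal_quot coboundaries n}.

HB.instance Definition _ n := GRing.Zmodule.on (cohomology n).

(* The class of a cocycle [f]; by convention it is 0 when [f] is not a cocycle
   of degree [n]. *)
Definition coh_class n (f : bicochain) : cohomology n :=
  \pi_(cohomology n) (insubd (0 : cocycle n) f).

Definition coh_repr n (c : cohomology n) : bicochain := \val (repr c).

End EquivariantCohomology.

Arguments cocycles {G} P C A n.
Arguments cohomology {G} P C A n.
Arguments coh_class {G P C A} n f.

(* H^n(G; A), computed with the resolution P. *)
Definition group_cohomology (G : groupType) (P : resolution G) (A : zmodType) n :=
  cohomology P (Z_complex G) A n.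

(* Chain maps over a group homomorphism [i : H -> G]. *)
Record gchain_map (H G : groupType) (i : H -> G) (C : gcomplex H) (C' : gcomplex G)
    := GChainMap {
  cm_fun :> forall n, C n -> C' n;
  cm_D : forall n, {morph @cm_fun n : x y / x + y};
  cm_act : forall n h x, @cm_fun n (gm_act h x) = gm_act (i h) (@cm_fun n x);
  cm_d : forall n x, gc_d C' (@cm_fun n.+1 x) = @cm_fun n (gc_d C x) }.

Arguments cm_fun {H G i C C'} _ n _.

Definition res_map (H G : groupType) (i : H -> G) (P : resolution H)
    (P' : resolution G) (phi : gchain_map i P P') : Prop :=
  forall x, res_aug (phi 0%N x) = res_aug x.

Section Pullback.
Variables (H G : groupType) (i : H -> G) (A : zmodType).
Variables (P : resolution H) (P' : resolution G) (C : gcomplex H) (C' : gcomplex G).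
Variables (phi : gchain_map i P P') (psi : gchain_map i C C').

Definition bc_pull (f : bicochain P' C' A) : bicochain P C A :=
  fun p q x z => f p q (phi p x) (psi q z).

Lemma bc_pull_cochain n f : is_cochain n f -> is_cochain n (bc_pull f).
Proof.
move=> [f1 f2 f3 f4]; split=> *; rewrite /bc_pull ?cm_D ?cm_act.
- exact: f1.
- exact: f2.
- exact: f3.
- exact: f4.
Qed.

Lemma bc_pull_d f : bc_pull (total_d f) = total_d (bc_pull f).
Proof.
by apply: bicochain_eq => -[|p] [|q] x z; rewrite /bc_pull /total_d ?cm_d.
Qed.

Lemma bc_pull0 : bc_pull 0 = 0. Proof. by []. Qed.

Lemma bc_pull_cocycle n (f : bicochain P' C' A) :
  f \in cocycles P' C' A n -> bc_pull f \in cocycles P C A n.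
Proof.
move=> /asboolP[fn f0]; apply/asboolP; split; first exact: bc_pull_cochain.
by rewrite -bc_pull_d f0 bc_pull0.
Qed.

Definition coh_pull n (c : cohomology P' C' A n) : cohomology P C A n :=
  coh_class n (bc_pull (coh_repr c)).

(* [coh_pull] is well defined. *)
Lemma coh_pullE n (f : cocycle P' C' A n) :
  coh_pull (\pi_(cohomology P' C' A n) f) = coh_class n (bc_pull f).
Proof.
rewrite /coh_pull /coh_repr /coh_class.
set g := repr _.
have /eqP : g = f %[mod cohomology P' C' A n] by rewrite reprK.
rewrite -Quotient.idealrBE => /asboolP fg.
apply/eqP; rewrite -Quotient.idealrBE; apply/asboolP.
have pullB (h k : bicochain P' C' A) : bc_pull (h - k) = bc_pull h - bc_pull k by [].
have E : \val (insubd (0 : cocycle P C A n) (bc_pull (\val g))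
    - insubd 0 (bc_pull f)) = bc_pull (\val (g - f)).
  by rewrite !raddfB /= !insubdK ?pullB //; apply/bc_pull_cocycle/cocycleP.
case: n f g fg E => [|n] f g fg E.
  by apply: val_inj; rewrite E fg.
case: fg => k kn fgE; exists (bc_pull k); first exact: bc_pull_cochain.
by rewrite E fgE bc_pull_d.
Qed.

End Pullback.

Fact id_chain_D G (C : gcomplex G) n : {morph (fun x : C n => x) : x y / x + y}.
Proof. by []. Qed.

Definition id_chain_map G (C : gcomplex G) : gchain_map id C C :=
  @GChainMap G G id C C (fun _ x => x) (@id_chain_D G C)
    (fun _ _ _ => erefl) (fun _ _ => erefl).

(* For trivial coefficients, the restriction map along [i] is induced by any
   [i]-equivariant chain map [phi] of resolutions that respects the
   augmentations; it does not depend on [phi]. *)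
Section Restriction.
Variables (H G : groupType) (i : H -> G) (P : resolution H) (P' : resolution G).
Variable phi : gchain_map i P P'.

Definition Z_map n : Z_complex H n -> Z_complex G n :=
  if n is 0 then fun x => x else fun x => x.

Fact Z_map_D n : {morph @Z_map n : x y / x + y}.
Proof. by case: n. Qed.
Fact Z_map_act n h x : @Z_map n (gm_act h x) = gm_act (i h) (Z_map x).
Proof. by case: n x. Qed.
Fact Z_map_d n x : gc_d (Z_complex G) (@Z_map n.+1 x) = Z_map (gc_d (Z_complex H) x).
Proof. by case: n x. Qed.

Definition Z_chain_map : gchain_map i (Z_complex H) (Z_complex G) :=
  @GChainMap H G i _ _ Z_map Z_map_D Z_map_act Z_map_d.

Definition restriction (A : zmodType) n :
  group_cohomology P' A n -> group_cohomology P A n :=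
  @coh_pull H G i A P P' _ _ phi Z_chain_map n.

End Restriction.

Section FlagComplex.
Variable G : groupType.

Record ggraph := GGraph {
  vertex :> Type;
  adj : vertex -> vertex -> Prop;
  vact : G -> vertex -> vertex;
  vact1 : vact 1%g =1 id;
  vactM : forall g h x, vact (g * h)%g x = vact g (vact h x);
  adj_vact : forall g x y, adj x y -> adj (vact g x) (vact g y) }.

Variable Gamma : ggraph.

Record simplex (k : nat) := Simplex {
  spx :> 'I_k.+1 -> Gamma;
  spxP : forall i j, spx i = spx j \/ adj (spx i) (spx j) }.

HB.instance Definition _ k := gen_eqMixin (simplex k).
HB.instance Definition _ k := gen_choiceMixin (simplex k).

Lemma simplex_eq k (s t : simplex k) : s =1 t -> s = t.
Proof.
case: s t => [s sP] [t tP] /= /funext st; case: _ / st tP => tP.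
by congr Simplex; exact: Prop_irrelevance.
Qed.

Fact face_subproof k (i : 'I_k.+2) (s : simplex k.+1) (j j' : 'I_k.+1) :
  s (fintype.lift i j) = s (fintype.lift i j') \/ adj (s (fintype.lift i j)) (s (fintype.lift i j')).
Proof. exact: spxP. Qed.

Definition face k (i : 'I_k.+2) (s : simplex k.+1) : simplex k :=
  Simplex (face_subproof i s).

Fact sact_subproof k (g : G) (s : simplex k) i j :
  vact g (s i) = vact g (s j) \/ adj (vact g (s i)) (vact g (s j)).
Proof. by case: (spxP s i j) => [->|/(adj_vact g)]; [left | right]. Qed.

Definition sact k (g : G) (s : simplex k) : simplex k :=
  Simplex (sact_subproof g s).

(* The additive extension of [c] to the free abelian group on [K];
   [zmodule M] is [M] as a Z-module. *)
Definition fgext (K : choiceType) (M : zmodType) (c : K -> M) (z : {freeg K}) : M :=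
  fglift (c : K -> zmodule M) z.

Lemma fgextB (K : choiceType) (M : zmodType) (c : K -> M) :
  {morph fgext c : x y / x - y}.
Proof. exact: (lift_is_additive (c : K -> zmodule M)). Qed.

Lemma fgext0 (K : choiceType) (M : zmodType) (c : K -> M) : fgext c 0 = 0.
Proof. by rewrite -(subrr (0 : {freeg K})) fgextB subrr. Qed.

Lemma fgextN (K : choiceType) (M : zmodType) (c : K -> M) x :
  fgext c (- x) = - fgext c x.
Proof. by rewrite -[- x]sub0r fgextB fgext0 sub0r. Qed.

Lemma fgextD (K : choiceType) (M : zmodType) (c : K -> M) :
  {morph fgext c : x y / x + y}.
Proof. by move=> x y; rewrite -[y in LHS]opprK fgextB fgextN opprK. Qed.

Lemma fgextU (K : choiceType) (M : zmodType) (c : K -> M) k :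
  fgext c << k >> = c k.
Proof. by rewrite /fgext liftU scale1r. Qed.

Lemma fgextMz (K : choiceType) (M : zmodType) (c : K -> M) x (m : int) :
  fgext c (x *~ m) = fgext c x *~ m.
Proof.
have MnE n : fgext c (x *+ n) = fgext c x *+ n.
  by elim: n => [|n IHn]; rewrite ?fgext0 // !mulrS fgextD IHn.
by case: m => n; rewrite ?NegzE ?mulrNz ?fgextN -!pmulrn MnE.
Qed.

Lemma fgext_sum (K : choiceType) (M : zmodType) (c : K -> M) (I : finType)
    (P : pred I) (F : I -> {freeg K}) :
  fgext c (\sum_(i | P i) F i) = \sum_(i | P i) fgext c (F i).
Proof. by apply: (big_morph _ (fgextD c) (fgext0 c)). Qed.

Lemma additive_freeg_eq (K : choiceType) (M : zmodType) (f g : {freeg K} -> M) :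
  {morph f : x y / x + y} -> {morph g : x y / x + y} ->
  (forall k, f << k >> = g << k >>) -> f =1 g.
Proof.
move=> fD gD fg x.
have f0 : f 0 = 0 by apply: (addrI (f 0)); rewrite -fD !addr0.
have g0 : g 0 = 0 by apply: (addrI (g 0)); rewrite -gD !addr0.
have fN y : f (- y) = - f y by apply: (addrI (f y)); rewrite -fD !subrr f0.
have gN y : g (- y) = - g y by apply: (addrI (g y)); rewrite -gD !subrr g0.
have fgn n y : f y = g y -> f (y *+ n) = g (y *+ n).
  by move=> yy; elim: n => [|n IHn]; rewrite ?f0 ?g0 // !mulrS fD gD yy IHn.
rewrite -(freeg_sumE x).
rewrite (big_morph f fD f0) (big_morph g gD g0); apply: eq_bigr => k _.
have -> : << coeff k x *g k >> = << k >> *~ coeff k x :> {freeg K}.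
  by rewrite freegU_mulz intz.
by case: (coeff k x) => n; rewrite ?NegzE ?mulrNz ?fN ?gN -!pmulrn fgn.
Qed.

Definition boundary k : {freeg (simplex k.+1)} -> {freeg (simplex k)} :=
  fgext (fun s => \sum_(i < k.+2) << (-1) ^+ i *g face i s >>).

Definition chain_act k (g : G) : {freeg (simplex k)} -> {freeg (simplex k)} :=
  fgext (fun s => << sact g s >>).

Fact chain_actD k g : {morph @chain_act k g : x y / x + y}.
Proof. exact: fgextD. Qed.

Fact chain_act1 k : @chain_act k 1%g =1 id.
Proof.
apply: additive_freeg_eq => //; first exact: fgextD.
move=> s; rewrite /chain_act fgextU; congr << _ >>.
by apply: simplex_eq => i /=; rewrite vact1.
Qed.

Fact chain_actM k (g h : G) (x : {freeg (simplex k)}) :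
  chain_act (g * h)%g x = chain_act g (chain_act h x).
Proof.
move: x; apply: additive_freeg_eq => [|x y|s]; rewrite /chain_act ?fgextD //.
  exact: fgextD.
rewrite !fgextU; congr << _ >>.
by apply: simplex_eq => i /=; rewrite vactM.
Qed.

Definition fl_mod (k : nat) : gmodule G :=
  GModule (@chain_actD k) (@chain_act1 k) (@chain_actM k).

Definition fl_d k : fl_mod k.+1 -> fl_mod k := @boundary k.

Fact fl_ghom k : is_ghom (@fl_d k).
Proof.
split=> [|g]; first exact: fgextD.
apply: additive_freeg_eq => [x y|x y|s] /=; rewrite /fl_d /boundary /chain_act ?fgextD //.
rewrite !fgextU fgext_sum; apply: eq_bigr => i _.
have signE (t : simplex k) : << (-1) ^+ i *g t >> = << t >> *~ (-1) ^+ i :> {freeg _}.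
  by rewrite freegU_mulz intz.
rewrite !signE fgextMz fgextU; congr (<< _ >> *~ _).
exact: simplex_eq.
Qed.

Fact fl_dd k (x : fl_mod k.+2) : fl_d (@fl_d k.+1 x) = 0.
Proof.
move: x; apply: (additive_freeg_eq (f := fun x => fl_d (fl_d x)) (g := fun=> 0)).
- by move=> x y; rewrite /fl_d /boundary !fgextD.
- by move=> x y; rewrite addr0.
move=> s; rewrite /fl_d /boundary fgextU fgext_sum.
have signE n (t : simplex n) (i : nat) : << (-1) ^+ i *g t >> = << t >> *~ (-1) ^+ i :> {freeg _}.
  by rewrite freegU_mulz intz.
transitivity (\sum_(i < k.+3) \sum_(j < k.+2)
    (<< face j (face i s) >> : {freeg (simplex k)}) *~ (-1) ^+ (i + j)).
  apply: eq_bigr => i _; rewrite signE fgextMz fgextU mulrz_suml.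
  by apply: eq_bigr => j _; rewrite signE -mulrzA exprD mulrC.
rewrite pair_big /= (bigID (fun ij : 'I_k.+3 * 'I_k.+2 => ij.2 < ij.1)%N) /=.
pose up (ij : 'I_k.+3 * 'I_k.+2) : 'I_k.+3 * 'I_k.+2 :=
  (inord ij.2.+1, inord ij.1).
pose down (ij : 'I_k.+3 * 'I_k.+2) : 'I_k.+3 * 'I_k.+2 :=
  (inord ij.2, inord ij.1.-1).
rewrite (reindex_onto up down) /=; last first.
  move=> [i j] /= ji; have i0 : (0 < i)%N by exact: leq_ltn_trans ji.
  have ik : (i.-1 < k.+2)%N by rewrite -ltnS prednK.
  have jk : (j < k.+3)%N by exact: ltn_trans (ltn_ord j) _.
  congr pair; apply: val_inj; rewrite /= !inordK ?prednK //; exact: (ltn_ord i).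
rewrite (eq_bigl (fun ij : 'I_k.+3 * 'I_k.+2 => ~~ (ij.2 < ij.1)%N)); last first.
  move=> [i j]; rewrite /down /up /= -leqNgt.
  have jk : (j.+1 < k.+3)%N by rewrite ltnS.
  have [ij|ji] := leqP i j.
    have ik : (i < k.+2)%N by exact: leq_ltn_trans ij _.
    rewrite !inordK // ltnS ij; apply/eqP.
    by congr pair; apply: val_inj; rewrite /= !inordK.
  apply/negbTE/negP => /andP[lt /eqP[/(congr1 val) /= iE _]].
  have ik : (i < k.+2)%N by rewrite -iE inordK // (ltn_trans (ltn_ord _)).
  by move: lt; rewrite !inordK // ltnS leqNgt ji.
rewrite -big_split big1 // => -[i j] /=; rewrite -leqNgt => ij.
have jk : (j.+1 < k.+3)%N by rewrite ltnS.
have ik : (i < k.+2)%N by exact: leq_ltn_trans ij _.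
have -> : face (inord i) (face (inord j.+1) s) = face j (face i s).
  apply: simplex_eq => l /=; congr (s _); apply: val_inj => /=.
  rewrite !inordK // /bump; lia.
rewrite !inordK // addSn exprS mulN1r mulrNz addrC [(j + i)%N]addnC.
exact: subrr.
Qed.

Definition fl_complex : gcomplex G := GComplex fl_ghom fl_dd.

(* The augmentation C_*(Fl Gamma) -> Z, which sends each vertex to 1: it is
   induced by the constant map from Fl Gamma to a point. *)
Definition fl_aug n : fl_mod n -> Z_mod G n :=
  if n is 0 then fun x => deg x else fun=> 0.

Fact fl_aug_D n : {morph @fl_aug n : x y / x + y}.
Proof. by case: n => [|n] x y /=; rewrite ?addr0 ?degD. Qed.

Lemma deg_chain_act k g (x : {freeg (simplex k)}) : deg (chain_act g x) = deg x.
Proof.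
move: x; apply: additive_freeg_eq => [x y|x y|s]; rewrite ?degD //.
  by rewrite /chain_act fgextD degD.
by rewrite /chain_act fgextU !degU.
Qed.

Fact fl_aug_act n (h : G) x : @fl_aug n (gm_act h x) = gm_act (id h) (fl_aug x).
Proof. by case: n x => [|n] x //=; rewrite deg_chain_act. Qed.

Fact fl_aug_d n x : gc_d (Z_complex G) (@fl_aug n.+1 x) = fl_aug (gc_d fl_complex x).
Proof.
case: n x => [|n] // x; rewrite /= /Z_d; apply/esym.
move: x; apply: (additive_freeg_eq (f := fun x => deg (fl_d x)) (g := fun=> 0)).
- by move=> x y; rewrite /fl_d /boundary fgextD degD.
- by move=> x y; rewrite addr0.
move=> s; rewrite /fl_d /boundary fgextU big_ord_recl big_ord1.
by rewrite degD !degU.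
Qed.

Definition fl_aug_map : gchain_map id fl_complex (Z_complex G) :=
  @GChainMap G G id fl_complex (Z_complex G) fl_aug fl_aug_D fl_aug_act fl_aug_d.

(* A 2-cochain [c] on [Fl Gamma], viewed as the cochain
   [p (x) z |-> eta p * c z], with [eta] the augmentation of the resolution. *)
Definition inflate2 (P : resolution G) (A : zmodType) (c : simplex 2 -> A) :
    bicochain P fl_complex A :=
  fun p q => match p, q return P p -> fl_complex q -> A with
             | 0%N, 2%N => fun x z => fgext c z *~ res_aug x
             | _, _ => fun _ _ => 0
             end.

End FlagComplex.

Arguments inflate2 {G Gamma} P {A} c.

Section Unitary.
Variables (D : nzRingType) (M : rmodType D) (h : M -> M -> D).

Record unitary := Unitary {
  unitary_fun :> M -> M;
  unitary_inv : M -> M;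
  unitary_linear : linear unitary_fun;
  unitaryK : cancel unitary_fun unitary_inv;
  unitaryVK : cancel unitary_inv unitary_fun;
  unitary_isom : forall u v, h (unitary_fun u) (unitary_fun v) = h u v }.

HB.instance Definition _ := gen_eqMixin unitary.
HB.instance Definition _ := gen_choiceMixin unitary.

Lemma unitary_eq (f g : unitary) : f =1 g -> f = g.
Proof.
case: f g => [f f' fl fK f'K fh] [g g' gl gK g'K gh] /= fg.
have {}fg := funext fg; case: _ / fg gl gK g'K gh => gl gK g'K gh.
have fg' : f' = g' by apply: funext => u; apply: (can_inj gK); rewrite f'K g'K.
by case: _ / fg' gK g'K => *; congr Unitary; exact: Prop_irrelevance.
Qed.

Fact unitary_one_linear : linear (fun u : M => u). Proof. by []. Qed.

Definition unitary_one : unitary :=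
  @Unitary (fun u => u) (fun u => u) unitary_one_linear (frefl _) (frefl _)
    (fun _ _ => erefl).

Section Mul.
Variables f g : unitary.
Fact unitary_mul_linear : linear (f \o g).
Proof. by move=> a u v /=; rewrite !unitary_linear. Qed.
Fact unitary_mul_isom u v : h (f (g u)) (f (g v)) = h u v.
Proof. by rewrite !unitary_isom. Qed.
Definition unitary_mul : unitary :=
  Unitary unitary_mul_linear (can_comp (@unitaryK f) (@unitaryK g))
    (can_comp (@unitaryVK g) (@unitaryVK f)) unitary_mul_isom.

Fact unitary_inv_linear : linear (unitary_inv f).
Proof.
by move=> a u v; apply: (can_inj (@unitaryK f)); rewrite unitary_linear !unitaryVK.
Qed.
Fact unitary_inv_isom u v : h (unitary_inv f u) (unitary_inv f v) = h u v.
Proof. by rewrite -(unitary_isom f) !unitaryVK. Qed.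
Definition unitary_opp : unitary :=
  Unitary unitary_inv_linear (@unitaryVK f) (@unitaryK f) unitary_inv_isom.
End Mul.

Fact unitary_mulA : associative unitary_mul.
Proof. by move=> f g k; apply: unitary_eq. Qed.
Fact unitary_mul1 : left_id unitary_one unitary_mul.
Proof. by move=> f; apply: unitary_eq. Qed.
Fact unitary_mul1r : right_id unitary_one unitary_mul.
Proof. by move=> f; apply: unitary_eq. Qed.
Fact unitary_mulV : left_inverse unitary_one unitary_opp unitary_mul.
Proof. by move=> f; apply: unitary_eq => u /=; rewrite unitaryK. Qed.
Fact unitary_mulrV : right_inverse unitary_one unitary_opp unitary_mul.
Proof. by move=> f; apply: unitary_eq => u /=; rewrite unitaryVK. Qed.

HB.instance Definition _ := isGroup.Build unitary unitary_mulA unitary_mul1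
  unitary_mul1r unitary_mulV unitary_mulrV.

End Unitary.

Section UnitaryInclusion.
Variables (D : nzRingType) (M1 M2 : rmodType D).
Variables (h1 : M1 -> M1 -> D) (h2 : M2 -> M2 -> D) (g : unitary h1).

Fact unitary_incl_linear : linear (fun u : M1 * M2 => (g u.1, u.2)).
Proof. by move=> a u v; rewrite /= unitary_linear. Qed.
Fact unitary_inclK :
  cancel (fun u : M1 * M2 => (g u.1, u.2)) (fun u => (unitary_inv g u.1, u.2)).
Proof. by move=> [u v] /=; rewrite unitaryK. Qed.
Fact unitary_inclVK :
  cancel (fun u => (unitary_inv g u.1, u.2)) (fun u : M1 * M2 => (g u.1, u.2)).
Proof. by move=> [u v] /=; rewrite unitaryVK. Qed.
Fact unitary_incl_isom (u v : M1 * M2) :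
  osum h1 h2 (g u.1, u.2) (g v.1, v.2) = osum h1 h2 u v.
Proof. by rewrite /osum /= unitary_isom. Qed.

Definition unitary_incl : unitary (osum h1 h2) :=
  Unitary unitary_incl_linear unitary_inclK unitary_inclVK unitary_incl_isom.

End UnitaryInclusion.

Arguments unitary_incl {D M1 M2} h1 h2 g.

Section Opposition.
Variables (D : nzRingType) (M : rmodType D) (h : M -> M -> D).
Local Open Scope classical_set_scope.

Definition perp (X : set M) : set M := [set v | forall u, X u -> h u v = 0].

Record lagrangian := Lagrangian {
  lag_set :> set M;
  lag_sub : is_submodule lag_set;
  lag_perp : lag_set = perp lag_set }.

Definition opposite (X Y : lagrangian) : Prop := X `&` Y = [set 0].

Lemma lagrangian_eq (X Y : lagrangian) : X = Y :> set M -> X = Y.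
Proof.
case: X Y => [X Xs Xp] [Y Ys Yp] /= XY; case: _ / XY Ys Yp => Ys Yp.
by congr Lagrangian; exact: Prop_irrelevance.
Qed.

Section Image.
Variables (g : unitary h) (X : lagrangian).

Fact lag_act_sub : is_submodule (g @` X).
Proof.
have [X0 XD XZ] := lag_sub X.
pose gL := HB.pack_for {linear M -> M} (g : M -> M)
  (GRing.isLinear.Build _ _ _ _ (g : M -> M) (@unitary_linear _ _ _ g)).
split=> [|_ _ [u Xu <-] [v Xv <-]|a _ [u Xu <-]].
- by exists 0 => //; exact: (linear0 gL).
- by exists (u + v); [exact: XD | exact: (linearD gL)].
- by exists (a *: u); [exact: XZ | exact: (linearZ_LR gL)].
Qed.

Fact lag_act_perp : g @` X = perp (g @` X).
Proof.
apply/seteqP; split=> [_ [v Xv <-] _ [u Xu <-]|v vX].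
  by rewrite unitary_isom; move: Xv; rewrite lag_perp; apply.
exists (unitary_inv g v); last exact: unitaryVK.
rewrite lag_perp => u Xu; rewrite -(unitary_isom g) unitaryVK; apply: vX.
by exists u.
Qed.

Definition lag_act : lagrangian := Lagrangian lag_act_sub lag_act_perp.

End Image.

Fact lag_act1 : lag_act 1%g =1 id.
Proof. by move=> X; apply: lagrangian_eq; rewrite /= image_id. Qed.

Fact lag_actM (f g : unitary h) X : lag_act (f * g)%g X = lag_act f (lag_act g X).
Proof. by apply: lagrangian_eq; rewrite /= image_comp. Qed.

Fact opposite_act (g : unitary h) X Y :
  opposite X Y -> opposite (lag_act g X) (lag_act g Y).
Proof.
rewrite /opposite /= => XY.
have g0 : g 0 = 0.
  by have := unitary_linear g (-1) 0 0; rewrite scaleN1r oppr0 addr0 scaleN1r addNr.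
apply/seteqP; split=> [_ [[u Xu <-] [v Yv /(can_inj (@unitaryK _ _ _ g)) vu]]|_ ->].
  rewrite vu in Yv; have : (X `&` Y) u by [].
  by rewrite XY => ->.
have [X0 Y0] : (X `&` Y) 0 by rewrite XY.
by split; exists 0.
Qed.

Definition opp_graph : ggraph (unitary h) :=
  GGraph lag_act1 lag_actM opposite_act.

End Opposition.

Section Maslov.
Variables (D : nzRingType) (J : involution D) (eps : D).
Variables (M : rmodType D) (h : M -> M -> D).

(* [a] is the matrix form [t] obtained from [X], [Y], [Z] and some basis of [X]. *)
Definition is_kappa (X Y Z : lagrangian h) (a : mform J eps) : Prop :=
  exists x y : 'I_(mf_dim a) -> M,
    [/\ is_basis X x, is_basis Y y,
        forall mu nu, h (y mu) (x nu) = (mu == nu)%:R &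
        is_basis Z (fun nu => y nu + \sum_mu (mf_mx a mu nu : D^c) *: x mu)].

Definition kappa (X Y Z : lagrangian h) : iso_class J eps :=
  xget 0 [set c | exists2 a, is_kappa X Y Z a & c = \pi_(iso_class J eps) a]%classic.

(* The alternating cochain <X, Y, Z> |-> [kappa (X, Y, Z)], pulled back to the
   chain complex of all simplices: two entries of a simplex that are not
   opposite coincide. *)
Definition maslov_cochain (s : simplex (opp_graph h) 2) : witt J eps :=
  let X := s (inord 0) in let Y := s (inord 1) in let Z := s (inord 2) in
  if `[< [/\ opposite X Y, opposite X Z & opposite Y Z] >]
  then witt_class (kappa X Y Z) else 0.

Variable P : resolution (unitary h).

Definition constant_pull (A : zmodType) n (c : group_cohomology P A n) :
    cohomology P (fl_complex (opp_graph h)) A n :=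
  coh_pull (id_chain_map P) (fl_aug_map (opp_graph h)) c.

(* The preimage of the class of the Maslov cocycle under [constant_pull], which
   is an isomorphism when D^eps is infinite and [h] is hyperbolic. *)
Definition maslov_class : group_cohomology P (witt J eps) 2 :=
  xget 0 [set c | constant_pull c = coh_class 2 (inflate2 P maslov_cochain)]%classic.

End Maslov.

Arguments maslov_class {D} J eps {M h} P.

(* Main.v *)
From HB Require Import structures.
From mathcomp Require Import all_boot all_order all_algebra.
From mathcomp Require Import boolp classical_sets functions cardinality.
From mathcomp Require Import freeg zify.
Require Import Defs.
Set Implicit Arguments.
Unset Strict Implicit.
Unset Printing Implicit Defensive.
Import GRing.Theory.
Local Open Scope ring_scope.
Local Open Scope quotient_scope.

(** Let Gamma_1, Gamma_2, Gamma be the opposition graphs of M_1, M_2 and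
    M = M_1 + M_2.  There is no reasonable map from Gamma_1 to Gamma: adding a
    fixed Lagrangian of M_2 destroys opposition.  Instead one compares both with
    the product graph Gamma_12, whose vertices are pairs (X_1, X_2), where two
    pairs are adjacent when both components are opposite ([prod_graph]).  It
    maps to Gamma by (X_1, X_2) |-> X_1 + X_2 and to each Gamma_i by
    projection; U(M_1) acts on it through the first component.

    The forms kappa add up under orthogonal sums, so the Maslov cochain of M
    restricts to Gamma_12 as the sum of the pullbacks of those of M_1 and M_2
    ([maslov_cochain_sum]).  The second summand is an equivariant coboundary for
    U(M_1): the flag complex of Gamma_2 is acyclic, so the Maslov cocycle of M_2
    is the coboundary of some 1-cochain, and that cochain is invariant because
    U(M_1) acts trivially on Gamma_2.  Hence the classes of the theorem have the
    same image in the equivariant cohomology of Gamma_12, and it remains to see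
    that H^2(U(M_1)) injects into the latter.

    Two facts make the constant maps isomorphisms.  Geometrically, when D^eps is
    infinite, finitely many Lagrangians have a common opposite
    ([common_opposite]): move one member of a hyperbolic pair of Lagrangians by
    a generic diagonal eps-hermitian matrix, one diagonal entry at a time; each
    given Lagrangian forbids at most one value per entry.  So every cycle of the
    flag complex bounds a cone, also for the product graph.
    Homologically, the flag complex then splits as a complex of abelian groups,
    Hom(C_*, A) is exact, and since the modules of a resolution P are projective
    an equivariant pairing of P_p with C_q that vanishes on boundaries factors
    equivariantly through the differential ([equivariant_factor]).  Clearing the
    columns of the double complex one after the other, every cochain whose
    coboundary lives on P_* (x) C_0 is, up to a coboundary, pulled back along the
    augmentation C_* -> Z ([coexact_normal_form]); this contains both
    surjectivity and injectivity.

    Finally the Maslov cochain has to be an invariant cocycle.  In terms of a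
    parametrization beta of Y and the map T with values in X such that Z is the
    image of beta + T, the form kappa(X, Y, Z) is h(beta u, T v) ([kappa_form]).
    For pairwise opposite Lagrangians the cocycle identity is then an isometry
    between orthogonal sums of two forms ([isometric_cocycle]).
    For simplices with repeated vertices it amounts to antisymmetry, that is to
    [t] + [-t] = 0, which holds in any characteristic because t + (-t) + (-t) is
    isometric to the sum of a hyperbolic form and -t
    ([isometric_metabolic]). *)

(** * Equivariant pairings with a projective module *)

Section AdditiveMaps.
Variables (G : groupType) (A : zmodType) (U : gmodule G) (K : set U).

(** The G-module Hom(U / <K>, A), presented as the additive maps on U that vanish
    on the G-stable set K, so that no quotient has to be formed. *)
Definition annihilator : {pred U -> A} :=
  [pred f | `[< {morph f : x y / x + y} /\ forall u, K u -> f u = 0 >]].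

Fact annihilator_zmod_closed : zmod_closed annihilator.
Proof.
have subE (f g : U -> A) u : (f - g) u = f u - g u by [].
split=> [|f g /asboolP[fD fK] /asboolP[gD gK]]; apply/asboolP.
  by split=> [x y|//]; rewrite [RHS]addr0.
split=> [x y|u Ku]; rewrite !subE; last by rewrite fK ?gK ?subrr.
by rewrite fD gD opprD addrACA.
Qed.

HB.instance Definition _ :=
  GRing.isZmodClosed.Build (U -> A) annihilator annihilator_zmod_closed.

Record annihilating := Annihilating {
  ann_fun :> U -> A;
  annP : ann_fun \in annihilator }.

HB.instance Definition _ := [isSub for ann_fun].
HB.instance Definition _ := [Choice of annihilating by <:].
HB.instance Definition _ := [SubChoice_isSubZmodule of annihilating by <:].

Hypothesis KG : forall (g : G) u, K u -> K (gm_act g u).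

Fact ann_act_subproof (g : G) (f : annihilating) :
  (fun u => f (gm_act g^-1%g u)) \in annihilator.
Proof.
have /asboolP[fD fK] := annP f; apply/asboolP; split=> [x y|u Ku].
  by rewrite gm_actD fD.
exact/fK/KG.
Qed.

Definition ann_act g f := Annihilating (ann_act_subproof g f).

Lemma annihilating_eq (f f' : annihilating) : f =1 f' -> f = f'.
Proof. by move=> /funext ff'; apply: val_inj. Qed.

Fact ann_actD g : {morph ann_act g : x y / x + y}.
Proof. by move=> f f'; apply: annihilating_eq. Qed.
Fact ann_act1 : ann_act 1%g =1 id.
Proof. by move=> f; apply: annihilating_eq => u /=; rewrite invg1 gm_act1. Qed.
Fact ann_actM g g' f : ann_act (g * g')%g f = ann_act g (ann_act g' f).
Proof. by apply: annihilating_eq => u /=; rewrite invgM gm_actM. Qed.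

Definition ann_gmodule : gmodule G := GModule ann_actD ann_act1 ann_actM.

End AdditiveMaps.

Arguments annihilator {G} A {U} K.
Arguments annihilating {G} A {U} K.
Arguments ann_gmodule {G} A {U K} KG.

(** An invariant pairing is an equivariant map from P to Hom(U, A), which is how
    the projectivity of P gets applied to it. *)
Definition invariant_pairing (G : groupType) (A : zmodType) (P U : gmodule G)
    (F : P -> U -> A) : Prop :=
  [/\ forall x x' u, F (x + x') u = F x u + F x' u,
      forall x u u', F x (u + u') = F x u + F x u' &
      forall (g : G) x u, F (gm_act g x) (gm_act g u) = F x u].

(** If every additive map on U vanishing on K factors through d, then composition
    with d maps Hom(V, A) onto Hom(U / <K>, A), equivariantly; a pairing F
    vanishing on K is an equivariant map from P to the target, and projectivity
    lifts it to Hom(V, A). *)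
Lemma equivariant_factor (G : groupType) (A : zmodType) (P U V : gmodule G)
    (d : U -> V) (K : set U) :
  projective P -> is_ghom d ->
  (forall (g : G) u, K u -> K (gm_act g u)) -> (forall u, K u -> d u = 0) ->
  (forall f : U -> A, {morph f : x y / x + y} -> (forall u, K u -> f u = 0) ->
    exists2 f' : V -> A, {morph f' : x y / x + y} & forall u, f u = f' (d u)) ->
  forall F : P -> U -> A, invariant_pairing F -> (forall x u, K u -> F x u = 0) ->
  exists2 F' : P -> V -> A, invariant_pairing F' & forall x u, F x u = F' x (d u).
Proof.
move=> projP [dD dG] KG dK exact F [FDl FDr FG] FK.
have set0G (g : G) (v : V) : @set0 V v -> @set0 V (gm_act g v) by [].
have pull_in (f : annihilating A (@set0 V)) : (fun u => f (d u)) \in annihilator A K.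
  have /asboolP[fD _] := annP f; have f0 : f 0 = 0 by apply: (addrI (f 0)); rewrite -fD !addr0.
  by apply/asboolP; split=> [x y|u /dK->//]; rewrite dD fD.
pose p (f : ann_gmodule A set0G) : ann_gmodule A KG := Annihilating (pull_in f).
have Fx_in x : F x \in annihilator A K.
  by apply/asboolP; split=> [u u'|u Ku]; [exact: FDr | exact: FK].
have pG : is_ghom p.
  by split=> [f f'|g f]; apply: annihilating_eq => u //=; rewrite dG.
have p_surj (f : ann_gmodule A KG) : exists f', p f' = f.
  have /asboolP[fD fK] := annP f; have [f' f'D ff'] := exact _ fD fK.
  have f'_in : f' \in annihilator A (@set0 V) by apply/asboolP.
  by exists (Annihilating f'_in); apply: annihilating_eq => u /=; rewrite ff'.
pose FA x : ann_gmodule A KG := Annihilating (Fx_in x).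
have FAG : is_ghom FA.
  split=> [x y|g x]; apply: annihilating_eq => u /=; first exact: FDl.
  by rewrite -(FG g^-1%g) -gm_actM mulVg gm_act1.
have [F' [F'D F'G] F'E] := projP _ _ p FA pG p_surj FAG.
exists (fun x => ann_fun (F' x)) => [|x u]; last by rewrite -[F x]/(ann_fun (FA x)) -F'E.
split=> [x x' v|x v v'|g x v].
- by rewrite F'D.
- by have /asboolP[+ _] := annP (F' x); apply.
- by rewrite F'G /= -gm_actM mulVg gm_act1.
Qed.

(** * Double complexes with coexact second factor *)
Section CochainComplex.
Variables (G : groupType) (P : resolution G) (C : gcomplex G) (A : zmodType).

Lemma total_dD (f g : bicochain P C A) : total_d (f + g) = total_d f + total_d g.
Proof. by rewrite -[g in LHS]opprK total_dB -[- g]sub0r total_dB total_d0 sub0r opprK. Qed.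

Lemma is_cochainD n (f g : bicochain P C A) :
  is_cochain n f -> is_cochain n g -> is_cochain n (f + g).
Proof.
move=> fn gn; rewrite -[g]opprK -[- g]sub0r.
by apply: is_cochainB => //; apply: is_cochainB => //; exact: is_cochain0.
Qed.

Lemma is_cochain0l n f p q (z : C q) : is_cochain n f -> f p q (0 : P p) z = 0 :> A.
Proof. by case=> f1 _ _ _; apply: (addrI (f p q 0 z)); rewrite -f1 !addr0. Qed.

Lemma is_cochain0r n f p q (x : P p) : is_cochain n f -> f p q x (0 : C q) = 0 :> A.
Proof. by case=> _ f2 _ _; apply: (addrI (f p q x 0)); rewrite -f2 !addr0. Qed.

Lemma is_cochain_d n (f : bicochain P C A) : is_cochain n f -> is_cochain n.+1 (total_d f).
Proof.
move=> [f1 f2 f3 f4].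
have dP p : {morph @gc_d _ P p : x y / x + y} by case: (@gc_ghom G P p).
have dC q : {morph @gc_d _ C q : x y / x + y} by case: (@gc_ghom G C q).
have gP p g x : gc_d P (gm_act g x) = gm_act g (gc_d P x) :> P p.
  by case: (@gc_ghom G P p).
have gC q g x : gc_d C (gm_act g x) = gm_act g (gc_d C x) :> C q.
  by case: (@gc_ghom G C q).
split=> [p q x x' z|p q x z z'|p q g x z|p q x z pq].
- case: p x x' => [|p] x x'; case: q z => [|q] z; rewrite /total_d ?dP ?f1 ?addr0 ?add0r //.
  by rewrite mulrzDl addrACA.
- case: p x => [|p] x; case: q z z' => [|q] z z'; rewrite /total_d ?dC ?f2 ?addr0 ?add0r //.
  by rewrite mulrzDl addrACA.
- by case: p x => [|p] x; case: q z => [|q] z; rewrite /total_d ?gP ?gC ?f3.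
- case: p x pq => [|p] x pq; case: q z pq => [|q] z pq; rewrite /total_d ?f4 ?mul0rz ?addr0 //;
   move=> pq'; apply: pq; rewrite -pq'; lia.
Qed.

Lemma total_dd n (f : bicochain P C A) : is_cochain n f -> total_d (total_d f) = 0.
Proof.
move=> fn; apply: bicochain_eq => p q x z; rewrite [RHS]/(0 : A).
case: p x => [|[|p]] x; case: q z => [|[|q]] z; rewrite /total_d ?gc_dd
   ?(is_cochain0r _ _ fn) ?(is_cochain0l _ _ fn) ?mul0rz ?addr0 ?add0r ?mul0rz //.

all: by rewrite [X in _ + _ *~ X]exprS mulN1r mulrNz; exact: subrr.
Qed.

Lemma is_cochain_pairing n (f : bicochain P C A) p q :
  is_cochain n f -> invariant_pairing (f p q).
Proof. by case. Qed.

End CochainComplex.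

(** C is an augmented complex for which the complex Hom(C_*, A), augmented by
    Hom(Z, A), is exact as a complex of abelian groups. *)
Section Coexact.
Variables (G : groupType) (P : resolution G) (C : gcomplex G) (A : zmodType).
Variable aug : gchain_map id C (Z_complex G).
Hypothesis aug_surj : forall k : Z_complex G 0%N, exists z, aug 0%N z = k.
Hypothesis coexact0 : forall f : C 0%N -> A, {morph f : x y / x + y} ->
  (forall z : C 1%N, f (gc_d C z) = 0) ->
  exists2 f' : Z_complex G 0%N -> A, {morph f' : x y / x + y} &
    forall z, f z = f' (aug 0%N z).
Hypothesis coexact : forall q (f : C q.+1 -> A), {morph f : x y / x + y} ->
  (forall z : C q.+2, f (gc_d C z) = 0) ->
  exists2 f' : C q -> A, {morph f' : x y / x + y} & forall z, f z = f' (gc_d C z).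

Definition boundary_set q : set (C q) := [set gc_d C z | z in setT]%classic.

Lemma boundary_set_act q (g : G) u : boundary_set u -> boundary_set (q := q) (gm_act g u).
Proof.
move=> [z _ <-]; exists (gm_act g z) => //.
by have [_ ->] := @gc_ghom G C q.
Qed.

Lemma pairing_factor q (U : gmodule G) (F : U -> C q.+1 -> A) :
  projective U -> invariant_pairing F ->
  (forall x z, F x (gc_d C z) = 0) ->
  exists2 F' : U -> C q -> A, invariant_pairing F' &
    forall x z, F x z = F' x (gc_d C z).
Proof.
move=> projU FP F0.
apply: (@equivariant_factor _ _ _ _ _ _ (@boundary_set q.+1)) => //.
- exact: gc_ghom.
- exact: boundary_set_act.
- by move=> _ [z _ <-]; rewrite gc_dd.
- move=> f fD f0; apply: coexact => // z; apply: f0; by exists z.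
- by move=> x _ [z _ <-].
Qed.

Lemma pairing_factor0 (U : gmodule G) (F : U -> C 0%N -> A) :
  projective U -> invariant_pairing F ->
  (forall x z, F x (gc_d C z) = 0) ->
  exists2 F' : U -> Z_complex G 0%N -> A, invariant_pairing F' &
    forall x z, F x z = F' x (aug 0%N z).
Proof.
move=> projU FP F0.
apply: (@equivariant_factor _ _ _ _ _ _ (@boundary_set 0)) => //.
- by split=> [x y|g x]; rewrite ?cm_D ?cm_act.
- exact: boundary_set_act.
- by move=> _ [z _ <-]; rewrite -cm_d.
- move=> f fD f0; apply: coexact0 => // z; apply: f0; by exists z.
- by move=> x _ [z _ <-].
Qed.

(** In column j the cocycle condition makes f j q.+1 vanish on boundaries, as the
    columns on the left of it are already zero; factoring through the
    differential of C yields a cochain k in column j whose coboundary removes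
    this column.  Subtracting it alters no column on the left. *)
Lemma clear_column n (f : bicochain P C A) j : is_cochain n.+1 f ->
  (forall p q (x : P p) (z : C q.+1), total_d f x z = 0) ->
  (forall p q (x : P p) (z : C q.+1), (p < j)%N -> f p q.+1 x z = 0) ->
  exists2 k, is_cochain n k &
    forall p q (x : P p) (z : C q.+1), (p < j.+1)%N -> (f - total_d k) p q.+1 x z = 0.
Proof.
move=> fn df f_lt.
have f_bd q x (z : C q.+2) : f j q.+1 x (gc_d C z) = 0.
  have := df j q.+1 x z; rewrite /total_d; case: j x f_lt => [|j] x f_lt.
    by rewrite add0r expr0.
  rewrite f_lt ?ltnSn // add0r => /(congr1 (fun a => a *~ (-1) ^+ j.+1)).
  by rewrite mul0rz -mulrzA -expr2 sqrr_sign.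
have [f1 f2 f3 f4] := fn.
have facts (pq : nat * nat) : exists F : P pq.1 -> C pq.2 -> A, [/\ invariant_pairing F,
    pq.1 <> j -> forall x z, F x z = 0 &
    pq.1 = j -> forall x z, f pq.1 pq.2.+1 x z = F x (gc_d C z)].
  case: pq => p q /=; case: (eqVneq p j) => [->|/eqP pj]; last first.
    by exists (fun _ _ => 0); split=> //; split=> *; rewrite ?addr0.
  have [F ? ?] := pairing_factor (@res_proj _ P j) (is_cochain_pairing j q.+1 fn) (f_bd q).
  by exists F; split.
have [F FP] := all_sig (fun pq => cid (facts pq)).
have {}FP p q := FP (p, q).
have signK (a : A) p : a *~ (-1) ^+ p *~ (-1) ^+ p = a.
  by rewrite -mulrzA -expr2 sqrr_sign.
(* The sign cancels the one that total_d puts on the differential of C. *)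
pose k : bicochain P C A := fun p q x z =>
  if (p + q == n)%N then F (p, q) x z *~ (-1) ^+ p else 0.
exists k.
  rewrite /k; split=> [p q x x' z|p q x z z'|p q g x z|p q x z /eqP/negbTE-> //];
    case: ifP => _; rewrite ?addr0 //; have [[F1 F2 F3] _ _] := FP p q.
  - by rewrite F1 mulrzDl.
  - by rewrite F2 mulrzDl.
  - by rewrite F3.
move=> p q x z pj.
have -> : (f - total_d k) p q.+1 x z = f p q.+1 x z - total_d k x z by [].
have -> : total_d k x z = k p q x (gc_d C z) *~ (-1) ^+ p.
  rewrite /total_d; case: p x pj => [|p] x pj; first by rewrite add0r.
  have [_ F0 _] := FP p q.+1; rewrite {1}/k F0 ?mul0rz ?if_same ?add0r //=.
  by move=> pE; rewrite pE ltnn in pj.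
rewrite /k; case: eqP => [pq|pq]; last first.
  by rewrite mul0rz subr0 f4 // addnS => -[].
rewrite signK; have [_ F0 FE] := FP p q; move: pj; rewrite ltnS leq_eqVlt.
case/orP=> [/eqP/FE->|pj]; first by rewrite subrr.
rewrite f_lt // F0 ?subr0 //= => pE; by rewrite pE ltnn in pj.
Qed.

Lemma clear_columns n (f : bicochain P C A) j : is_cochain n.+1 f ->
  (forall p q (x : P p) (z : C q.+1), total_d f x z = 0) ->
  exists2 k, is_cochain n k &
    forall p q (x : P p) (z : C q.+1), (p < j)%N -> (f - total_d k) p q.+1 x z = 0.
Proof.
move=> fn df; elim: j => [|j [k kn kE]]; first by exists 0; [exact: is_cochain0|].

set f' := f - total_d k.
have f'n : is_cochain n.+1 f' by apply: is_cochainB => //; exact: is_cochain_d.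
have df' p q (x : P p) (z : C q.+1) : total_d f' x z = 0.
  by rewrite total_dB (total_dd kn) subr0 df.
have [l ln lE] := clear_column f'n df' kE.
exists (k + l) => [|p q x z pj]; first exact: is_cochainD.
by rewrite total_dD opprD addrA lE.
Qed.

(** After all columns have been cleared only the row q = 0 is left.  It vanishes
    on boundaries of C, hence factors through the augmentation. *)
Lemma coexact_normal_form n (f : bicochain P C A) : is_cochain n.+1 f ->
  (forall p q (x : P p) (z : C q.+1), total_d f x z = 0) ->
  exists k L, [/\ is_cochain n k, is_cochain n.+1 L &
    f = total_d k + bc_pull (id_chain_map P) aug L].
Proof.
move=> fn df; have [k kn kE] := clear_columns n.+2 fn df.
set f' := f - total_d k in kE.
have f'n : is_cochain n.+1 f' by apply: is_cochainB => //; exact: is_cochain_d.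
have [_ _ _ f'0] := f'n.
have {}kE p q (x : P p) (z : C q.+1) : f' p q.+1 x z = 0.
  have [|pn] := ltnP p n.+2; first exact: kE.
  by apply: f'0 => pq; move: pn; rewrite -pq; lia.
have df' p q (x : P p) (z : C q.+1) : total_d f' x z = 0.
  by rewrite total_dB (total_dd kn) subr0 df.
have f'_bd p (x : P p) (z : C 1%N) : f' p 0%N x (gc_d C z) = 0.
  have := df' p 0%N x z; rewrite /total_d; case: p x => [|p] x.
    by rewrite add0r expr0.
  rewrite kE add0r => /(congr1 (fun a => a *~ (-1) ^+ p.+1)).
  by rewrite mul0rz -mulrzA -expr2 sqrr_sign.
have facts p : exists F : P p -> Z_complex G 0%N -> A, 
    invariant_pairing F /\ forall x z, f' p 0%N x z = F x (aug 0%N z).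
  have [F ? ?] := pairing_factor0 (@res_proj _ P p) (is_cochain_pairing p 0 f'n) (f'_bd p).
  by exists F.
have [F FP] := all_sig (fun p => cid (facts p)).
pose L : bicochain P (Z_complex G) A := fun p q =>
  match q return P p -> Z_complex G q -> A with 0 => F p | _ => fun _ _ => 0 end.
exists k, L; split=> //; last first.
  rewrite -[LHS](subrK (total_d k)) addrC -/f'; congr (_ + _).
  by apply: bicochain_eq => p [|q] x z; rewrite /bc_pull /= ?kE //; have [_ ->] := FP p.
split=> [p [|q] x x' z|p [|q] x z z'|p [|q] g x z|p [|q] x z pq] //=; rewrite ?addr0 //;
  have [[F1 F2 F3] F4] := FP p.
- exact: F1.
- exact: F2.
- exact: F3.
- by have [y <-] := aug_surj z; rewrite -F4 f'0.
Qed.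

Lemma bc_pull_aug_eq0 n (L : bicochain P (Z_complex G) A) : is_cochain n L ->
  bc_pull (id_chain_map P) aug L = 0 -> L = 0.
Proof.
move=> [_ L2 _ _] L0; have Lr p q x : L p q x 0 = 0.
  by apply: (addrI (L p q x 0)); rewrite -L2 !addr0.
apply: bicochain_eq => p [|q] x z.
  by have [y <-] := aug_surj z; have := congr1 (fun f : bicochain P C A => f p 0%N x y) L0.
have -> : z = 0 by apply/matrixP => i [].
exact: Lr.
Qed.

(** Surjectivity and injectivity of the map induced by the augmentation are the
    normal form of a cocycle and of a cochain whose coboundary is pulled back. *)
Lemma aug_pull_surj n (f : bicochain P C A) : f \in cocycles P C A n.+1 ->
  exists2 L, L \in cocycles P (Z_complex G) A n.+1 &
    exists2 k, is_cochain n k & f = bc_pull (id_chain_map P) aug L + total_d k.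
Proof.
move=> /asboolP[fn df]; have [|k [L [kn Ln fE]]] := coexact_normal_form fn.
  by move=> p q x z; rewrite df.
exists L; last by exists k => //; rewrite fE addrC.
apply/asboolP; split=> //; apply: (bc_pull_aug_eq0 (n := n.+2)); first exact: is_cochain_d.
by move: df; rewrite fE total_dD (total_dd kn) add0r bc_pull_d.
Qed.

Lemma aug_pull_inj n (L : bicochain P (Z_complex G) A) (k : bicochain P C A) :
  L \in cocycles P (Z_complex G) A n.+2 -> is_cochain n.+1 k ->
  bc_pull (id_chain_map P) aug L = total_d k ->
  exists2 l, is_cochain n.+1 l & L = total_d l.
Proof.
move=> /asboolP[Ln dL] kn Lk; have [|k' [l [k'n ln kE]]] := coexact_normal_form kn.
  move=> p q x z; rewrite -Lk /bc_pull.
  have -> : aug q.+1 z = 0 by apply/matrixP => i [].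
  exact: is_cochain0r Ln.
exists l => //; apply/eqP; rewrite -subr_eq0; apply/eqP.
apply: (bc_pull_aug_eq0 (n := n.+2)).
  by apply: is_cochainB => //; exact: is_cochain_d.
have -> : bc_pull (id_chain_map P) aug (L - total_d l) =
  bc_pull (id_chain_map P) aug L - bc_pull (id_chain_map P) aug (total_d l) by [].
by rewrite Lk kE bc_pull_d total_dD (total_dd k'n) add0r subrr.
Qed.

End Coexact.

(** * Classes of cocycles *)
Section CohomologyClasses.
Variables (G : groupType) (P : resolution G) (C : gcomplex G) (A : zmodType).

Lemma coh_class_cocycle n (c : cohomology P C A n) :
  exists2 f, f \in cocycles P C A n & c = coh_class n f.
Proof.
elim/quotW: c => f; exists (f : bicochain P C A); first exact: cocycleP.
by rewrite /coh_class; congr (\pi_(_) _); apply: val_inj; rewrite insubdK //; exact: cocycleP.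
Qed.

Lemma coh_classP n (f g : bicochain P C A) :
  f \in cocycles P C A n.+1 -> g \in cocycles P C A n.+1 ->
  coh_class n.+1 f = coh_class n.+1 g <-> exists2 k, is_cochain n k & f - g = total_d k.
Proof.
move=> fZ gZ; rewrite /coh_class.
have E : \val (insubd (0 : cocycle P C A n.+1) f - insubd 0 g) = f - g.
  by rewrite !raddfB /= !insubdK.
split=> [/eqP|[k kn kE]].
  by rewrite -Quotient.idealrBE => /asboolP[k kn kE]; exists k; rewrite // -kE E.
by apply/eqP; rewrite -Quotient.idealrBE; apply/asboolP; exists k; rewrite ?E.
Qed.

End CohomologyClasses.

Lemma coh_pull_class (H G : groupType) (i : H -> G) (A : zmodType)
    (P : resolution H) (P' : resolution G) (C : gcomplex H) (C' : gcomplex G)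
    (phi : gchain_map i P P') (psi : gchain_map i C C') n (f : bicochain P' C' A) :
  f \in cocycles P' C' A n ->
  coh_pull phi psi (coh_class n f) = coh_class n (bc_pull phi psi f).
Proof. by move=> fZ; rewrite coh_pullE insubdK. Qed.

(** * Flag complexes in which finite families have common neighbours *)
Lemma additive0 (U V : zmodType) (f : U -> V) : {morph f : x y / x + y} -> f 0 = 0.
Proof. by move=> fD; apply: (addrI (f 0)); rewrite -fD !addr0. Qed.

Lemma additiveN (U V : zmodType) (f : U -> V) :
  {morph f : x y / x + y} -> {morph f : x / - x}.
Proof. by move=> fD x; apply: (addrI (f x)); rewrite -fD !subrr additive0. Qed.

Lemma additiveMz (U V : zmodType) (f : U -> V) (m : int) :
  {morph f : x y / x + y} -> {morph f : x / x *~ m}.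
Proof.
move=> fD x; have MnE n : f (x *+ n) = f x *+ n.
  by elim: n => [|n IHn]; rewrite ?additive0 // !mulrS fD IHn.
by case: m => n; rewrite ?NegzE ?mulrNz ?additiveN // -!pmulrn MnE.
Qed.

Lemma additive_sum (U V : zmodType) (f : U -> V) (I : Type) (r : seq I) (F : I -> U) :
  {morph f : x y / x + y} -> f (\sum_(i <- r) F i) = \sum_(i <- r) f (F i).
Proof. by move=> fD; apply: (big_morph _ fD (additive0 fD)). Qed.

Lemma additive_freeg_eq_dom (K : choiceType) (M : zmodType) (f g : {freeg K} -> M) z :
  {morph f : x y / x + y} -> {morph g : x y / x + y} ->
  (forall k, k \in dom z -> f << k >> = g << k >>) -> f z = g z.
Proof.
move=> fD gD fg; rewrite -(freeg_sumE z) !additive_sum //.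
apply: eq_big_seq => k /fg fgk.
have -> : << coeff k z *g k >> = << k >> *~ coeff k z :> {freeg K}.
  by rewrite freegU_mulz intz.
by rewrite !additiveMz // fgk.
Qed.

Section FlagAcyclic.
Variables (G : groupType) (Gamma : ggraph G).

(** Both directions are required because the adjacency relation of a graph is not
    assumed to be symmetric. *)
Definition common_neighbours : Prop := forall (I : finType) (x : I -> Gamma),
  exists v, forall i, adj v (x i) /\ adj (x i) v.

Hypothesis Gamma_cn : common_neighbours.

Section Cone.
Variable v : Gamma.

Definition cone_base k (s : simplex Gamma k) : Prop :=
  forall i, adj v (s i) /\ adj (s i) v.

Definition cone_fun k (s : simplex Gamma k) (i : 'I_k.+2) : Gamma :=
  if unlift ord0 i is Some j then s j else v.

Lemma cone_spxP k (s : simplex Gamma k) : cone_base s -> forall i j,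
  cone_fun s i = cone_fun s j \/ adj (cone_fun s i) (cone_fun s j).
Proof.
move=> sv i j; rewrite /cone_fun; case: unliftP => [i' _|_]; case: unliftP => [j' _|_].
- exact: spxP.
- by right; have [] := sv i'.
- by right; have [] := sv j'.
- by left.
Qed.

(** The join with v makes sense only for simplices in the link of v; elsewhere the
    value is the junk value 0. *)
Definition cone_chain k (s : simplex Gamma k) : {freeg (simplex Gamma k.+1)} :=
  match pselect (cone_base s) with
  | left sv => << Simplex (cone_spxP sv) >>
  | right _ => 0
  end.

Lemma cone_base_face k (i : 'I_k.+2) (s : simplex Gamma k.+1) :
  cone_base s -> cone_base (face i s).
Proof. by move=> sv j; exact: sv. Qed.

Definition cone k : {freeg (simplex Gamma k)} -> {freeg (simplex Gamma k.+1)} :=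
  fgext (@cone_chain k).

Lemma signU k (i : nat) (t : simplex Gamma k) :
  << (-1) ^+ i *g t >> = << t >> *~ (-1) ^+ i :> {freeg _}.
Proof. by rewrite freegU_mulz intz. Qed.

Lemma boundary_cone k (s : simplex Gamma k.+1) : cone_base s ->
  boundary (cone << s >>) = << s >> - cone (boundary << s >>).
Proof.
move=> sv; rewrite /cone /boundary !fgextU /cone_chain.
case: pselect => // sv'; rewrite fgextU big_ord_recl expr0; congr (_ + _).
  by congr << _ >>; apply: simplex_eq => i /=; rewrite /cone_fun liftK.
rewrite fgext_sum -sumrN; apply: eq_bigr => i _.
rewrite !signU fgextMz fgextU; case: pselect => [sv2|[]]; last exact: cone_base_face.
rewrite lift0 exprS mulN1r mulrNz; congr (- (<< _ >> *~ _)).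
apply: simplex_eq => j /=; rewrite /cone_fun.
case: (unliftP ord0 j) => [j' ->|->] /=.
  have -> : fintype.lift (fintype.lift ord0 i) (fintype.lift ord0 j') =
     fintype.lift ord0 (fintype.lift i j') by apply: val_inj => /=; rewrite /bump /=; lia.
  by rewrite liftK.
have -> : fintype.lift (fintype.lift ord0 i) ord0 = ord0 :> 'I_k.+3.
  by apply: val_inj => /=; rewrite /bump.
by rewrite unlift_none.
Qed.

Definition point_simplex : simplex Gamma 0 :=
  @Simplex _ _ 0 (fun=> v) (fun _ _ => or_introl erefl).

Lemma boundary_cone0 (s : simplex Gamma 0) : cone_base s ->
  boundary (cone << s >>) = << s >> - << point_simplex >>.
Proof.
move=> sv; rewrite /cone /boundary !fgextU /cone_chain.
case: pselect => // sv'; rewrite fgextU big_ord_recl big_ord1 !signU; congr (_ + _).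
  by congr << _ >>; apply: simplex_eq => i /=; rewrite /cone_fun liftK.
rewrite lift0 expr1 mulrNz; congr (- << _ >>).
apply: simplex_eq => i /=; rewrite /cone_fun.
have -> : fintype.lift (fintype.lift ord0 ord0) i = ord0 :> 'I_2.
  by apply: val_inj => /=; rewrite ord1.
by rewrite unlift_none.
Qed.

End Cone.

Lemma dom_cone_vertex k (z : {freeg (simplex Gamma k)}) :
  exists v, forall s, s \in dom z -> cone_base v s.
Proof.
have [v vP] := Gamma_cn (fun ai : 'I_(size (dom z)) * 'I_k.+1 =>
  tnth (in_tuple (dom z)) ai.1 ai.2).
by exists v => s /(tnthP (in_tuple (dom z)))[a ->] i; exact: (vP (a, i)).
Qed.

(** Cone off a cycle from a vertex adjacent to all vertices in its support. *)
Lemma flag_acyclic k (z : {freeg (simplex Gamma k.+1)}) :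
  boundary z = 0 -> exists w, boundary w = z.
Proof.
move=> z0; have [v vz] := dom_cone_vertex z; exists (cone v z).
transitivity (z - cone v (boundary z)); last by rewrite z0 /cone fgext0 subr0.
apply: (additive_freeg_eq_dom (f := fun z => boundary (cone v z))
   (g := fun z => z - cone v (boundary z))).
- by move=> x y; rewrite /boundary /cone !fgextD.
- by move=> x y; rewrite /boundary /cone !fgextD opprD addrACA.
- by move=> s /vz; exact: boundary_cone.
Qed.

Lemma flag_acyclic0 (z : {freeg (simplex Gamma 0)}) :
  deg z = 0 -> exists w, boundary w = z.
Proof.
move=> z0; have [v vz] := dom_cone_vertex z; exists (cone v z).
transitivity (z - << point_simplex v >> *~ deg z); last by rewrite z0 mulr0z subr0.
apply: (additive_freeg_eq_dom (f := fun z => boundary (cone v z))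
   (g := fun z => z - << point_simplex v >> *~ deg z)).
- by move=> x y; rewrite /boundary /cone !fgextD.
- by move=> x y; rewrite degD mulrzDr opprD addrACA.
- by move=> s /vz /boundary_cone0 ->; rewrite degU.
Qed.

Lemma boundary_boundary k (z : {freeg (simplex Gamma k.+2)}) : boundary (boundary z) = 0.
Proof. exact: (fl_dd z). Qed.

Lemma deg_boundary (z : {freeg (simplex Gamma 1)}) : deg (boundary z) = 0.
Proof. exact: esym (fl_aug_d (n := 0) z). Qed.

(** Acyclic complexes of free abelian groups split.  The section s over the cycles
    is found by induction: once s is known in degree k, the chain e - s(d e) is a
    cycle for every simplex e of degree k + 1, so a bounding chain can be chosen
    for each e and extended additively; on cycles z one has z - s(d z) = z. *)
Lemma flag_splitting k : exists2 s : {freeg (simplex Gamma k)} -> {freeg (simplex Gamma k.+1)},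
  {morph s : x y / x + y} &
  forall z, match k return {freeg (simplex Gamma k)} -> Prop with
            | 0 => fun z => deg z = 0
            | _ => fun z => boundary z = 0
            end z -> boundary (s z) = z.
Proof.
elim: k => [|k [s sD sE]].
  have [v _] := Gamma_cn (fun x : void => match x with end).
  have b_ex (e : simplex Gamma 0) : exists w, boundary w = << e >> - << point_simplex v >>.
    by apply: flag_acyclic0; rewrite degB !degU subrr.
  have [c cE] := choice b_ex; exists (fgext c) => [|z z0]; first exact: fgextD.
  transitivity (z - << point_simplex v >> *~ deg z); last by rewrite z0 mulr0z subr0.
  move: z {z0}; apply: additive_freeg_eq => [x y|x y|e].
  - by rewrite /boundary !fgextD.
  - by rewrite degD mulrzDr opprD addrACA.
  - by rewrite fgextU cE degU.
have b_ex (e : simplex Gamma k.+1) : exists w, boundary w = << e >> - s (boundary << e >>).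
  apply: flag_acyclic.
  rewrite /boundary fgextB -!/(boundary _) sE ?subrr //.
  by case: k s sD sE e => [|k] s sD sE e; [exact: deg_boundary | exact: boundary_boundary].
have [c cE] := choice b_ex; exists (fgext c) => [|z z0]; first exact: fgextD.
transitivity (z - s (boundary z)); last by rewrite z0 additive0 // subr0.
move: z {z0}; apply: additive_freeg_eq => [x y|x y|e].
- by rewrite /boundary !fgextD.
- by rewrite /boundary fgextD sD opprD addrACA.
- by rewrite fgextU cE.
Qed.

Variable A : zmodType.

(** Writing z = (z - s(d z)) + s(d z), the first term is a boundary, which f kills,
    so that f z = f(s(d z)). *)
Lemma flag_coexact k (f : {freeg (simplex Gamma k.+1)} -> A) : {morph f : x y / x + y} ->
  (forall z, f (boundary z) = 0) ->
  exists2 f' : {freeg (simplex Gamma k)} -> A, {morph f' : x y / x + y} &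
    forall z, f z = f' (boundary z).
Proof.
move=> fD f0; have [s sD sE] := flag_splitting k.
exists (fun z => f (s z)) => [x y|z]; first by rewrite sD fD.
apply/eqP; rewrite -subr_eq0 -additiveN // -fD; apply/eqP.
have [|w <-] := @flag_acyclic k (z - s (boundary z)); last exact: f0.
rewrite /boundary fgextB -!/(boundary _) sE ?subrr //.
by case: k f fD f0 s sD sE z => [|k] *; [exact: deg_boundary | exact: boundary_boundary].
Qed.

Lemma flag_coexact0 (f : {freeg (simplex Gamma 0)} -> A) : {morph f : x y / x + y} ->
  (forall z, f (boundary z) = 0) ->
  exists2 f' : int -> A, {morph f' : x y / x + y} & forall z, f z = f' (deg z).
Proof.
move=> fD f0; have [v _] := Gamma_cn (fun x : void => match x with end).
exists (fun m => f << point_simplex v >> *~ m) => [m m'|]; first exact: mulrzDr.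
move=> z; rewrite -additiveMz //; apply/eqP; rewrite -subr_eq0 -additiveN // -fD; apply/eqP.
have [|w <-] := @flag_acyclic0 (z - << point_simplex v >> *~ deg z); last exact: f0.
by rewrite degB -(mulr1z (deg z)); have := additiveMz (deg z) (@degD _) << point_simplex v >>;
  rewrite degU => ->; rewrite mulr1z intz subrr.
Qed.

Lemma deg_surj (m : int) : exists z : {freeg (simplex Gamma 0)}, deg z = m.
Proof.
have [v _] := Gamma_cn (fun x : void => match x with end).
by exists << m *g point_simplex v >>; rewrite degU.
Qed.

End FlagAcyclic.

(** * Maps of flag complexes and inflated cochains *)
Section GraphMap.
Variables (H G : groupType) (i : H -> G) (Gamma : ggraph H) (Gamma' : ggraph G).
Variable theta : Gamma -> Gamma'.
Hypothesis theta_adj : forall x y, adj x y -> adj (theta x) (theta y).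
Hypothesis theta_act : forall h x, theta (vact h x) = vact (i h) (theta x).

Fact simplex_map_subproof k (s : simplex Gamma k) a b :
  theta (s a) = theta (s b) \/ adj (theta (s a)) (theta (s b)).
Proof. by case: (spxP s a b) => [->|/theta_adj]; [left | right]. Qed.

Definition simplex_map k (s : simplex Gamma k) : simplex Gamma' k :=
  Simplex (simplex_map_subproof s).

Definition fl_map k : fl_complex Gamma k -> fl_complex Gamma' k :=
  fgext (fun s => << simplex_map s >>).

Fact fl_map_D k : {morph @fl_map k : x y / x + y}.
Proof. exact: fgextD. Qed.

Fact fl_map_act k h x : @fl_map k (gm_act h x) = gm_act (i h) (fl_map x).
Proof.
move: x; apply: additive_freeg_eq => [x y|x y|s]; rewrite /fl_map /= /chain_act ?fgextD //.
by rewrite !fgextU; congr << _ >>; apply: simplex_eq => a /=.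
Qed.

Fact fl_map_d k x : gc_d (fl_complex Gamma') (@fl_map k.+1 x) = fl_map (gc_d (fl_complex Gamma) x).
Proof.
move: x; apply: additive_freeg_eq => [x y|x y|s]; rewrite /fl_map /= /fl_d /boundary ?fgextD //.
rewrite !fgextU fgext_sum; apply: eq_bigr => a _.
rewrite !signU fgextMz fgextU; congr (<< _ >> *~ _).
exact: simplex_eq.
Qed.

Definition fl_chain_map : gchain_map i (fl_complex Gamma) (fl_complex Gamma') :=
  GChainMap fl_map_D fl_map_act fl_map_d.

Lemma fl_aug_map_natural n (x : fl_complex Gamma n) :
  fl_aug_map Gamma' n (fl_map x) = Z_chain_map i n (fl_aug_map Gamma n x).
Proof.
case: n x => [|n] x //=; move: x; apply: additive_freeg_eq => [x y|x y|s].
- by rewrite /fl_map fgextD degD.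
- by rewrite degD.
- by rewrite /fl_map fgextU !degU.
Qed.

Lemma inflate2_pull (P : resolution H) (P' : resolution G) (phi : gchain_map i P P')
   (A : zmodType) (c : simplex Gamma' 2 -> A) : res_map phi ->
  bc_pull phi fl_chain_map (inflate2 P' c) = inflate2 P (fun s => c (simplex_map s)).
Proof.
move=> phi_aug; apply: bicochain_eq => -[|p] [|[|[|q]]] x z; rewrite /bc_pull //=.
rewrite phi_aug; congr (_ *~ _); move: z.
apply: (additive_freeg_eq (f := fun z => fgext c (fl_map z))) => [y z|y z|s].
- by rewrite /fl_map !fgextD.
- by rewrite fgextD.
- by rewrite /fl_map !fgextU.
Qed.

End GraphMap.

Section Inflation.
Variables (G : groupType) (Gamma : ggraph G) (P : resolution G) (A : zmodType).

Lemma inflate2_cocycle (c : simplex Gamma 2 -> A) :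
  (forall g s, c (sact g s) = c s) ->
  (forall s : simplex Gamma 3, fgext c (boundary << s >>) = 0) ->
  inflate2 P c \in cocycles P (fl_complex Gamma) A 2.
Proof.
move=> cG dc; have [augD augG] := @res_aug_ghom _ P.
have cG' g z : fgext c (chain_act g z) = fgext c z.
  move: z; apply: (additive_freeg_eq (f := fun z => fgext c (chain_act g z))) => [x y|x y|s].
  - by rewrite /chain_act !fgextD.
  - by rewrite fgextD.
  - by rewrite /chain_act !fgextU cG.
have dc' z : fgext c (boundary z) = 0.
  move: z; apply: (additive_freeg_eq (f := fun z => fgext c (boundary z)) (g := fun=> 0))
     => [x y|x y|s].
  - by rewrite /boundary !fgextD.
  - by rewrite addr0.
  - exact: dc.
apply/asboolP; split; last first.
  apply: bicochain_eq => -[|[|p]] [|[|[|[|q]]]] x z; rewrite /total_d /= ?mul0rz ?addr0 //.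
    by rewrite add0r /fl_d dc' !mul0rz.
  by rewrite res_aug_d mulr0z.
split.
- by case=> [|p] [|[|[|q]]] x x' z; rewrite /= ?addr0 // augD mulrzDr.
- by case=> [|p] [|[|[|q]]] x z z'; rewrite /= ?addr0 // fgextD mulrzDl.
- by case=> [|p] [|[|[|q]]] g x z; rewrite //= cG' augG.
- by case=> [|p] [|[|[|q]]] x z.
Qed.

Lemma inflate2D (c c1 c2 : simplex Gamma 2 -> A) : (forall s, c s = c1 s + c2 s) ->
  inflate2 P c = inflate2 P c1 + inflate2 P c2.
Proof.
move=> cE; have cE' z : fgext c z = fgext c1 z + fgext c2 z.
  move: z; apply: (additive_freeg_eq (g := fun z => fgext c1 z + fgext c2 z)) => [x y|x y|s].
  - exact: fgextD.
  - by rewrite !fgextD addrACA.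
  - by rewrite !fgextU.
apply: bicochain_eq => -[|p] [|[|[|q]]] x z; rewrite /= -[RHS]/(_ + _) /=.
all: by rewrite ?addr0 // cE' mulrzDl.
Qed.

Lemma inflate2_coboundary (c : simplex Gamma 2 -> A) (b : fl_complex Gamma 1%N -> A) :
  {morph b : x y / x + y} -> (forall g z, b (gm_act g z) = b z) ->
  (forall s : simplex Gamma 2, c s = b (boundary << s >>)) ->
  exists2 k, is_cochain 1 k & inflate2 P c = total_d k.
Proof.
move=> bD bG cE; have [augD augG] := @res_aug_ghom _ P.
pose k : bicochain P (fl_complex Gamma) A := fun p q =>
  match p, q return P p -> fl_complex Gamma q -> A with
  | 0%N, 1%N => fun x z => b z *~ res_aug x
  | _, _ => fun _ _ => 0 end.
exists k.
  split.
  - by case=> [|p] [|[|q]] x x' z; rewrite /= ?addr0 // augD mulrzDr.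
  - by case=> [|p] [|[|q]] x z z'; rewrite /= ?addr0 // bD mulrzDl.
  - by case=> [|p] [|[|q]] g x z; rewrite //= bG augG.
  - by case=> [|p] [|[|q]] x z.
apply: bicochain_eq => -[|[|p]] [|[|[|q]]] x z; rewrite /total_d /= ?mul0rz ?addr0 //.
  rewrite add0r expr0 mulr1z; congr (_ *~ _); move: z.
  apply: (additive_freeg_eq (g := fun z => b (boundary z))) => [y z|y z|s].
  - by rewrite fgextD.
  - by rewrite /boundary fgextD bD.
  - by rewrite fgextU.
by rewrite res_aug_d mulr0z.
Qed.

End Inflation.

(** * Sesquilinear forms and linear algebra over a division ring *)
Section SesquilinearForms.
Variables (D : nzRingType) (J : involution D) (delta : D) (M : rmodType D).
Variables (h : M -> M -> D) (hH : hermitian J delta h).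

Lemma hermDl u v w : h (u + v) w = h u w + h v w. Proof. by case: hH. Qed.
Lemma hermDr u v w : h u (v + w) = h u v + h u w. Proof. by case: hH. Qed.
Lemma hermZl (a : D^c) u v : h (a *: u) v = J a * h u v.
Proof. by case: hH => _ _ hZ _; rewrite -[v in LHS]scale1r hZ mulr1. Qed.
Lemma hermZr (a : D^c) u v : h u (a *: v) = h u v * a.
Proof. by case: hH => _ _ hZ _; rewrite -[u in LHS]scale1r hZ inv1 mul1r. Qed.
Lemma hermC u v : h u v = J (h v u) * delta. Proof. by case: hH. Qed.
Lemma herm0l u : h 0 u = 0.
Proof. by apply: (addrI (h 0 u)); rewrite -hermDl !addr0. Qed.
Lemma herm0r u : h u 0 = 0.
Proof. by apply: (addrI (h u 0)); rewrite -hermDr !addr0. Qed.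
Lemma hermNl u v : h (- u) v = - h u v.
Proof. by apply: (addrI (h u v)); rewrite -hermDl !subrr herm0l. Qed.
Lemma hermNr u v : h u (- v) = - h u v.
Proof. by apply: (addrI (h u v)); rewrite -hermDr !subrr herm0r. Qed.
Lemma herm_suml (I : Type) (r : seq I) (P : pred I) (F : I -> M) v :
  h (\sum_(i <- r | P i) F i) v = \sum_(i <- r | P i) h (F i) v.
Proof. by rewrite (big_morph (h^~ v) (fun u w => hermDl u w v) (herm0l v)). Qed.
Lemma herm_sumr (I : Type) (r : seq I) (P : pred I) (F : I -> M) v :
  h v (\sum_(i <- r | P i) F i) = \sum_(i <- r | P i) h v (F i).
Proof. by rewrite (big_morph (h v) (hermDr v) (herm0r v)). Qed.
Lemma herm_eq0C u v : h u v = 0 -> h v u = 0.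
Proof. by rewrite (hermC v) => ->; rewrite inv0 mul0r. Qed.

End SesquilinearForms.

Lemma submodule_sum (D : nzRingType) (M : rmodType D) (S : set M) (I : Type)
    (r : seq I) (a : I -> D^c) (e : I -> M) :
  is_submodule S -> (forall i, S (e i)) -> S (\sum_(i <- r) a i *: e i).
Proof.
move=> [S0 SD SZ] Se; elim: r => [|i r IHr]; first by rewrite big_nil.
by rewrite big_cons; apply: SD => //; exact: SZ.
Qed.

Lemma submoduleB (D : nzRingType) (M : rmodType D) (S : set M) u v :
  is_submodule S -> S u -> S v -> S (u - v).
Proof. by move=> [_ SD SZ] Su Sv; apply: SD => //; rewrite -scaleN1r; exact: SZ. Qed.

Lemma basis_mem (D : nzRingType) (M : rmodType D) (S : set M) n (e : 'I_n -> M) i :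
  is_basis S e -> S (e i).
Proof.
move=> [-> _]; exists (fun j => (i == j)%:R).
by rewrite (bigD1 i) //= eqxx scale1r big1 ?addr0 // => j ji; rewrite eq_sym (negbTE ji) scale0r.
Qed.

Definition cons_fun T n (x : T) (e : 'I_n -> T) (i : 'I_n.+1) : T :=
  if unlift ord0 i is Some j then e j else x.

Lemma cons_fun0 T n (x : T) (e : 'I_n -> T) : cons_fun x e ord0 = x.
Proof. by rewrite /cons_fun unlift_none. Qed.

Lemma cons_funS T n (x : T) (e : 'I_n -> T) i : cons_fun x e (fintype.lift ord0 i) = e i.
Proof. by rewrite /cons_fun liftK. Qed.

Lemma sum_cons_fun (D : nzRingType) (M : rmodType D) n (a : 'I_n.+1 -> D^c) x (e : 'I_n -> M) :
  \sum_i a i *: cons_fun x e i = a ord0 *: x + \sum_i a (fintype.lift ord0 i) *: e i.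
Proof.
rewrite big_ord_recl cons_fun0; congr (_ + _).
by apply: eq_bigr => i _; rewrite cons_funS.
Qed.

Section DivisionRing.
Variables (D : unitRingType) (D_division : GRing.field_axiom D).

Lemma division_mulVr (a : D) : a != 0 -> a^-1 * a = 1.
Proof. by move=> /D_division; exact: mulVr. Qed.

Lemma division_mulrV (a : D) : a != 0 -> a * a^-1 = 1.
Proof. by move=> /D_division; exact: mulrV. Qed.

(** A submodule on which finitely many linear forms separate points has a finite
    basis: by induction on the number of forms, either the first form vanishes on
    S, or S is spanned by a vector where that form is 1 and the kernel of the
    form in S. *)
Lemma submodule_basis (M : rmodType D) k (phi : 'I_k -> M -> D) (S : set M) :
  (forall i, is_linear_form (phi i)) -> is_submodule S ->
  (forall u, S u -> (forall i, phi i u = 0) -> u = 0) ->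
  exists n (e : 'I_n -> M), is_basis S e.
Proof.
move=> phiP; elim: k phi phiP S => [|k IHk] phi phiP S Ssub sep.
  exists 0%N, (fun=> 0); split=> [|a _ []//].
  apply/seteqP; split=> [u Su|u [a ->]]; last by rewrite big_ord0; case: Ssub.
  by exists (fun=> 0); rewrite big_ord0; apply: sep => // -[].
have [S0 SD SZ] := Ssub.
have [phiD phiZ] := phiP ord0.
have phi0 : phi ord0 0 = 0 by apply: (addrI (phi ord0 0)); rewrite -phiD !addr0.
pose S' : set M := [set u | S u /\ phi ord0 u = 0]%classic.
have S'sub : is_submodule S'.
  split=> [//|u v [Su u0] [Sv v0]|a u [Su u0]]; split.
  - exact: SD.
  - by rewrite phiD u0 v0 addr0.
  - exact: SZ.
  - by rewrite phiZ u0 mul0r.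
have [||n [e eB]] := IHk (fun i => phi (fintype.lift ord0 i)) _ S' S'sub.
- by move=> i; exact: phiP.
- move=> u [Su u0] uS; apply: sep => // i.
  by case: (unliftP ord0 i) => [j ->|->].
have [[w [Sw w0]]|noW] := pselect (exists w, S w /\ phi ord0 w <> 0); last first.
  exists n, e; suff <- : S' = S by [].
  apply/seteqP; split=> [u []//|u Su]; split=> //.
  by have [//|u0] := pselect (phi ord0 u = 0); case: noW; exists u.
have w0' : phi ord0 w != 0 by apply/eqP.
pose w1 : M := ((phi ord0 w)^-1 : D^c) *: w.
have w11 : phi ord0 w1 = 1 by rewrite phiZ division_mulrV.
have [S'E eI] := eB.
exists n.+1, (cons_fun w1 e); split.
  apply/seteqP; split=> [u Su|_ [a ->]]; last first.
    rewrite sum_cons_fun; apply: SD; first exact/SZ/SZ.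
    by apply: submodule_sum => // i; have [] := basis_mem i eB.
  have : S' (u - (phi ord0 u : D^c) *: w1).
    split; first by apply: submoduleB => //; exact/SZ/SZ.
    by rewrite -scaleNr phiD phiZ w11 mul1r subrr.
  rewrite S'E => -[a aE]; exists (cons_fun (phi ord0 u : D^c) a).
  rewrite sum_cons_fun cons_fun0 -[LHS](subrK ((phi ord0 u : D^c) *: w1)) addrC aE.
  by congr (_ + _); apply: eq_bigr => i _; rewrite cons_funS.
move=> a; rewrite sum_cons_fun => a0.
have a00 : a ord0 = 0.
  have := congr1 (phi ord0) a0; rewrite phiD phiZ w11 mul1r phi0.
  have [_ ->] : S' (\sum_i a (fintype.lift ord0 i) *: e i); last by rewrite addr0.
  by apply: submodule_sum => // i; exact: basis_mem.
move=> i; case: (unliftP ord0 i) => [j ->|->//].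
apply: (eI (fun j => a (fintype.lift ord0 j))).
by move: a0; rewrite a00 scale0r add0r.
Qed.

Definition independent (M : rmodType D) n (e : 'I_n -> M) : Prop :=
  forall a : 'I_n -> D^c, \sum_i a i *: e i = 0 -> forall i, a i = 0.

Section DualFamily.
Variables (J : involution D) (delta : D) (M : rmodType D).
Variables (h : M -> M -> D) (hH : hermitian J delta h) (h_nd : nondegenerate h).

(** By induction, m being dual to all vectors but the first: if no vector is
    orthogonal to the other vectors but not to x_0, then the difference d of x_0
    and its projection along m is orthogonal to everything, so nondegeneracy
    contradicts independence. *)
Lemma dual_family n (x : 'I_n -> M) : independent x ->
  exists m : 'I_n -> M, forall i j, h (m i) (x j) = (i == j)%:R.
Proof.
elim: n x => [|n IHn] x xI; first by exists (fun=> 0) => -[].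
have [|m mE] := IHn (fun i => x (fintype.lift ord0 i)).
  move=> a a0 i; have := xI (cons_fun 0 a); rewrite big_ord_recl cons_fun0 scale0r add0r.
  move=> /(_ _ (fintype.lift ord0 i)); rewrite cons_funS; apply.
  by rewrite -[RHS]a0; apply: eq_bigr => j _; rewrite cons_funS.
have [[m' [m'0 m'1]]|no] := pselect (exists m', (forall j, h m' (x (fintype.lift ord0 j)) = 0)
    /\ h m' (x ord0) <> 0).
  have m'1' : h m' (x ord0) != 0 by apply/eqP.
  pose m0 : M := (J (h m' (x ord0))^-1 : D^c) *: m'.
  have m00 : h m0 (x ord0) = 1 by rewrite (hermZl hH) inv_inv division_mulVr.
  have m0S j : h m0 (x (fintype.lift ord0 j)) = 0 by rewrite (hermZl hH) m'0 mulr0.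
  exists (cons_fun m0 (fun i => m i - (J (h (m i) (x ord0)) : D^c) *: m0)) => i j.
  case: (unliftP ord0 i) => [i' ->|->]; rewrite ?cons_funS ?cons_fun0;
    case: (unliftP ord0 j) => [j' ->|->].
  - by rewrite (hermDl hH) (hermNl hH) (hermZl hH) m0S mulr0 subr0 mE (inj_eq lift_inj).
  - by rewrite (hermDl hH) (hermNl hH) (hermZl hH) m00 mulr1 inv_inv subrr.
  - by rewrite m0S.
  - by rewrite m00 eqxx.
pose d := x ord0 - \sum_j (h (m j) (x ord0) : D^c) *: x (fintype.lift ord0 j).
have d0 : d = 0.
  apply: h_nd => u; apply: (herm_eq0C hH).
  pose u' := u - \sum_j (J (h u (x (fintype.lift ord0 j))) : D^c) *: m j.
  have u'0 k : h u' (x (fintype.lift ord0 k)) = 0.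
    rewrite (hermDl hH) (hermNl hH) (herm_suml hH) (bigD1 k) //= big1 => [|j jk].
      by rewrite (hermZl hH) inv_inv mE eqxx mulr1 addr0 subrr.
    by rewrite (hermZl hH) mE (negbTE jk) mulr0.
  have : h u' (x ord0) = 0.
    by have [//|u'1] := pselect (h u' (x ord0) = 0); case: no; exists u'.
  rewrite (hermDl hH) (hermNl hH) (herm_suml hH) (hermDr hH) (hermNr hH) (herm_sumr hH).
  move=> u'E; rewrite -[RHS]u'E; congr (_ - _); apply: eq_bigr => j _.
  by rewrite (hermZl hH) (hermZr hH) inv_inv.
pose c : 'I_n.+1 -> D^c := cons_fun 1 (fun j => - (h (m j) (x ord0) : D^c)).
have /xI/(_ ord0)/eqP : \sum_i c i *: x i = 0.
  rewrite big_ord_recl /c cons_fun0 scale1r -[RHS]d0 /d -sumrN; congr (_ + _).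
  by apply: eq_bigr => j _; rewrite cons_funS scaleNr.
by rewrite /c cons_fun0 oner_eq0.
Qed.

End DualFamily.

End DivisionRing.

(** * Hyperbolic frames and common opposites *)
Section Frames.
Variables (D : unitRingType) (D_division : GRing.field_axiom D).
Variables (J : involution D).

Section OneForm.
Variables (delta : D) (M : rmodType D) (h : M -> M -> D).
Hypotheses (delta_sign : delta = 1 \/ delta = -1) (hH : hermitian J delta h).

Lemma sqr_sign : delta * delta = 1.
Proof. by case: delta_sign => ->; rewrite ?mulrNN mulr1. Qed.
Lemma comm_sign a : delta * a = a * delta.
Proof. by case: delta_sign => ->; rewrite ?mulrN1 ?mulN1r ?mulr1 ?mul1r. Qed.

(** The index type is an arbitrary finite type so that frames of two modules
    combine into a frame of their sum, indexed by the disjoint union. *)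
Definition hyp_frame (I : finType) (x y : I -> M) : Prop :=
  [/\ forall i j, h (x i) (x j) = 0, forall i j, h (y i) (y j) = 0,
      forall i j, h (y i) (x j) = (i == j)%:R &
      forall u, exists a b : I -> D^c, u = \sum_i a i *: x i + \sum_i b i *: y i].

Section Frame.
Variables (I : finType) (x y : I -> M).
Hypothesis xyF : hyp_frame x y.

Lemma frame_xx i j : h (x i) (x j) = 0. Proof. by case: xyF. Qed.
Lemma frame_yy i j : h (y i) (y j) = 0. Proof. by case: xyF. Qed.
Lemma frame_yx i j : h (y i) (x j) = (i == j)%:R. Proof. by case: xyF. Qed.
Lemma frame_xy i j : h (x i) (y j) = (i == j)%:R * delta.
Proof. by rewrite (hermC hH) frame_yx eq_sym; case: eqP; rewrite ?inv1 ?inv0. Qed.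

Lemma frame_coord_x j (a b : I -> D^c) :
  h (y j) (\sum_i a i *: x i + \sum_i b i *: y i) = a j.
Proof.
rewrite (hermDr hH) !(herm_sumr hH) (bigD1 j) //= (hermZr hH) frame_yx eqxx mul1r.
rewrite !big1 ?addr0 // => i; rewrite (hermZr hH) ?frame_yy ?mul0r // => ij.
by rewrite frame_yx eq_sym (negbTE ij) mul0r.
Qed.

Lemma frame_coord_y j (a b : I -> D^c) :
  h (x j) (\sum_i a i *: x i + \sum_i b i *: y i) = delta * b j.
Proof.
rewrite (hermDr hH) !(herm_sumr hH) addrC (bigD1 j) //= (hermZr hH) frame_xy eqxx mul1r.
rewrite !big1 ?addr0 // => i; rewrite (hermZr hH) ?frame_xx ?mul0r // => ij.
by rewrite frame_xy eq_sym (negbTE ij) !mul0r.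
Qed.

(** Pairing with a frame recovers all coordinates, hence the frame yields finitely
    many separating linear forms; this is the form in which finite dimension gets
    used below. *)
Lemma frame_separating u :
  (forall i, h (x i) u = 0) -> (forall i, h (y i) u = 0) -> u = 0.
Proof.
have [_ _ _ /(_ u)[a [b ->]]] := xyF => xu yu.
rewrite !big1 ?addr0 // => i _.
  have := xu i; rewrite frame_coord_y => /(congr1 (fun c => delta * c)).
  by rewrite mulr0 mulrA sqr_sign mul1r => ->; rewrite scale0r.
by have := yu i; rewrite frame_coord_x => ->; rewrite scale0r.
Qed.

Lemma frame_nondegenerate : nondegenerate h.
Proof. by move=> u u0; apply: frame_separating => i; apply: (herm_eq0C hH). Qed.

Lemma frame_submodule_basis (S : set M) : is_submodule S ->
  exists n (e : 'I_n -> M), is_basis S e.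
Proof.
pose phi (k : 'I_#|{: I + I}|) := match enum_val k with inl i => h (x i) | inr i => h (y i) end.
move=> Ssub; apply: (submodule_basis D_division (phi := phi)) => // [k|u _ u0].
  rewrite /phi; case: enum_val => i; split=> [u v|a v];
    by rewrite ?(hermDr hH) ?(hermZr hH).
apply: frame_separating => i.
  by have := u0 (enum_rank (inl i)); rewrite /phi enum_rankK.
by have := u0 (enum_rank (inr i)); rewrite /phi enum_rankK.
Qed.

Fact span_submodule : is_submodule [set u | exists b : I -> D^c, u = \sum_i b i *: y i]%classic.
Proof.
split=> [|_ _ [a ->] [b ->]|c _ [a ->]].
- by exists (fun=> 0); rewrite big1 // => i _; rewrite scale0r.
- by exists (fun i => a i + b i); rewrite -big_split; apply: eq_bigr => i _; rewrite scalerDl.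
- by exists (fun i => c * a i); rewrite scaler_sumr; apply: eq_bigr => i _; rewrite scalerA.
Qed.

Fact span_perp :
  [set u | exists b : I -> D^c, u = \sum_i b i *: y i]%classic =
  perp h [set u | exists b : I -> D^c, u = \sum_i b i *: y i]%classic.
Proof.
apply/seteqP; split=> [_ [b ->] _ [c ->]|u uP].
  rewrite (herm_suml hH) big1 // => i _; rewrite (herm_sumr hH) big1 // => j _.
  by rewrite (hermZl hH) (hermZr hH) frame_yy mul0r mulr0.
have yu i : h (y i) u = 0.
  apply: uP; exists (fun j => (i == j)%:R); rewrite (bigD1 i) //= eqxx scale1r.
  by rewrite big1 ?addr0 // => j ji; rewrite eq_sym (negbTE ji) scale0r.
have [_ _ _ /(_ u)[a [b uE]]] := xyF; exists b; rewrite uE big1 ?add0r // => i _.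
by have := yu i; rewrite uE frame_coord_x => ->; rewrite scale0r.
Qed.

Definition frame_lagrangian : lagrangian h := Lagrangian span_submodule span_perp.

End Frame.

(** The unipotent isometry with diagonal (-delta)-hermitian block a, which fixes
    the Lagrangian spanned by x and moves the one spanned by y. *)
Lemma frame_shift (I : finType) (x y : I -> M) (a : I -> D) : hyp_frame x y ->
  (forall i, a i + J (a i) * delta = 0) ->
  hyp_frame x (fun i => y i + (a i : D^c) *: x i).
Proof.
move=> xyF aH; have [xx yy yx span] := xyF; split=> // [i j|i j|u].
- rewrite !(hermDr hH) !(hermDl hH) !(hermZr hH) !(hermZl hH) xx yy yx (frame_xy xyF).
  case: eqP => [->|_]; rewrite ?mul0r ?mulr0 ?mul0r ?mul1r ?addr0 ?add0r //.
  by rewrite addrC aH.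
- by rewrite (hermDl hH) (hermZl hH) yx xx mulr0 addr0.
have [b [c ->]] := span u; exists (fun i => b i - c i * (a i : D^c)), c.
rewrite -!big_split; apply: eq_bigr => i _.
rewrite /= scalerBl scalerDr scalerA [c i *: y i + _]addrC addrA.
by rewrite subrK.
Qed.

Section CommonOpposite.
Hypothesis skew_infinite : infinite_set [set a : D | a + J a * delta = 0]%classic.
Variables (I : finType) (x y : I -> M).
Hypothesis xyF : hyp_frame x y.
Variables (K : finType) (X : K -> lagrangian h).

Lemma lag_isotropic (Y : lagrangian h) u v : lag_set Y u -> lag_set Y v -> h u v = 0.
Proof. by move=> Yu; rewrite {1}lag_perp; apply. Qed.

Let z (a : I -> D) i := y i + (a i : D^c) *: x i.

(** Genericity, one coordinate at a time: if the span of the z_j with j in r meets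
    no X k, then at most one value b makes the vector y_i + x_i b, up to a vector
    of this span, fall into a given X k.  For two such values b, b' the resulting
    vectors pair to b' + b^J delta = b' - b, while X k is isotropic. *)
Lemma generic_shift (r : seq I) : uniq r -> exists a : I -> D,
  (forall i, a i + J (a i) * delta = 0) /\
  forall k (c : I -> D^c), lag_set (X k) (\sum_(i <- r) c i *: z a i) ->
    forall i, i \in r -> c i = 0.
Proof.
elim: r => [_|i r IHr /= /andP[ir /IHr[a [aH aX]]]].
  by exists (fun=> 0); split=> // i; rewrite inv0 mul0r addr0.
pose zb (b : D) := y i + (b : D^c) *: x i.
have zz := frame_yy (frame_shift xyF aH).
have zbz b b' : h (zb b) (zb b') = b' + J b * delta.
  rewrite /zb (hermDr hH) !(hermDl hH) !(hermZr hH) !(hermZl hH) (frame_yy xyF)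
    (frame_xx xyF) (frame_yx xyF) (frame_xy xyF) eqxx.
  by rewrite !(mulr0, mul0r, addr0, add0r, mul1r) addrC.
have zbzj b j : j != i -> h (zb b) (z a j) = 0.
  move=> ji; rewrite /zb /z (hermDr hH) !(hermDl hH) !(hermZr hH) !(hermZl hH) (frame_yy xyF)
    (frame_xx xyF) (frame_yx xyF) (frame_xy xyF) eq_sym (negbTE ji).
  by rewrite !(mul0r, mulr0) !addr0.
have zbs b (c : I -> D^c) : h (zb b) (\sum_(j <- r) c j *: z a j) = 0.
  rewrite (herm_sumr hH) big_seq big1 // => j jr.
  by rewrite (hermZr hH) zbzj ?mul0r //; apply: contraNneq ir => <-.
have ss (c c' : I -> D^c) :
    h (\sum_(j <- r) c j *: z a j) (\sum_(j <- r) c' j *: z a j) = 0.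
  rewrite (herm_suml hH) big1 // => j _; rewrite (herm_sumr hH) big1 // => j' _.
  by rewrite (hermZl hH) (hermZr hH) zz mul0r mulr0.
pose bad k b := exists c : I -> D^c, lag_set (X k) (\sum_(j <- r) c j *: z a j + zb b).
have bad_uniq k b b' : b + J b * delta = 0 -> bad k b -> bad k b' -> b' = b.
  move=> bH [c Xc] [c' Xc']; have := lag_isotropic Xc Xc'.
  rewrite (hermDl hH _ (zb b)) !(hermDr hH _ _ (zb b')) ss zbs zbz (herm_eq0C hH (zbs _ _)).
  rewrite !add0r.
  by move=> E; apply: (addIr (J b * delta)); rewrite E bH.
have b0_ex k : exists b0, forall b, b + J b * delta = 0 -> bad k b -> b = b0.
  have [[b [bH bk]]|no] := pselect (exists b, b + J b * delta = 0 /\ bad k b).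
    by exists b => b' b'H; exact: bad_uniq.
  by exists 0 => b bH bk; case: no; exists b.
have [b0 b0P] := choice b0_ex.
have [b bH bK] : exists2 b, b + J b * delta = 0 & forall k, b <> b0 k.
  apply: contrapT => no; apply: skew_infinite.
  apply: (sub_finite_set (B := range b0)); last exact/finite_image/finite_finset.
  move=> b bH; apply: contrapT => bK; apply: no; exists b => // k bE; apply: bK.
  by exists k.
exists (fun j => if j == i then b else a j); split=> [j|k c].
  by case: ifP.
rewrite big_cons; have -> : \sum_(j <- r) c j *: z (fun j => if j == i then b else a j) j
    = \sum_(j <- r) c j *: z a j.
  rewrite big_seq [RHS]big_seq; apply: eq_bigr => j jr; rewrite /z.
  by case: eqP => // ji; rewrite -ji jr in ir.
rewrite {1}/z eqxx -/(zb b) => Xk.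
(* Otherwise dividing by c i shows that b is the forbidden value b0 k. *)
have ci0 : c i = 0.
  apply: contrapT => /eqP ci; apply: (bK k); apply: b0P => //.
  exists (fun j => ((c i : D)^-1 : D^c) * c j).
  have [_ _ /(_ ((c i : D)^-1 : D^c) _ Xk)] := lag_sub (X k).
  rewrite scalerDr scalerA addrC; set e := (X in X *: zb b).
  have -> : e = 1 by apply: (division_mulrV D_division ci).
  rewrite scale1r scaler_sumr; congr (lag_set _ (_ + _)).
  by apply: eq_bigr => j _; rewrite scalerA.
move=> j; rewrite inE => /orP[/eqP->//|]; apply: (aX k).
by move: Xk; rewrite ci0 scale0r add0r.
Qed.

Lemma common_opposite : exists Y : lagrangian h, forall k, opposite Y (X k) /\ opposite (X k) Y.
Proof.
have [a [aH aX]] := generic_shift (index_enum_uniq I).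
exists (frame_lagrangian (frame_shift xyF aH)) => k.
suff E : opposite (frame_lagrangian (frame_shift xyF aH)) (X k).
  by split=> //; rewrite /opposite setIC.
apply/seteqP; split=> [_ [/= [b ->] Xb]|_ ->].
  rewrite /= big1 // => i _; rewrite (aX _ _ Xb) ?scale0r //; exact: mem_index_enum.
have [X0 _ _] := lag_sub (X k); split=> //.
by case: (span_submodule (fun i => y i + (a i : D^c) *: x i)).
Qed.

End CommonOpposite.

End OneForm.
End Frames.

(** * Frames of hyperbolic modules *)
Section FrameExamples.
Variables (D : unitRingType) (J : involution D) (delta : D).

Lemma hyperbolic_frame (M : rmodType D) (h : M -> M -> D) : hyperbolic J delta h ->
  exists n (x y : 'I_n -> M), hyp_frame h x y.
Proof.
move=> [hH [X [[n [e [eS eI]]] [f [[g fK gK] fh]]]]].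
have coord_ex v : exists a : 'I_n -> D^c, v = \sum_i a i *: e i.
  by have : setT v by []; rewrite eS => -[a ->]; exists a.
have [c cE] := choice coord_ex.
have c_uniq (a : 'I_n -> D^c) v : v = \sum_i a i *: e i -> c v = a.
  move=> vE; apply: funext => i; apply/eqP; rewrite -subr_eq0; apply/eqP.
  apply: (eI (fun i => c v i - a i)).
  rewrite (eq_bigr (fun j => c v j *: e j - a j *: e j)) => [|j _]; last exact: scalerBl.
  by rewrite sumrB -cE -vE subrr.
have c_lin i : is_linear_form (fun v => (c v i : D)).
  split=> [u v|a v].
    rewrite (c_uniq (fun i => c u i + c v i)) // [in LHS](cE u) [in LHS](cE v) -big_split.
    by apply: eq_bigr => j _; rewrite scalerDl.
  rewrite (c_uniq (fun i => a * c v i)) // [in LHS](cE v) scaler_sumr.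
  by apply: eq_bigr => j _; rewrite scalerA.
(* The module structure on the dual depends on J, so it has to be named. *)
pose Xd : rmodType D := Defs_dual__canonical__GRing_Lmodule J X.
pose d i : Xd := Dual (c_lin i).
have de i j : (d i : dual X) (e j) = (i == j)%:R.
  rewrite /= (c_uniq (fun i => (i == j)%:R)) //.
  rewrite (bigD1 j) //= eqxx scale1r big1 ?addr0 // => k kj.
  by rewrite (negbTE kj) scale0r.
exists n, (fun i => f (e i, 0)), (fun i => f (0, d i)); split=> [i j|i j|i j|u].
- by rewrite fh /hyp_form /= inv0 mul0r addr0.
- rewrite fh /hyp_form /=; have [dD _] := c_lin i; have [dD' _] := c_lin j.
  have -> : (c 0 i : D) = 0 by apply: (addrI (c 0 i : D)); rewrite -dD !addr0.
  have -> : (c 0 j : D) = 0 by apply: (addrI (c 0 j : D)); rewrite -dD' !addr0.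
  by rewrite inv0 mul0r addr0.
- by rewrite fh /hyp_form -de /= inv0 mul0r addr0.
exists (c (g u).1), (fun i => J ((g u).2 (e i))).
rewrite -[LHS]gK.
have sum1 (a : 'I_n -> D^c) : \sum_i a i *: f (e i, 0) = f (\sum_i a i *: e i, 0).
  rewrite (eq_bigr (fun i => f (a i *: (e i, 0)))) => [|i _]; last by rewrite linearZ_LR.
  rewrite -linear_sum; congr (f _); elim/big_rec2: _ => // i u1 u2 _ ->.
  by congr pair; rewrite /= scaler0 addr0.
have sum2 (a : 'I_n -> D^c) : \sum_i a i *: f (0, d i) = f (0, \sum_i a i *: d i).
  rewrite (eq_bigr (fun i => f (a i *: (0, d i)))) => [|i _]; last by rewrite linearZ_LR.
  rewrite -linear_sum; congr (f _); elim/big_rec2: _ => // i u1 u2 _ ->.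
  by congr pair; rewrite /= scaler0 addr0.
rewrite sum1 sum2 -linearD; congr (f _); case: (g u) => v xi.
congr pair; rewrite /= ?addr0 -?cE ?add0r //.
apply: dual_eq => w; case: (dualP xi) => xiD xiZ.
have dual_sum (a : 'I_n -> D^c) : (\sum_i a i *: d i : dual X) w = \sum_i J (a i) * c w i.
  by elim/big_rec2: _ => // i u1 u2 _ <-.
have xi_sum (a : 'I_n -> D^c) : xi (\sum_i a i *: e i) = \sum_i xi (e i) * a i.
  have xi0 : xi 0 = 0 by apply: (addrI (xi 0)); rewrite -xiD !addr0.
  by elim/big_rec2: _ => // i u1 u2 _ <-; rewrite xiD xiZ.
by rewrite dual_sum [in LHS](cE w) xi_sum; apply: eq_bigr => i _; rewrite inv_inv.
Qed.

Lemma osum_hermitian (M1 M2 : rmodType D) (h1 : M1 -> M1 -> D) (h2 : M2 -> M2 -> D) :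
  hermitian J delta h1 -> hermitian J delta h2 -> hermitian J delta (osum h1 h2).
Proof.
move=> H1 H2; split=> [u v w|u v w|a b u v|u v]; rewrite /osum /=.
- by rewrite (hermDl H1) (hermDl H2) addrACA.
- by rewrite (hermDr H1) (hermDr H2) addrACA.
- case: H1 H2 => _ _ Z1 _ [_ _ Z2 _].
  by rewrite Z1 Z2 mulrDr mulrDl.
- by rewrite (hermC H1) (hermC H2) inv_add mulrDl.
Qed.

Lemma osum_frame (M1 M2 : rmodType D) (h1 : M1 -> M1 -> D) (h2 : M2 -> M2 -> D)
    (I1 I2 : finType) (x1 y1 : I1 -> M1) (x2 y2 : I2 -> M2) :
  hermitian J delta h1 -> hermitian J delta h2 ->
  hyp_frame h1 x1 y1 -> hyp_frame h2 x2 y2 ->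
  exists x y : I1 + I2 -> M1 * M2, hyp_frame (osum h1 h2) x y.
Proof.
move=> H1 H2 [xx1 yy1 yx1 sp1] [xx2 yy2 yx2 sp2].
pose inj (e1 : I1 -> M1) (e2 : I2 -> M2) (i : I1 + I2) : M1 * M2 :=
  match i with inl i => (e1 i, 0) | inr i => (0, e2 i) end.
have inj_sum (e1 : I1 -> M1) e2 (a : I1 + I2 -> D^c) : \sum_i a i *: inj e1 e2 i =
    (\sum_i a (inl i) *: e1 i, \sum_i a (inr i) *: e2 i).
  rewrite big_sumType /= [LHS]surjective_pairing; congr pair.
    rewrite /= !(raddf_sum (@fst M1 M2)) /= [X in _ + X]big1 ?addr0 // => i _.
    by rewrite scaler0.
  rewrite /= !(raddf_sum (@snd M1 M2)) /= [X in X + _]big1 ?add0r // => i _.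
  by rewrite scaler0.
exists (inj x1 x2), (inj y1 y2); split=> [[] i [] j|[] i [] j|[] i [] j|[u1 u2]];
  rewrite /osum /= ?(herm0l H1) ?(herm0r H1) ?(herm0l H2) ?(herm0r H2) ?addr0 ?add0r //.
have [a1 [b1 ->]] := sp1 u1; have [a2 [b2 ->]] := sp2 u2.
exists (fun i => match i with inl i => a1 i | inr i => a2 i end).
exists (fun i => match i with inl i => b1 i | inr i => b2 i end).
by rewrite !inj_sum.
Qed.

End FrameExamples.

(** * Opposite Lagrangians *)
Lemma lin_comb_subproof (D : nzRingType) (M : rmodType D) n (e : 'I_n -> M) :
  linear (fun u : 'cV[D^c]_n => \sum_i u i 0 *: e i).
Proof.
move=> a u v; rewrite scaler_sumr -big_split; apply: eq_bigr => i _.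
by rewrite !mxE scalerDl scalerA.
Qed.

Definition lin_comb (D : nzRingType) (M : rmodType D) n (e : 'I_n -> M) :
    {linear 'cV[D^c]_n -> M} :=
  HB.pack_for {linear 'cV[D^c]_n -> M} (fun u : 'cV[D^c]_n => \sum_i u i 0 *: e i)
    (GRing.isLinear.Build _ _ _ _ _ (lin_comb_subproof e)).

Lemma lin_combE (D : nzRingType) (M : rmodType D) n (e : 'I_n -> M) u :
  lin_comb e u = \sum_i u i 0 *: e i.
Proof. by []. Qed.

Section Lagrangians.
Variables (D : unitRingType) (D_division : GRing.field_axiom D).
Variables (J : involution D) (delta : D) (delta_sign : delta = 1 \/ delta = -1).
Variables (M : rmodType D) (h : M -> M -> D) (hH : hermitian J delta h).

Lemma opposite_sym (X Y : lagrangian h) : opposite X Y -> opposite Y X.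
Proof. by rewrite /opposite setIC. Qed.

Lemma opposite_eq0 (X Y : lagrangian h) u :
  opposite X Y -> lag_set X u -> lag_set Y u -> u = 0.
Proof. by move=> XY Xu Yu; have : (lag_set X `&` lag_set Y)%classic u by []; rewrite XY. Qed.

Lemma lag_orthogonal (X : lagrangian h) u :
  (forall v, lag_set X v -> h v u = 0) -> lag_set X u.
Proof. by move=> uX; rewrite lag_perp. Qed.

Variables (I : finType) (fx fy : I -> M) (frame : hyp_frame h fx fy).

(** The sum X + Y has orthogonal complement contained in both X and Y, hence zero.
    If it missed a vector u, then u together with a basis w of X + Y would be
    independent, and its dual family would contain a nonzero vector orthogonal to
    X + Y. *)
Lemma opposite_add (X Y : lagrangian h) u : opposite X Y ->
  exists x y, [/\ lag_set X x, lag_set Y y & u = x + y].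
Proof.
move=> XY; have [X0 XD XZ] := lag_sub X; have [Y0 YD YZ] := lag_sub Y.
pose S : set M := [set u | exists x y, [/\ lag_set X x, lag_set Y y & u = x + y]]%classic.
have Ssub : is_submodule S.
  split.
  - by exists 0, 0; split; rewrite ?addr0.
  - move=> _ _ [x [y [Xx Yy ->]]] [x' [y' [Xx' Yy' ->]]].
    by exists (x + x'), (y + y'); split; [exact: XD | exact: YD | rewrite addrACA].
  - move=> a _ [x [y [Xx Yy ->]]].
    by exists (a *: x), (a *: y); split; [exact: XZ | exact: YZ | rewrite scalerDr].
have XS x : lag_set X x -> S x by move=> Xx; exists x, 0; split; rewrite ?addr0.
have YS y : lag_set Y y -> S y by move=> Yy; exists 0, y; split; rewrite ?add0r.
apply: contrapT => noS; have Su : ~ S u by [].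
have [n [w wB]] := frame_submodule_basis D_division delta_sign hH frame Ssub.
have [_ wI] := wB; have [S0 SD SZ] := Ssub.
have [|m mE] := dual_family D_division hH (frame_nondegenerate delta_sign hH frame)
   (x := cons_fun u w).
  move=> a; rewrite sum_cons_fun => a0.
  have Ss : S (\sum_i a (fintype.lift ord0 i) *: w i).
    by apply: submodule_sum => // i; exact: basis_mem.
  have a00 : a ord0 = 0.
    apply: contrapT => /eqP a0'; apply: Su.
    have -> : u = ((a ord0 : D)^-1 : D^c) *: (- \sum_i a (fintype.lift ord0 i) *: w i).
      move/eqP: a0; rewrite addr_eq0 => /eqP <-; rewrite scalerA; set e := (X in X *: _).
      have -> : e = 1 by apply: (division_mulrV D_division a0').
      by rewrite scale1r.
    by apply: (SZ); rewrite -scaleN1r; exact: SZ.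
  move=> i; case: (unliftP ord0 i) => [j ->|->//].
  apply: (wI (fun j => a (fintype.lift ord0 j))).
  by move: a0; rewrite a00 scale0r add0r.
have m_w j : h (m ord0) (w j) = 0 by have := mE ord0 (fintype.lift ord0 j); rewrite cons_funS.
have m_S s : S s -> h s (m ord0) = 0.
  have [-> _] := wB => -[a ->]; apply: (herm_eq0C hH); rewrite (herm_sumr hH) big1 // => i _.
  by rewrite (hermZr hH) m_w mul0r.
have m0 : m ord0 = 0.
  apply: (opposite_eq0 XY); apply: lag_orthogonal => v; first by move=> /XS/m_S.
  by move=> /YS/m_S.
have := mE ord0 ord0; rewrite cons_fun0 m0 (herm0l hH) eqxx => /eqP.
by rewrite eq_sym oner_eq0.
Qed.

(** Independence is read off by pairing with x.  For spanning, subtracting from v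
    the combination with the same pairings leaves a vector of Y orthogonal to X,
    that is, an element of both. *)
Lemma dual_basis (X Y : lagrangian h) n (x y : 'I_n -> M) : opposite X Y ->
  is_basis X x -> (forall i, lag_set Y (y i)) ->
  (forall i j, h (y i) (x j) = (i == j)%:R) -> is_basis Y y.
Proof.
move=> XY xB Yy yx; have h_sum (a : 'I_n -> D^c) j : h (\sum_i a i *: y i) (x j) = J (a j).
  rewrite (herm_suml hH) (bigD1 j) //= (hermZl hH) yx eqxx mulr1 big1 ?addr0 // => i ij.
  by rewrite (hermZl hH) yx (negbTE ij) mulr0.
split=> [|a a0 i]; last first.
  by have := h_sum a i; rewrite a0 (herm0l hH) => /esym/(congr1 J); rewrite inv_inv inv0.
apply/seteqP; split=> [v Yv|_ [a ->]]; last by apply: submodule_sum => //; exact: lag_sub.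
exists (fun i => J (h v (x i))); apply/eqP; rewrite -subr_eq0; apply/eqP.
set s := \sum_i _.
apply: (opposite_eq0 XY); last first.
  apply: submoduleB => //; first exact: lag_sub.
  by apply: submodule_sum => //; exact: lag_sub.
apply: lag_orthogonal => u; have [-> _] := xB => -[a ->]; apply: (herm_eq0C hH).
rewrite (herm_sumr hH) big1 // => i _; rewrite (hermZr hH) (hermDl hH) (hermNl hH).
by rewrite h_sum inv_inv subrr mul0r.
Qed.

Lemma lagrangian_dual_bases (X Y : lagrangian h) : opposite X Y ->
  exists n (x y : 'I_n -> M), [/\ is_basis X x, is_basis Y y &
    forall i j, h (y i) (x j) = (i == j)%:R].
Proof.
move=> XY.
have [n [x xB]] := frame_submodule_basis D_division delta_sign hH frame (lag_sub X).
have [m mE] := dual_family D_division hH (frame_nondegenerate delta_sign hH frame) xB.2.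
have dec i : exists y, lag_set Y y /\ lag_set X (m i - y).
  have [u [y [Xu Yy ->]]] := opposite_add (m i) XY.
  by exists y; split=> //; rewrite addrK.
have [y yP] := choice dec.
have yx i j : h (y i) (x j) = (i == j)%:R.
  rewrite -mE -[m i](subrK (y i)) (hermDl hH).
  rewrite (lag_isotropic (proj2 (yP i)) (basis_mem j xB)) add0r.
  by [].
exists n, x, y; split=> //; apply: (dual_basis XY xB) => // i; exact: (proj1 (yP i)).
Qed.

End Lagrangians.

(** * The hermitian form of three Lagrangians *)
Section MatrixForms.
Variables (D : unitRingType) (J : involution D) (eps : D).
Hypothesis eps_sign : eps = 1 \/ eps = -1.

Lemma mx_form_hermitian n (t : 'M[D]_n) : (forall i j, t i j = J (t j i) * eps) ->
  hermitian J eps (mx_form J t).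
Proof.
move=> tH; split=> [u v w|u v w|a b u v|u v].
- rewrite /mx_form -big_split; apply: eq_bigr => i _; rewrite -big_split; apply: eq_bigr => j _.
  by rewrite /= !mxE inv_add !mulrDl.
- rewrite /mx_form -big_split; apply: eq_bigr => i _; rewrite -big_split; apply: eq_bigr => j _.
  by rewrite /= !mxE mulrDr.
- rewrite /mx_form big_distrr big_distrl; apply: eq_bigr => i _.
  rewrite big_distrr big_distrl; apply: eq_bigr => j _ /=; rewrite !mxE.
  transitivity (J ((u i 0 : D) * (a : D)) * t i j * ((v j 0 : D) * (b : D))) => //.
  by rewrite inv_mul !mulrA.
rewrite /mx_form exchange_big /= (big_morph J (@inv_add _ J) (inv0 J)) big_distrl.
apply: eq_bigr => j _; rewrite (big_morph J (@inv_add _ J) (inv0 J)) big_distrl.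
apply: eq_bigr => i _ /=; rewrite !inv_mul inv_inv tH -!mulrA.
by rewrite (comm_sign eps_sign).
Qed.

Lemma mf_hermitian (a : mform J eps) : hermitian J eps (mf_form a).
Proof. exact: mx_form_hermitian (@mf_herm _ _ _ a). Qed.

End MatrixForms.

Section KappaForms.
Variables (D : unitRingType) (M : rmodType D) (h : M -> M -> D).

Definition parametrizes (Y : set M) (V : rmodType D) (beta : V -> M) : Prop :=
  injective beta /\ forall v, Y v <-> exists u, beta u = v.

Definition is_graph (X Z : set M) (V : rmodType D) (beta T : V -> M) : Prop :=
  forall u, X (T u) /\ Z (beta u + T u).

(** A coordinate-free description of kappa(X, Y, Z).  The module V parametrizes Y
    and may be varied freely, which turns identities between matrices and their
    inverses into changes of the parametrization. *)
Definition kappa_form (X Y Z : set M) (V : rmodType D) (k : V -> V -> D) : Prop :=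
  exists beta T : {linear V -> M},
    [/\ parametrizes Y beta, is_graph X Z beta T &
        forall u v, k u v = h (beta u) (T v)].

(** Both parametrizations of Y differ by a linear bijection, and the component in
    X is determined by the one in Y because X and Z meet trivially. *)
Lemma kappa_form_unique (X Y Z : lagrangian h) (V V' : rmodType D)
    (k : V -> V -> D) (k' : V' -> V' -> D) :
  opposite X Z -> kappa_form X Y Z k -> kappa_form X Y Z k' -> isometric k k'.
Proof.
move=> XZ [b [T [[bI bY] TXZ kE]]] [b' [T' [[b'I b'Y] T'XZ k'E]]].
have f_ex u : exists u', b' u' = b u by apply/b'Y/bY; exists u.
have [f fE] := choice f_ex.
have g_ex u : exists u', b u' = b' u by apply/bY/b'Y; exists u.
have [g gE] := choice g_ex.
have fl : linear f by move=> a u v; apply: b'I; rewrite fE !linearP !fE.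
exists (HB.pack_for {linear V -> V'} f (GRing.isLinear.Build _ _ _ _ _ fl)).
split=> [|u v] /=.
  by exists g => u; [apply: bI; rewrite gE fE | apply: b'I; rewrite fE gE].
rewrite kE k'E fE; congr (h _ _).
apply/eqP; rewrite -subr_eq0; apply/eqP; apply: (opposite_eq0 XZ).
  by apply: submoduleB => //; [exact: lag_sub | case: (T'XZ (f v)) | case: (TXZ v)].
have -> : T' (f v) - T v = (b' (f v) + T' (f v)) - (b v + T v).
  by rewrite fE opprD addrACA subrr add0r.
by apply: submoduleB => //; [exact: lag_sub | case: (T'XZ (f v)) | case: (TXZ v)].
Qed.

Lemma kappa_form_act (g : unitary h) (X Y Z : lagrangian h) (V : rmodType D)
    (k : V -> V -> D) : kappa_form X Y Z k ->
  kappa_form (lag_act g X) (lag_act g Y) (lag_act g Z) k.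
Proof.
move=> [b [T [[bI bY] TXZ kE]]].
pose gL := HB.pack_for {linear M -> M} (g : M -> M)
  (GRing.isLinear.Build _ _ _ _ (g : M -> M) (@unitary_linear _ _ _ g)).
exists (gL \o b), (gL \o T); split; [split|..].
- by apply: inj_comp => //; exact: (can_inj (@unitaryK _ _ _ g)).
- move=> v; split=> [[w /bY[u <-] <-]|[u <-]]; first by exists u.
  by exists (b u) => //; apply/bY; exists u.
- move=> u; have [XT ZT] := TXZ u; split; first by exists (T u).
  by exists (b u + T u); rewrite // -[LHS]/(gL (b u + T u)) linearD.
- by move=> u v /=; rewrite unitary_isom.
Qed.

End KappaForms.

Section Kappa.
Variables (D : unitRingType) (D_division : GRing.field_axiom D).
Variables (J : involution D) (eps : D) (eps_sign : eps = 1 \/ eps = -1).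

Let neps_sign : - eps = 1 \/ - eps = -1.
Proof. by case: eps_sign => ->; [right | left; rewrite opprK]. Qed.

Section OneModule.
Variables (M : rmodType D) (h : M -> M -> D) (hH : hermitian J (- eps) h).

Lemma is_kappa_form (X Y Z : lagrangian h) (a : mform J eps) :
  is_kappa X Y Z a -> kappa_form h X Y Z (mf_form a).
Proof.
move=> [x [y [xB yB yx zB]]].
pose w j := \sum_i (mf_mx a i j : D^c) *: x i.
have yw i j : h (y i) (w j) = mf_mx a i j.
  rewrite (herm_sumr hH) (bigD1 i) //= (hermZr hH) yx eqxx mul1r big1 ?addr0 // => k ki.
  by rewrite (hermZr hH) yx eq_sym (negbTE ki) mul0r.
have [yE yI] := yB.
exists (lin_comb y), (lin_comb w); split; [split|..].
- move=> u v uv; apply/matrixP => i j; rewrite [j]ord1; apply/eqP; rewrite -subr_eq0; apply/eqP.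
  have := yI (fun i => u i 0 - v i 0) _ i; apply.
  rewrite (eq_bigr (fun i => u i 0 *: y i - v i 0 *: y i)) => [|k _]; last exact: scalerBl.
  by rewrite sumrB -!lin_combE uv subrr.
- move=> v; rewrite yE; split=> [[c ->]|[u <-]]; last by exists (fun i => u i 0).
  by exists (\col_i c i); rewrite lin_combE; apply: eq_bigr => i _; rewrite mxE.
- move=> u; split.
    apply: submodule_sum => [|j]; first exact: lag_sub.
    apply: submodule_sum => [|i]; [exact: lag_sub | exact: basis_mem xB].
  have [-> _] := zB; exists (fun i => u i 0); rewrite !lin_combE -big_split.
  by apply: eq_bigr => i _; rewrite scalerDr.
- move=> u v; rewrite /mf_form /mx_form !lin_combE (herm_suml hH); apply: eq_bigr => i _.
  rewrite (herm_sumr hH); apply: eq_bigr => j _.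
  by rewrite (hermZl hH) (hermZr hH) yw mulrA.
Qed.

Variables (I : finType) (fx fy : I -> M) (frame : hyp_frame h fx fy).

(** The relation h(z_i, z_j) = 0 says that t is eps-hermitian.  A vector u in the
    radical of t gives T u orthogonal to Y, hence T u = 0, hence beta u in both Y
    and Z. *)
Lemma is_kappa_exists (X Y Z : lagrangian h) :
  opposite X Y -> opposite X Z -> opposite Y Z -> exists a : mform J eps, is_kappa X Y Z a.
Proof.
move=> XY XZ YZ.
have [n [x [y [xB yB yx]]]] := lagrangian_dual_bases D_division neps_sign hH frame XY.
have t_ex j : exists t : 'I_n -> D^c, lag_set Z (y j + \sum_i t i *: x i).
  have [u [z [Xu Zz yE]]] := opposite_add D_division neps_sign hH frame (y j) XZ.
  have : lag_set X (- u).
    by rewrite -[- u]add0r; apply: submoduleB => //; [exact: lag_sub | case: (lag_sub X)].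
  have [XE _] := xB; rewrite XE => -[t tE]; exists t.
  by rewrite -tE yE addrAC subrr add0r.
have [tt ttZ] := choice t_ex.
pose t : 'M[D]_n := \matrix_(i, j) tt j i.
pose w j := \sum_i (t i j : D^c) *: x i.
have wX j : lag_set X (w j).
  by apply: submodule_sum => [|i]; [exact: lag_sub | exact: basis_mem xB].
have zZ j : lag_set Z (y j + w j).
  rewrite /w (eq_bigr (fun i => tt j i *: x i)) // => i _; by rewrite mxE.
have yw i j : h (y i) (w j) = t i j.
  rewrite (herm_sumr hH) (bigD1 i) //= (hermZr hH) yx eqxx mul1r big1 ?addr0 // => k ki.
  by rewrite (hermZr hH) yx eq_sym (negbTE ki) mul0r.
have Yy i : lag_set Y (y i) by exact: basis_mem yB.
have tH i j : t i j = J (t j i) * eps.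
  have := lag_isotropic (zZ i) (zZ j).
  rewrite (hermDl hH _ (w i)) !(hermDr hH _ _ (w j)) (lag_isotropic (Yy i) (Yy j)).
  rewrite (lag_isotropic (wX i) (wX j)) add0r addr0 yw (hermC hH (w i)) yw mulrN.
  by move/eqP; rewrite subr_eq0 => /eqP.
have zx i j : h (y i + w i) (x j) = (i == j)%:R.
  by rewrite (hermDl hH) yx (lag_isotropic (wX i) (basis_mem j xB)) addr0.
have zB := dual_basis hH XZ xB zZ zx.
have form_lin u v : mx_form J t u v = h (lin_comb y u) (lin_comb w v).
  rewrite /mx_form !lin_combE (herm_suml hH); apply: eq_bigr => i _.
  rewrite (herm_sumr hH); apply: eq_bigr => j _.
  by rewrite (hermZl hH) (hermZr hH) yw mulrA.
have t_nd : nondegenerate (mx_form J t).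
  move=> u u0; have Tu0 : lin_comb w u = 0.
    have XT : lag_set X (lin_comb w u) by apply: submodule_sum => //; exact: lag_sub.
    apply: (opposite_eq0 XY) => //; apply: lag_orthogonal => v.
    have [-> _] := yB => -[c ->]; have -> : \sum_i c i *: y i = lin_comb y (\col_i c i).
      by rewrite lin_combE; apply: eq_bigr => i _; rewrite mxE.
    rewrite -form_lin; exact: (herm_eq0C (mx_form_hermitian eps_sign tH) (u0 _)).
  have bu0 : lin_comb y u = 0.
    apply: (opposite_eq0 YZ); first by apply: submodule_sum => //; exact: lag_sub.
    have -> : lin_comb y u = \sum_i u i 0 *: (y i + w i).
      rewrite -[LHS]addr0 -[X in _ + X = _]Tu0 !lin_combE -big_split.
      by apply: eq_bigr => i _; rewrite scalerDr.
    by apply: submodule_sum => //; exact: lag_sub.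
  apply/matrixP => i j; rewrite [j]ord1 mxE.
  by have [_ yI] := yB; apply: (yI (fun i => u i 0)).
exists (MForm tH t_nd), x, y; split=> //.
Qed.

Lemma kappaE (X Y Z : lagrangian h) (a : mform J eps) :
  opposite X Y -> opposite X Z -> opposite Y Z -> kappa_form h X Y Z (mf_form a) ->
  kappa J eps X Y Z = \pi_(iso_class J eps) a.
Proof.
move=> XY XZ YZ aP; rewrite /kappa; set S := (X in xget _ X).
have [b bP] := is_kappa_exists XY XZ YZ.
have [c cP ->] : S (xget 0 S) by apply: (xgetI 0); exists b; [exact: bP|].
by apply/iso_classP; apply: (kappa_form_unique XZ) aP; exact: is_kappa_form.
Qed.

Lemma kappa_form_exists (X Y Z : lagrangian h) :
  opposite X Y -> opposite X Z -> opposite Y Z ->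
  exists a : mform J eps, kappa_form h X Y Z (mf_form a).
Proof.
by move=> XY XZ /(is_kappa_exists XY XZ)[a aP]; exists a; exact: is_kappa_form.
Qed.

End OneModule.
End Kappa.

(** * Isometries and relations in the Witt group *)
Section FormIdentities.
Variables (D : nzRingType) (J : involution D) (eps : D) (V : rmodType D).

(** The diagonal of V + V, with form s + (t - s) = t, has as its orthogonal
    complement the vectors (v - w v, - w v), on which the form is s(u, v - w v). *)
Lemma isometric_cocycle (s t : V -> V -> D) (w : {linear V -> V}) :
  hermitian J eps s -> hermitian J eps t -> (forall u v, t u (w v) = s u v) ->
  isometric (osum t (fun u v => s u (v - w v))) (osum s (fun u v => t u v - s u v)).
Proof.
move=> sH tH tw.
have tw' u v : t (w u) v = s u v by rewrite (hermC tH) tw -(hermC sH).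
pose F (p : V * V) : V * V := (p.1 + (p.2 - w p.2), p.1 - w p.2).
have Fl : linear F.
  move=> a p q; rewrite /F /= !linearP; congr pair => /=.
    by rewrite [a *: p.2 + _ + _]addrACA [LHS]addrACA !scalerDr.
  by rewrite scalerDr addrACA.
exists (HB.pack_for {linear (V * V)%type -> (V * V)%type} F
  (GRing.isLinear.Build _ _ _ _ F Fl)); split=> /= [|[u1 v1] [u2 v2]].
  exists (fun p => (p.2 + w (p.1 - p.2), p.1 - p.2)) => -[u v]; rewrite /F /=.
    have -> : u + (v - w v) - (u - w v) = v.
      by rewrite opprB [u + (v - w v)]addrA addrA subrK addrC addKr.
    by rewrite subrK.
  by rewrite addrK [X in _ + X]addrC addrA addrK addrC subrK.
rewrite /osum /F /=.
rewrite !(hermDl sH, hermDr sH, hermDl tH, hermDr tH, hermNl sH, hermNr sH, hermNl tH, hermNr tH).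
rewrite !tw !tw'.
rewrite !opprD !opprK !addrA.
rewrite ((@GRing.add D).[ACl (10*5*6)*(1*14)*(2*11)*(3*15)*(4*12)*(7*16)*(8*13)*(9*17)]).
by rewrite !(subrr, addNr, addr0).
Qed.

(** In s + (-s) + (-s) the vectors (x, x, 0) and the vectors (y, 0, y) form two
    isotropic subspaces in duality under s; their common orthogonal complement
    consists of the vectors (z, z, z) and carries -s.  The third summand is what
    makes the argument work in characteristic 2, where s + (-s) is metabolic but
    in general not hyperbolic. *)
Lemma isometric_metabolic (s : V -> V -> D) : hermitian J eps s ->
  isometric (osum (fun p q : V * V => s p.1 q.2 + s p.2 q.1) (fun u v => - s u v))
    (osum (osum s (fun u v => - s u v)) (fun u v => - s u v)).
Proof.
move=> sH; pose F (p : V * V * V) : V * V * V :=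
  (p.1.1 + p.1.2 + p.2, p.1.1 + p.2, p.1.2 + p.2).
have Fl : linear F.
  move=> a p q; rewrite /F /=; congr (_, _, _) => /=; rewrite !scalerDr.
  - by rewrite [a *: p.1.1 + _ + _]addrACA [LHS]addrACA.
  - by rewrite [LHS]addrACA.
  - by rewrite [LHS]addrACA.
exists (HB.pack_for {linear (V * V * V)%type -> (V * V * V)%type} F
  (GRing.isLinear.Build _ _ _ _ F Fl)); split=> /= [|[[u1 v1] w1] [[u2 v2] w2]].
  pose G (p : V * V * V) : V * V * V :=
    (p.1.1 - p.2, p.1.1 - p.1.2, p.1.2 + p.2 - p.1.1).
  exists G => -[[u v] w]; rewrite /G /F /=.
    have -> : u + v + w - (v + w) = u by rewrite -[u + v + w]addrA addrK.
    have -> : u + v + w - (u + w) = v by rewrite [u + v + w]addrAC [u + w + v]addrC addrK.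
    by rewrite [u + w + _]addrACA addrA [u + v + w + w]addrC addrK.
  rewrite !addrA; congr (_, _, _).
  - rewrite ((@GRing.add V).[ACl 1*(3*7)*(5*4)*(6*2)]).
    by rewrite !subrr !addr0.
  - by rewrite ((@GRing.add V).[ACl 3*(1*5)*(4*2)]) !subrr !addr0.
  - by rewrite ((@GRing.add V).[ACl 4*(1*5)*(3*2)]) !subrr !addr0.
rewrite /osum /F /=.
rewrite !(hermDl sH, hermDr sH).
rewrite !opprD !addrA.
rewrite ((@GRing.add D).[ACl (2*4*13)*(1*10)*(3*11)*(5*14)*(6*15)*(7*12)*(8*16)*(9*17)]).
by rewrite !(subrr, addr0).
Qed.

End FormIdentities.

Section WittRelations.
Variables (D : unitRingType) (D_division : GRing.field_axiom D).
Variables (J : involution D) (eps : D) (eps_sign : eps = 1 \/ eps = -1).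

Lemma witt_classD (x y : iso_class J eps) :
  witt_class (x + y) = witt_class x + witt_class y.
Proof.
rewrite /witt_class -[RHS](@raddfD _ _ (\pi_(witt J eps))); congr (\pi_(_) _).
by rewrite /to_completion [RHS]gc_addE /= addr0.
Qed.

Lemma witt_hyperbolic (a : mform J eps) : hyperbolic J eps (mf_form a) ->
  witt_class (\pi_(iso_class J eps) a) = 0.
Proof.
move=> aH; apply/eqP; rewrite -[0](raddf0 (\pi_(witt J eps))) -Quotient.idealrBE subr0.
apply/asboolP => H _ HS; apply: HS; by exists a.
Qed.

Lemma isometric_pi_add (a b : mform J eps) :
  \pi_(iso_class J eps) a + \pi_(iso_class J eps) b = \pi_(iso_class J eps) (mf_add a b).
Proof. exact: iso_addE. Qed.

(** The nondegenerate form a identifies V with its dual, which turns the form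
    a(p_1, q_2) + a(p_2, q_1) on V + V into the hyperbolic form on V. *)
Lemma hyperbolic_double (a : mform J eps) : exists2 H : mform J eps, hyperbolic J eps (mf_form H) &
  isometric (mf_form H) (fun p q : 'cV[D^c]_(mf_dim a) * 'cV[D^c]_(mf_dim a) =>
     mf_form a p.1 q.2 + mf_form a p.2 q.1).
Proof.
have aH := mf_hermitian eps_sign a.
set n := mf_dim a in aH *; pose t := block_mx 0 (mf_mx a) (mf_mx a) 0 : 'M[D]_(n + n).
have tE u v : mx_form J t u v = mf_form a (usubmx u) (dsubmx v) + mf_form a (dsubmx u) (usubmx v).
  rewrite /mf_form /mx_form big_split_ord /=; congr (_ + _); apply: eq_bigr => i _.
    rewrite big_split_ord /= [X in X + _]big1 ?add0r => [|j _].
      by apply: eq_bigr => j _; rewrite block_mxEur !mxE.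
    by rewrite block_mxEul mxE mulr0 mul0r.
  rewrite big_split_ord /= [X in _ + X]big1 ?addr0 => [|j _].
    by apply: eq_bigr => j _; rewrite block_mxEdl !mxE.
  by rewrite block_mxEdr mxE mulr0 mul0r.
have tH i j : t i j = J (t j i) * eps.
  rewrite /t; case: (split_ordP i) (split_ordP j) => i' -> [] j' ->;
  by rewrite ?block_mxEul ?block_mxEur ?block_mxEdl ?block_mxEdr -?mf_herm //
    !mxE inv0 mul0r.
have t_nd : nondegenerate (mx_form J t).
  move=> u u0; rewrite -[u]vsubmxK.
  have -> : usubmx u = 0.
    apply: (mf_nondeg (m := a)) => v; have := u0 (col_mx 0 v).
    by rewrite tE col_mxKu col_mxKd (herm0r aH) addr0.
  have -> : dsubmx u = 0.
    apply: (mf_nondeg (m := a)) => v; have := u0 (col_mx v 0).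
    by rewrite tE col_mxKu col_mxKd (herm0r aH) add0r.
  by rewrite col_mx0.
pose H := MForm tH t_nd.
have Hiso : isometric (mf_form H) (fun p q : 'cV[D^c]_n * 'cV[D^c]_n =>
     mf_form a p.1 q.2 + mf_form a p.2 q.1).
  pose F (u : 'cV[D^c]_(n + n)) : 'cV[D^c]_n * 'cV[D^c]_n := (usubmx u, dsubmx u).
  have Fl : linear F by move=> b u v; congr pair; apply/matrixP => i j; rewrite !mxE.
  exists (HB.pack_for {linear 'cV[D^c]_(n + n) -> ('cV[D^c]_n * 'cV[D^c]_n)%type} F
    (GRing.isLinear.Build _ _ _ _ F Fl)); split=> /= [|u v]; last exact: esym (tE u v).
  exists (fun u => col_mx u.1 u.2) => [u|[u1 u2]]; rewrite /F /= ?vsubmxK //.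
  by rewrite col_mxKu col_mxKd.
exists H => //; split; first exact: mf_hermitian.
pose e (i : 'I_n) : 'cV[D^c]_n := delta_mx i 0.
have eE (u : 'cV[D^c]_n) : u = \sum_i u i 0 *: e i.
  apply/matrixP => i j; rewrite [j]ord1 summxE (bigD1 i) //= !mxE !eqxx mulr1.
  by rewrite big1 ?addr0 // => k ki; rewrite !mxE eq_sym (negbTE ki) mulr0.
have eI : independent e.
  move=> c c0 i; have := congr1 (fun u : 'cV[D^c]_n => u i 0) c0.
  rewrite /= summxE (bigD1 i) //= !mxE !eqxx mulr1 big1 ?addr0 // => k ki.
  by rewrite !mxE eq_sym (negbTE ki) mulr0.
exists 'cV[D^c]_n; split.
  exists n, e; split=> //; apply/seteqP; split=> // u _; exists (fun i => u i 0); exact: eE.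
apply: isometric_sym; apply: isometric_trans Hiso _.
have [m mE] := dual_family D_division aH (@mf_nondeg _ _ _ a) eI.
pose Vd : rmodType D := Defs_dual__canonical__GRing_Lmodule J 'cV[D^c]_n.
have form_lin u : is_linear_form (mf_form a u).
  by split=> [v w|b v]; rewrite ?(hermDr aH) ?(hermZr aH).
pose F (p : 'cV[D^c]_n * 'cV[D^c]_n) : 'cV[D^c]_n * Vd := (p.1, Dual (form_lin p.2)).
have Fl : linear F.
  move=> b p q; congr pair; apply: dual_eq => v /=.
  by rewrite (hermDl aH) (hermZl aH).
exists (HB.pack_for {linear ('cV[D^c]_n * 'cV[D^c]_n)%type -> ('cV[D^c]_n * Vd)%type} F
    (GRing.isLinear.Build _ _ _ _ F Fl)); split=> /= [|p q]; last first.
  by rewrite /hyp_form /= -(hermC aH) addrC.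
pose g (xi : Vd) : 'cV[D^c]_n := \sum_i (J ((xi : dual 'cV[D^c]_n) (e i)) : D^c) *: m i.
have g_e xi i : mf_form a (g xi) (e i) = (xi : dual 'cV[D^c]_n) (e i).
  rewrite /g (herm_suml aH) (bigD1 i) //= (hermZl aH) mE eqxx mulr1 inv_inv.
  by rewrite big1 ?addr0 // => k ki; rewrite (hermZl aH) mE (negbTE ki) mulr0.
have gE xi v : mf_form a (g xi) v = (xi : dual 'cV[D^c]_n) v.
  rewrite [v]eE (herm_sumr aH); have [xiD xiZ] := dualP xi.
  have xi0 : xi 0 = 0 by apply: (addrI (xi 0)); rewrite -xiD !addr0.
  rewrite (big_morph _ xiD xi0); apply: eq_bigr => i _.
  by rewrite (hermZr aH) g_e xiZ.
have a_inj u v : mf_form a u =1 mf_form a v -> u = v.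
  move=> uv; apply/eqP; rewrite -subr_eq0; apply/eqP; apply: (@mf_nondeg _ _ _ a) => w.
  by rewrite -[LHS]/(mf_form a (u - v) w) (hermDl aH) (hermNl aH) uv subrr.
exists (fun p => (p.1, g p.2)) => -[u v]; rewrite /F /=; congr pair.
  by apply: a_inj => w; rewrite gE.
by apply: dual_eq => w /=; rewrite gE.
Qed.

Lemma isometric_osum_add (a b c d : mform J eps) :
  isometric (osum (mf_form a) (mf_form b)) (osum (mf_form c) (mf_form d)) ->
  witt_class (\pi_(iso_class J eps) a) + witt_class (\pi_(iso_class J eps) b) =
  witt_class (\pi_(iso_class J eps) c) + witt_class (\pi_(iso_class J eps) d).
Proof.
move=> iso; rewrite -!witt_classD !isometric_pi_add; congr (witt_class _).
apply/iso_classP; apply: isometric_trans (mf_addE _ _) _.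
exact: isometric_trans iso (isometric_sym (mf_addE _ _)).
Qed.

(** [a] + [b] + [b] = [H] + [b] with H hyperbolic. *)
Lemma witt_opposite (a b : mform J eps) :
  isometric (mf_form b) (fun u v => - mf_form a u v) ->
  witt_class (\pi_(iso_class J eps) b) = - witt_class (\pi_(iso_class J eps) a).
Proof.
move=> ba; have [H /witt_hyperbolic H0 Hiso] := hyperbolic_double a.
have /isometric_osum_add : isometric (osum (mf_form H) (mf_form b))
    (osum (mf_form (mf_add a b)) (mf_form b)).
  apply: isometric_trans (isometric_osum Hiso ba) _.
  apply: isometric_trans (isometric_metabolic (mf_hermitian eps_sign a)) _.
  apply: isometric_osum; last exact: isometric_sym.
  apply: isometric_trans (isometric_sym (mf_addE _ _)).
  by apply: isometric_osum; [exact: isometric_refl | exact: isometric_sym].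
rewrite H0 add0r -isometric_pi_add witt_classD => E.
apply/eqP; rewrite -addr_eq0 addrC; apply/eqP.
by apply: (addIr (witt_class (\pi_(iso_class J eps) b))); rewrite add0r -E.
Qed.

End WittRelations.

(** * Values of the Maslov cochain *)
Section MaslovValues.
Variables (D : unitRingType) (D_division : GRing.field_axiom D).
Variables (J : involution D) (eps : D) (eps_sign : eps = 1 \/ eps = -1).

Let neps_sign : - eps = 1 \/ - eps = -1.
Proof. by case: eps_sign => ->; [right | left; rewrite opprK]. Qed.

Definition maslov_value (M : rmodType D) (h : M -> M -> D) (X Y Z : lagrangian h) : witt J eps :=
  if `[< [/\ opposite X Y, opposite X Z & opposite Y Z] >]
  then witt_class (kappa J eps X Y Z) else 0.

Lemma witt_zero (a : mform J eps) : (forall u : 'cV[D^c]_(mf_dim a), u = 0) ->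
  witt_class (\pi_(iso_class J eps) a) = 0.
Proof.
move=> a0; have -> : \pi_(iso_class J eps) a = 0.
  apply/iso_classP; pose F (u : 'cV[D^c]_(mf_dim a)) : 'cV[D^c]_0 := 0.
  have Fl : linear F by move=> c u v; rewrite /F scaler0 addr0.
  exists (HB.pack_for {linear 'cV[D^c]_(mf_dim a) -> 'cV[D^c]_0} F
    (GRing.isLinear.Build _ _ _ _ F Fl)); split=> [|u v].
    by exists (fun=> 0) => u; [rewrite [RHS]a0 | apply/matrixP => -[]].
  by rewrite [LHS]big_ord0 [u]a0 (herm0l (mf_hermitian eps_sign a)).
by apply: (addIr (witt_class 0)); rewrite -witt_classD addr0 add0r.
Qed.

Section OneModule.
Variables (M : rmodType D) (h : M -> M -> D) (hH : hermitian J (- eps) h).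
Variables (I : finType) (fx fy : I -> M) (frame : hyp_frame h fx fy).

Lemma maslov_valueE (X Y Z : lagrangian h) (a : mform J eps) :
  opposite X Y -> opposite X Z -> opposite Y Z -> kappa_form h X Y Z (mf_form a) ->
  maslov_value X Y Z = witt_class (\pi_(iso_class J eps) a).
Proof.
move=> XY XZ YZ aP; rewrite /maslov_value asboolT //.
by rewrite (kappaE D_division eps_sign hH frame XY XZ YZ aP).
Qed.

Section Graphs.
Variables (V : rmodType D).

(** X + Z is the whole module and the sum is direct, so every vector has a unique
    translate by X that lies in Z. *)
Lemma graph_map (X Z : lagrangian h) (b : {linear V -> M}) : opposite X Z ->
  exists T : {linear V -> M}, is_graph X Z b T.
Proof.
move=> XZ; have T_ex u : exists x, lag_set X x /\ lag_set Z (b u + x).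
  have [x [z [Xx Zz bE]]] := opposite_add D_division neps_sign hH frame (b u) XZ.
  exists (- x); split; last by rewrite bE addrAC subrr add0r.
  by rewrite -[- x]add0r; apply: submoduleB => //; [exact: lag_sub | case: (lag_sub X)].
have [T TP] := choice T_ex.
have [X0 XD XZ'] := lag_sub X; have [Z0 ZD ZZ] := lag_sub Z.
have Tl : linear T.
  move=> a u v; apply/eqP; rewrite -subr_eq0; apply/eqP; apply: (opposite_eq0 XZ).
    apply: submoduleB; [exact: lag_sub | by case: (TP (a *: u + v))|].
    by apply: XD; [apply: XZ'|]; [case: (TP u) | case: (TP v)].
  have -> : T (a *: u + v) - (a *: T u + T v) =
      (b (a *: u + v) + T (a *: u + v)) - (a *: (b u + T u) + (b v + T v)).
    by rewrite linearP scalerDr [a *: b u + a *: T u + _]addrACA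
       [in RHS]opprD [RHS]addrACA subrr add0r.
  apply: submoduleB; [exact: lag_sub | by case: (TP (a *: u + v))|].
  by apply: ZD; [apply: ZZ|]; [case: (TP u) | case: (TP v)].
by exists (HB.pack_for {linear V -> M} T (GRing.isLinear.Build _ _ _ _ _ Tl)) => u; exact: TP.
Qed.

Variables (X Y Z : lagrangian h).
Hypotheses (XY : opposite X Y) (XZ : opposite X Z) (YZ : opposite Y Z).
Variables (b T : {linear V -> M}).
Hypotheses (bY : parametrizes Y b) (bT : is_graph X Z b T).

Lemma param_mem u : lag_set Y (b u).
Proof. by have [_ bE] := bY; apply/bE; exists u. Qed.

Lemma parametrizes_graph : parametrizes Z (b \+ T).
Proof.
have [bI bE] := bY; split.
  move=> u v /= uv; apply: bI; apply/eqP; rewrite -subr_eq0; apply/eqP.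
  apply: (opposite_eq0 XY); last first.
    by apply: submoduleB; [exact: lag_sub | exact: param_mem | exact: param_mem].
  have -> : b u - b v = T v - T u.
    by apply/eqP; rewrite subr_eq addrAC [T v + _]addrC -uv addrK.
  by apply: submoduleB; [exact: lag_sub | case: (bT v) | case: (bT u)].
move=> z; split=> [Zz|[u <-]]; last by case: (bT u).
have [x [y [Xx /bE[u <-] zE]]] := opposite_add D_division neps_sign hH frame z XY.
have [XT ZT] := bT u.
exists u => /=; apply/eqP; rewrite -subr_eq0; apply/eqP; apply: (opposite_eq0 XZ).
  have -> : b u + T u - z = T u - x by rewrite zE [x + _]addrC opprD addrACA subrr add0r.
  by apply: submoduleB => //; exact: lag_sub.
by apply: submoduleB => //; exact: lag_sub.
Qed.

Lemma parametrizes_map : parametrizes X T.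
Proof.
have [bI bE] := bY; split.
  move=> u v uv; apply: bI; apply/eqP; rewrite -subr_eq0; apply/eqP.
  apply: (opposite_eq0 YZ).
    by apply: submoduleB; [exact: lag_sub | exact: param_mem | exact: param_mem].
  have -> : b u - b v = (b u + T u) - (b v + T v) by rewrite uv opprD addrACA subrr addr0.
  by apply: submoduleB; [exact: lag_sub | case: (bT u) | case: (bT v)].
move=> x; split=> [Xx|[u <-]]; last by case: (bT u).
have [y [z [Yy Zz xE]]] := opposite_add D_division neps_sign hH frame x YZ.
have Yy' : lag_set Y (- y).
  by rewrite -[- y]add0r; apply: submoduleB => //; [exact: lag_sub | case: (lag_sub Y)].
have [u uE] := (bE (- y)).1 Yy'; have [XT ZT] := bT u.
exists u; apply/eqP; rewrite -subr_eq0; apply/eqP; apply: (opposite_eq0 XZ).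
  by apply: submoduleB => //; exact: lag_sub.
have -> : T u - x = (b u + T u) - z by rewrite xE uE opprD addrA [T u - y]addrC.
by apply: submoduleB => //; exact: lag_sub.
Qed.

Lemma graph_form_skew u v : h (T u) (b v) = - h (b u) (T v).
Proof.
have [XTu ZTu] := bT u; have [XTv ZTv] := bT v.
have := lag_isotropic ZTu ZTv.
rewrite (hermDl hH _ (T u)) !(hermDr hH _ _ (T v)) (lag_isotropic (param_mem u) (param_mem v)).
rewrite (lag_isotropic XTu XTv) add0r addr0 addrC => /eqP; rewrite addr_eq0 => /eqP.
by [].
Qed.

Lemma graph_form_hermitian : hermitian J eps (fun u v => h (b u) (T v)).
Proof.
split=> [u v w|u v w|c d u v|u v].
- by rewrite linearD (hermDl hH).
- by rewrite linearD (hermDr hH).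
- by rewrite !linearZ_LR (hermZl hH) (hermZr hH) mulrA.
- by rewrite -[LHS]opprK -graph_form_skew (hermC hH) mulrN opprK.
Qed.

End Graphs.

(** Exchanging X and Y exchanges beta and T, and h(T u, b v) = - h(b u, T v). *)
Lemma maslov_value_swap12 (X Y Z : lagrangian h) :
  maslov_value Y X Z = - maslov_value X Y Z.
Proof.
have [[XY XZ YZ]|no] := pselect [/\ opposite X Y, opposite X Z & opposite Y Z]; last first.
  by rewrite /maslov_value !asboolF ?oppr0 // => -[/opposite_sym YX YZ XZ]; apply: no.
have YX := opposite_sym XY.
have [a aP] := kappa_form_exists D_division eps_sign hH frame XY XZ YZ.
have [c cP] := kappa_form_exists D_division eps_sign hH frame YX YZ XZ.
rewrite (maslov_valueE XY XZ YZ aP) (maslov_valueE YX YZ XZ cP).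
apply: (witt_opposite D_division eps_sign); apply: (kappa_form_unique YZ cP).
have [b [T [bY bT aE]]] := aP; exists T, b; split.
- exact: (parametrizes_map XZ YZ bY bT).
- by move=> u; split; [exact: (param_mem bY) | rewrite addrC; case: (bT u)].
- by move=> u v; rewrite (graph_form_skew bY bT) aE.
Qed.

(** Exchanging Y and Z replaces beta by beta + T and T by -T; the additional term
    h(T u, T v) vanishes as X is isotropic. *)
Lemma maslov_value_swap23 (X Y Z : lagrangian h) :
  maslov_value X Z Y = - maslov_value X Y Z.
Proof.
have [[XY XZ YZ]|no] := pselect [/\ opposite X Y, opposite X Z & opposite Y Z]; last first.
  by rewrite /maslov_value !asboolF ?oppr0 // => -[XZ XY /opposite_sym YZ]; apply: no.
have ZY := opposite_sym YZ.
have [a aP] := kappa_form_exists D_division eps_sign hH frame XY XZ YZ.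
have [c cP] := kappa_form_exists D_division eps_sign hH frame XZ XY ZY.
rewrite (maslov_valueE XY XZ YZ aP) (maslov_valueE XZ XY ZY cP).
apply: (witt_opposite D_division eps_sign); apply: (kappa_form_unique XY cP).
have [b [T [bY bT aE]]] := aP; exists (b \+ T), (\- T); split.
- exact: (parametrizes_graph XY XZ bY bT).
- move=> u /=; rewrite addrK; split; last exact: (param_mem bY).
  have [XT _] := bT u.
  by rewrite -[- T u]add0r; apply: submoduleB => //; [exact: lag_sub | case: (lag_sub X)].
- move=> u v /=; have [XTu _] := bT u; have [XTv _] := bT v.
  by rewrite aE (hermNr hH) (hermDl hH) (lag_isotropic XTu XTv) addr0.
Qed.

(** Parametrize X1 by b and let S, T be the maps to X0 belonging to X2 and X3, with
    forms s and t.  Then kappa(X0, X2, X3) is t - s, in the parametrization b + S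
    of X2, and in the same parametrization kappa(X1, X2, X3) is s(u, v - w v),
    where w = T^-1 S. *)
Lemma maslov_value_cocycle (X0 X1 X2 X3 : lagrangian h) :
  opposite X0 X1 -> opposite X0 X2 -> opposite X0 X3 -> opposite X1 X2 ->
  opposite X1 X3 -> opposite X2 X3 ->
  maslov_value X0 X1 X3 + maslov_value X1 X2 X3 =
  maslov_value X0 X1 X2 + maslov_value X0 X2 X3.
Proof.
move=> X01 X02 X03 X12 X13 X23.
have [a aP] := kappa_form_exists D_division eps_sign hH frame X01 X02 X12.
have [t tP] := kappa_form_exists D_division eps_sign hH frame X01 X03 X13.
have [r rP] := kappa_form_exists D_division eps_sign hH frame X02 X03 X23.
have [k kP] := kappa_form_exists D_division eps_sign hH frame X12 X13 X23.
rewrite (maslov_valueE X01 X02 X12 aP) (maslov_valueE X01 X03 X13 tP).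
rewrite (maslov_valueE X02 X03 X23 rP) (maslov_valueE X12 X13 X23 kP).
apply: isometric_osum_add.
have [b [S [b1 bS aE]]] := aP.
have [T bT] := graph_map b X03.
pose s u v := h (b u) (S v); pose t' u v := h (b u) (T v).
have [TI TE] := parametrizes_map X03 X13 b1 bT.
have w_ex u : exists v, T v = S u by apply/TE; case: (bS u).
have [w wE] := choice w_ex.
have wl : linear w by move=> c u v; apply: TI; rewrite !linearP !wE linearP.
pose wL := HB.pack_for {linear _ -> _} w (GRing.isLinear.Build _ _ _ _ _ wl).
have sH : hermitian J eps s := graph_form_hermitian b1 bS.
have t'H : hermitian J eps t' := graph_form_hermitian b1 bT.
have a_iso : isometric (mf_form a) s.
  by apply: (kappa_form_unique X02 aP); exists b, S; split.
have t_iso : isometric (mf_form t) t'.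
  by apply: (kappa_form_unique X03 tP); exists b, T; split.
have r_iso : isometric (mf_form r) (fun u v => t' u v - s u v).
  apply: (kappa_form_unique X03 rP); exists (b \+ S), (T \- S); split.
  - exact: (parametrizes_graph X01 X02 b1 bS).
  - move=> u /=; have [XT ZT] := bT u; have [XS _] := bS u; split.
      by apply: submoduleB => //; exact: lag_sub.
    by rewrite addrACA [S u + _]addrC addNr addr0.
  - move=> u v /=; have [XTv _] := bT v; have [XSv _] := bS v; have [XSu _] := bS u.
    rewrite (hermDl hH (b u)) (hermDr hH (S u)) !(hermNr hH).
    rewrite (hermDr hH (b u)) (hermNr hH) (lag_isotropic XSu XTv) (lag_isotropic XSu XSv).
    by rewrite subr0 addr0.
have k_iso : isometric (mf_form k) (fun u v => s u (v - w v)).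
  apply: (kappa_form_unique X13 kP); exists (b \+ S), ((b \o wL) \- b); split.
  - exact: (parametrizes_graph X01 X02 b1 bS).
  - move=> u /=; split.
      by apply: submoduleB; [exact: lag_sub | exact: (param_mem b1) | exact: (param_mem b1)].
    have -> : b u + S u + (b (w u) - b u) = b (w u) + T (w u).
      by rewrite wE addrC addrA subrK.
    by case: (bT (w u)).
  - move=> u v; transitivity (h (b u + S u) (- b (v - w v))); last first.
      by congr (h _ _); rewrite linearB opprB.
    have Yb x := param_mem b1 x.
    rewrite (hermNr hH) /= (hermDl hH) (lag_isotropic (Yb _) (Yb _)) add0r.
    by rewrite (graph_form_skew b1 bS) opprK.
apply: isometric_trans (isometric_osum t_iso k_iso) _.
apply: isometric_trans (isometric_sym (isometric_osum a_iso r_iso)).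
by apply: (isometric_cocycle (w := wL) sH t'H) => u v; rewrite /t' /= wE.
Qed.

(** Coinciding Lagrangians can be opposite, but only in the zero module, where
    kappa is the empty form. *)
Lemma maslov_value_eq0 (X Y Z : lagrangian h) :
  X = Y \/ X = Z \/ Y = Z -> maslov_value X Y Z = 0.
Proof.
move=> XYZ; rewrite /maslov_value; case: asboolP => [[XY XZ YZ]|//].
have [a aP] := kappa_form_exists D_division eps_sign hH frame XY XZ YZ.
rewrite (kappaE D_division eps_sign hH frame XY XZ YZ aP).
have zero (W : lagrangian h) u : opposite W W -> lag_set W u -> u = 0.
  by move=> WW Wu; apply: (opposite_eq0 WW).
have a0 (u : 'cV[D^c]_(mf_dim a)) : u = 0.
  have [b [T [bY bT aE]]] := aP.
  have [bI _] := bY; have [TI _] := parametrizes_map XZ YZ bY bT.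
  have [XTu _] := bT u; have Yu := param_mem bY u.
  case: XYZ => [XY'|[XZ'|YZ']].
  - by apply: bI; rewrite linear0; apply: (zero Y) => //; rewrite -{1}XY'.
  - by apply: TI; rewrite linear0; apply: (zero X) => //; rewrite {2}XZ'.
  - by apply: bI; rewrite linear0; apply: (zero Y) => //; rewrite {2}YZ'.
apply: witt_zero; exact: a0.
Qed.

End OneModule.

Lemma opposite_actE (M : rmodType D) (h : M -> M -> D) (g : unitary h) (X Y : lagrangian h) :
  opposite (lag_act g X) (lag_act g Y) <-> opposite X Y.
Proof.
split=> [|/opposite_act]; last exact.
by move=> /(opposite_act g^-1%g); rewrite -!lag_actM mulVg !lag_act1.
Qed.

Lemma maslov_value_act (M : rmodType D) (h : M -> M -> D) (hH : hermitian J (- eps) h)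
    (I : finType) (fx fy : I -> M) (frame : hyp_frame h fx fy)
    (g : unitary h) (X Y Z : lagrangian h) :
  maslov_value (lag_act g X) (lag_act g Y) (lag_act g Z) = maslov_value X Y Z.
Proof.
have [[XY XZ YZ]|no] := pselect [/\ opposite X Y, opposite X Z & opposite Y Z]; last first.
  rewrite /maslov_value !asboolF // => -[/opposite_actE XY /opposite_actE XZ /opposite_actE YZ].
  exact: no.
have [a aP] := kappa_form_exists D_division eps_sign hH frame XY XZ YZ.
rewrite (maslov_valueE hH frame XY XZ YZ aP).
by apply: (maslov_valueE hH frame); rewrite ?opposite_actE //; exact: kappa_form_act.
Qed.

Section DirectSum.
Variables (M1 M2 : rmodType D) (h1 : M1 -> M1 -> D) (h2 : M2 -> M2 -> D).
Hypotheses (hH1 : hermitian J (- eps) h1) (hH2 : hermitian J (- eps) h2).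

Section LagrangianSum.
Variables (X1 : lagrangian h1) (X2 : lagrangian h2).

Definition osum_set : set (M1 * M2) := [set u | lag_set X1 u.1 /\ lag_set X2 u.2]%classic.

Fact osum_submodule : is_submodule osum_set.
Proof.
have [X10 X1D X1Z] := lag_sub X1; have [X20 X2D X2Z] := lag_sub X2.
split=> [//|u v [u1 u2] [v1 v2]|a u [u1 u2]].
  by split; [exact: X1D | exact: X2D].
by split; [exact: X1Z | exact: X2Z].
Qed.

Fact osum_perp : osum_set = perp (osum h1 h2) osum_set.
Proof.
have [X10 _ _] := lag_sub X1; have [X20 _ _] := lag_sub X2.
apply/seteqP; split=> [v [v1 v2] u [u1 u2]|v vX].
  by rewrite /osum (lag_isotropic u1 v1) (lag_isotropic u2 v2) addr0.
split; apply: lag_orthogonal => u Xu.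
  by have := vX (u, 0) (conj Xu X20); rewrite /osum /= (herm0l hH2) addr0.
by have := vX (0, u) (conj X10 Xu); rewrite /osum /= (herm0l hH1) add0r.
Qed.

Definition osum_lagrangian : lagrangian (osum h1 h2) := Lagrangian osum_submodule osum_perp.

End LagrangianSum.

Lemma osum_opposite (X1 Y1 : lagrangian h1) (X2 Y2 : lagrangian h2) :
  opposite X1 Y1 -> opposite X2 Y2 ->
  opposite (osum_lagrangian X1 X2) (osum_lagrangian Y1 Y2).
Proof.
move=> XY1 XY2; apply/seteqP; split=> [[u1 u2] [[/= Xu1 Xu2] [/= Yu1 Yu2]]|_ ->].
  by congr pair; [exact: (opposite_eq0 XY1) | exact: (opposite_eq0 XY2)].
have [X10 _ _] := lag_sub X1; have [X20 _ _] := lag_sub X2.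
by have [Y10 _ _] := lag_sub Y1; have [Y20 _ _] := lag_sub Y2.
Qed.

Lemma kappa_form_osum (X1 Y1 Z1 : lagrangian h1) (X2 Y2 Z2 : lagrangian h2)
    (V1 V2 : rmodType D) (k1 : V1 -> V1 -> D) (k2 : V2 -> V2 -> D) :
  kappa_form h1 X1 Y1 Z1 k1 -> kappa_form h2 X2 Y2 Z2 k2 ->
  kappa_form (osum h1 h2) (osum_lagrangian X1 X2) (osum_lagrangian Y1 Y2)
    (osum_lagrangian Z1 Z2) (osum k1 k2).
Proof.
move=> [b1 [T1 [[b1I b1Y] bT1 k1E]]] [b2 [T2 [[b2I b2Y] bT2 k2E]]].
have lin (f1 : {linear V1 -> M1}) (f2 : {linear V2 -> M2}) :
    linear (fun u : V1 * V2 => (f1 u.1, f2 u.2)).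
  by move=> a u v; rewrite /= !linearP.
pose pair_lin (f1 : {linear V1 -> M1}) (f2 : {linear V2 -> M2}) :=
  HB.pack_for {linear (V1 * V2)%type -> (M1 * M2)%type}
   (fun u : V1 * V2 => (f1 u.1, f2 u.2))
   (GRing.isLinear.Build _ _ _ _ _ (lin f1 f2)).
exists (pair_lin b1 b2), (pair_lin T1 T2); split; [split|..].
- by move=> [u1 u2] [v1 v2] [/b1I -> /b2I ->].
- move=> [v1 v2]; split=> [[/= /b1Y[u1 <-] /b2Y[u2 <-]]|[[u1 u2] [<- <-]]].
    by exists (u1, u2).
  by split; [apply/b1Y; exists u1 | apply/b2Y; exists u2].
- by move=> [u1 u2]; have [? ?] := bT1 u1; have [? ?] := bT2 u2.
- by move=> [u1 u2] [v1 v2]; rewrite /osum /= k1E k2E.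
Qed.

Variables (I1 I2 : finType) (fx1 fy1 : I1 -> M1) (fx2 fy2 : I2 -> M2).
Hypotheses (frame1 : hyp_frame h1 fx1 fy1) (frame2 : hyp_frame h2 fx2 fy2).

Lemma maslov_value_osum (X1 Y1 Z1 : lagrangian h1) (X2 Y2 Z2 : lagrangian h2) :
  opposite X1 Y1 -> opposite X1 Z1 -> opposite Y1 Z1 ->
  opposite X2 Y2 -> opposite X2 Z2 -> opposite Y2 Z2 ->
  maslov_value (osum_lagrangian X1 X2) (osum_lagrangian Y1 Y2) (osum_lagrangian Z1 Z2) =
  maslov_value X1 Y1 Z1 + maslov_value X2 Y2 Z2.
Proof.
move=> XY1 XZ1 YZ1 XY2 XZ2 YZ2.
have [a aP] := kappa_form_exists D_division eps_sign hH1 frame1 XY1 XZ1 YZ1.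
have [b bP] := kappa_form_exists D_division eps_sign hH2 frame2 XY2 XZ2 YZ2.
have hH := osum_hermitian hH1 hH2.
have [fx [fy frame]] := osum_frame hH1 hH2 frame1 frame2.
rewrite (maslov_valueE hH1 frame1 XY1 XZ1 YZ1 aP) (maslov_valueE hH2 frame2 XY2 XZ2 YZ2 bP).
have [XY XZ YZ] := And3 (osum_opposite XY1 XY2) (osum_opposite XZ1 XZ2) (osum_opposite YZ1 YZ2).
have [c cP] := kappa_form_exists D_division eps_sign hH frame XY XZ YZ.
rewrite (maslov_valueE hH frame XY XZ YZ cP) -witt_classD isometric_pi_add.
congr witt_class; apply/iso_classP; apply: isometric_trans (isometric_sym (mf_addE _ _)).
exact: kappa_form_unique XZ cP (kappa_form_osum aP bP).
Qed.

End DirectSum.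

End MaslovValues.

(** * The Maslov class *)
Section FlagCohomology.
Variables (G : groupType) (Gamma : ggraph G) (P : resolution G) (A : zmodType).
Hypothesis Gamma_cn : common_neighbours Gamma.

Lemma flag_aug_pull_surj n (f : bicochain P (fl_complex Gamma) A) :
  f \in cocycles P (fl_complex Gamma) A n.+1 ->
  exists2 L, L \in cocycles P (Z_complex G) A n.+1 &
    exists2 k, is_cochain n k &
      f = bc_pull (id_chain_map P) (fl_aug_map Gamma) L + total_d k.
Proof.
apply: aug_pull_surj.
- exact: deg_surj.
- exact: flag_coexact0.
- by move=> q; exact: flag_coexact.
Qed.

Lemma flag_aug_pull_inj n (L : bicochain P (Z_complex G) A)
    (k : bicochain P (fl_complex Gamma) A) :
  L \in cocycles P (Z_complex G) A n.+2 -> is_cochain n.+1 k ->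
  bc_pull (id_chain_map P) (fl_aug_map Gamma) L = total_d k ->
  exists2 l, is_cochain n.+1 l & L = total_d l.
Proof.
apply: aug_pull_inj.
- exact: deg_surj.
- exact: flag_coexact0.
- by move=> q; exact: flag_coexact.
Qed.

End FlagCohomology.

Section MaslovClass.
Variables (D : unitRingType) (D_division : GRing.field_axiom D).
Variables (J : involution D) (eps : D) (eps_sign : eps = 1 \/ eps = -1).
Hypothesis Deps_infinite : infinite_set [set a : D | a - J a * eps = 0]%classic.

Section OneModule.
Variables (M : rmodType D) (h : M -> M -> D) (hH : hermitian J (- eps) h).
Variables (I : finType) (fx fy : I -> M) (frame : hyp_frame h fx fy).

Lemma opp_graph_common_neighbours : common_neighbours (opp_graph h).
Proof.
move=> K X; apply: (common_opposite D_division hH _ frame).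
have -> // : [set a : D | a + J a * - eps = 0]%classic = [set a | a - J a * eps = 0]%classic.
by apply: eq_set => a; rewrite mulrN.
Qed.

Lemma maslov_cochainE (s : simplex (opp_graph h) 2) (X Y Z : lagrangian h) :
  s (inord 0) = X -> s (inord 1) = Y -> s (inord 2) = Z ->
  maslov_cochain J eps s = maslov_value J eps X Y Z.
Proof. by move=> <- <- <-. Qed.

Lemma maslov_cochain_act (g : unitary h) (s : simplex (opp_graph h) 2) :
  maslov_cochain J eps (sact g s) = maslov_cochain J eps s.
Proof.
rewrite (maslov_cochainE (erefl (sact g s _)) erefl erefl).
rewrite (maslov_cochainE (erefl (s _)) erefl erefl).
exact: (maslov_value_act D_division eps_sign hH frame).
Qed.

(** If two vertices of s coincide, the two faces containing both contribute 0 and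
    the other two cancel by antisymmetry; if no two coincide, all pairs are
    opposite and the isometry of forms applies. *)
Lemma maslov_cochain_cocycle (s : simplex (opp_graph h) 3) :
  fgext (maslov_cochain J eps (h := h)) (boundary << s >>) = 0.
Proof.
pose x i : lagrangian h := s (inord i).
have faceE (i : 'I_4) a b c : (fintype.lift i (inord 0 : 'I_3) = a :> nat) ->
    (fintype.lift i (inord 1 : 'I_3) = b :> nat) -> (fintype.lift i (inord 2 : 'I_3) = c :> nat) ->
    maslov_cochain J eps (face i s) = maslov_value J eps (x a) (x b) (x c).
  by move=> <- <- <-; apply: maslov_cochainE; rewrite /x inord_val.
rewrite /boundary fgextU fgext_sum.
have signE (t : simplex (opp_graph h) 2) (i : nat) :
    fgext (maslov_cochain J eps (h := h)) << (-1) ^+ i *g t >> =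
    maslov_cochain J eps t *~ (-1) ^+ i.
  by rewrite signU fgextMz fgextU.
rewrite !big_ord_recl big_ord0 !signE.
have -> := faceE ord0 1%N 2%N 3%N; try by rewrite /= !inordK.
have -> := faceE (fintype.lift ord0 ord0) 0%N 2%N 3%N; try by rewrite /= !inordK.
have -> := faceE (fintype.lift ord0 (fintype.lift ord0 ord0)) 0%N 1%N 3%N;
  try by rewrite /= !inordK.
have -> := faceE (fintype.lift ord0 (fintype.lift ord0 (fintype.lift ord0 ord0)))
  0%N 1%N 2%N; try by rewrite /= !inordK.
rewrite !lift0 /=.
rewrite expr0 !exprS expr0 !mulr1 !mulN1r !opprK !mulrNz !mulr1z addr0.
set m := @maslov_value _ J eps _ h.
have eqopp i j : (x i = x j) \/ opposite (x i) (x j) by exact: (spxP s (inord i) (inord j)).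
have m_eq0 X Y Z : X = Y \/ X = Z \/ Y = Z -> m X Y Z = 0.
  exact: (maslov_value_eq0 D_division eps_sign hH frame).
have m12 X Y Z : m Y X Z = - m X Y Z.
  exact: (maslov_value_swap12 D_division eps_sign hH frame).
have m23 X Y Z : m X Z Y = - m X Y Z.
  exact: (maslov_value_swap23 D_division eps_sign hH frame).
have [x01|o01] := eqopp 0%N 1%N.
  rewrite x01 (m_eq0 (x 1%N) (x 1%N) (x 3%N)); last by left.
  rewrite (m_eq0 (x 1%N) (x 1%N) (x 2%N)); last by left.
  by rewrite subr0 addr0 subrr.
have [x02|o02] := eqopp 0%N 2%N.
  rewrite x02 (m_eq0 (x 2%N) (x 2%N) (x 3%N)); last by left.
  rewrite (m_eq0 (x 2%N) (x 1%N) (x 2%N)); last by right; left.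
  by rewrite oppr0 add0r addr0 m12 addNr.
have [x03|o03] := eqopp 0%N 3%N.
  rewrite x03 (m_eq0 (x 3%N) (x 2%N) (x 3%N)); last by right; left.
  rewrite (m_eq0 (x 3%N) (x 1%N) (x 3%N)); last by right; left.
  by rewrite oppr0 !add0r (m12 (x 1%N) (x 3%N)) (m23 (x 1%N) (x 2%N)) opprK subrr.
have [x12|o12] := eqopp 1%N 2%N.
  rewrite x12 (m_eq0 (x 2%N) (x 2%N) (x 3%N)); last by left.
  rewrite (m_eq0 (x 0%N) (x 2%N) (x 2%N)); last by right; right.
  by rewrite oppr0 add0r addr0 addNr.
have [x13|o13] := eqopp 1%N 3%N.
  rewrite x13 (m_eq0 (x 3%N) (x 2%N) (x 3%N)); last by right; left.
  rewrite (m_eq0 (x 0%N) (x 3%N) (x 3%N)); last by right; right.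
  by rewrite !add0r (m23 (x 0%N) (x 2%N)) opprK addNr.
have [x23|o23] := eqopp 2%N 3%N.
  rewrite x23 (m_eq0 (x 1%N) (x 3%N) (x 3%N)); last by right; right.
  rewrite (m_eq0 (x 0%N) (x 3%N) (x 3%N)); last by right; right.
  by rewrite oppr0 !add0r subrr.
have := maslov_value_cocycle D_division eps_sign hH frame o01 o02 o03 o12 o13 o23.
rewrite -/m => E; rewrite [- _ + _]addrC !addrA [m (x 1%N) _ _ + _]addrC E.
by rewrite [_ + m (x 0%N) (x 2%N) _]addrC addrK subrr.
Qed.

Variable P : resolution (unitary h).

Lemma maslov_cocycle :
  inflate2 P (maslov_cochain J eps (h := h)) \in
    cocycles P (fl_complex (opp_graph h)) (witt J eps) 2.
Proof.
by apply: inflate2_cocycle; [exact: maslov_cochain_act | exact: maslov_cochain_cocycle].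
Qed.

(** A preimage under the constant map exists by surjectivity, so the choice that
    defines the Maslov class returns one; this is the relation between
    representing cocycles that it provides. *)
Lemma maslov_class_spec : exists2 u, u \in cocycles P (Z_complex _) (witt J eps) 2 &
  maslov_class J eps P = coh_class 2 u /\
  exists2 k, is_cochain 1 k &
    bc_pull (id_chain_map P) (fl_aug_map (opp_graph h)) u =
    inflate2 P (maslov_cochain J eps (h := h)) + total_d k.
Proof.
have [u uP [uE]] : exists2 u, u \in cocycles P (Z_complex _) (witt J eps) 2 &
    maslov_class J eps P = coh_class 2 u /\
    constant_pull (maslov_class J eps P) =
      coh_class 2 (inflate2 P (maslov_cochain J eps (h := h))).
  have [u uP uE] := coh_class_cocycle (maslov_class J eps P); exists u => //; split=> //.
  have [L LP [k kn LE]] := flag_aug_pull_surj opp_graph_common_neighbours maslov_cocycle.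
  pose S : set (group_cohomology P (witt J eps) 2) :=
    [set c | constant_pull c = coh_class 2 (inflate2 P (maslov_cochain J eps (h := h)))]%classic.
  suff SL : S (coh_class 2 L) by exact: (xgetI 0 SL : S (xget 0 S)).
  rewrite /S /= /constant_pull coh_pull_class //.
  apply/coh_classP; [exact: bc_pull_cocycle | exact: maslov_cocycle|].
  exists (0 - k); first by apply: is_cochainB => //; exact: is_cochain0.
  by rewrite LE opprD addrA subrr total_dB total_d0.
rewrite {1}uE /constant_pull coh_pull_class // => /coh_classP[].
- exact: bc_pull_cocycle.
- exact: maslov_cocycle.
move=> k kn kE; exists u => //; split=> //; exists k => //.
by rewrite -kE addrC subrK.
Qed.

End OneModule.
End MaslovClass.

(** * The product of two opposition graphs *)
Section ProductGraph.
Variables (D : nzRingType) (M1 M2 : rmodType D).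
Variables (h1 : M1 -> M1 -> D) (h2 : M2 -> M2 -> D).

Definition prod_adj (p q : lagrangian h1 * lagrangian h2) : Prop :=
  opposite p.1 q.1 /\ opposite p.2 q.2.

Definition prod_act (g : unitary h1) (p : lagrangian h1 * lagrangian h2) :=
  (lag_act g p.1, p.2).

Fact prod_act1 : prod_act 1%g =1 id.
Proof. by move=> [X1 X2]; rewrite /prod_act lag_act1. Qed.
Fact prod_actM f g p : prod_act (f * g)%g p = prod_act f (prod_act g p).
Proof. by rewrite /prod_act lag_actM. Qed.
Fact prod_adj_act g p q : prod_adj p q -> prod_adj (prod_act g p) (prod_act g q).
Proof. by move=> [o1 o2]; split => //; exact: opposite_act. Qed.

Definition prod_graph : ggraph (unitary h1) := GGraph prod_act1 prod_actM prod_adj_act.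

Lemma prod_graph_common_neighbours :
  common_neighbours (opp_graph h1) -> common_neighbours (opp_graph h2) ->
  common_neighbours prod_graph.
Proof.
move=> cn1 cn2 K X; have [Y1 Y1P] := cn1 K (fun k => (X k).1).
have [Y2 Y2P] := cn2 K (fun k => (X k).2).
by exists (Y1, Y2) => k; have [? ?] := Y1P k; have [? ?] := Y2P k.
Qed.

Definition proj1 (p : prod_graph) : opp_graph h1 := p.1.
Definition proj2 (p : prod_graph) : opp_graph h2 := p.2.

Fact proj1_adj p q : adj p q -> adj (proj1 p) (proj1 q). Proof. by case. Qed.
Fact proj2_adj p q : adj p q -> adj (proj2 p) (proj2 q). Proof. by case. Qed.

Fact proj1_act (g : unitary h1) p : proj1 (vact g p) = vact g (proj1 p).
Proof. by []. Qed.
(** The second projection is equivariant over the constant map U(M_1) -> U(M_2),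
    as the action on the product only moves the first component. *)
Fact proj2_act (g : unitary h1) p : proj2 (vact g p) = vact 1%g (proj2 p).
Proof. by rewrite vact1. Qed.

End ProductGraph.

Section SumMap.
Variables (D : unitRingType) (J : involution D) (eps : D) (M1 M2 : rmodType D).
Variables (h1 : M1 -> M1 -> D) (h2 : M2 -> M2 -> D).
Hypotheses (hH1 : hermitian J (- eps) h1) (hH2 : hermitian J (- eps) h2).

Definition sum_vertex (p : prod_graph h1 h2) : opp_graph (osum h1 h2) :=
  osum_lagrangian hH1 hH2 p.1 p.2.

Fact sum_vertex_adj p q : adj p q -> adj (sum_vertex p) (sum_vertex q).
Proof. by move=> [o1 o2]; exact: osum_opposite. Qed.

Fact sum_vertex_act (g : unitary h1) p :
  sum_vertex (vact g p) = vact (unitary_incl h1 h2 g) (sum_vertex p).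
Proof.
apply: lagrangian_eq; apply/seteqP.
split=> [[u1 u2] [[/= v1 Xv1 <-] Xu2]|_ [[u1 u2] [/= Xu1 Xu2] <-]].
  by exists (v1, u2).
by split=> //=; exists u1.
Qed.

Lemma maslov_cochain_sum (D_division : GRing.field_axiom D) (eps_sign : eps = 1 \/ eps = -1)
    (I1 I2 : finType) (fx1 fy1 : I1 -> M1) (fx2 fy2 : I2 -> M2)
    (frame1 : hyp_frame h1 fx1 fy1) (frame2 : hyp_frame h2 fx2 fy2)
    (s : simplex (prod_graph h1 h2) 2) :
  maslov_cochain J eps (simplex_map sum_vertex_adj s) =
  maslov_cochain J eps (simplex_map (@proj1_adj _ _ _ h1 h2) s) +
  maslov_cochain J eps (simplex_map (@proj2_adj _ _ _ h1 h2) s).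
Proof.
have hH := osum_hermitian hH1 hH2.
have [fx [fy frame]] := osum_frame hH1 hH2 frame1 frame2.
pose p i : lagrangian h1 * lagrangian h2 := s (inord i).
have eqadj i j : p i = p j \/ prod_adj (p i) (p j) by exact: (spxP s (inord i) (inord j)).
rewrite (@maslov_cochainE _ _ _ _ _ _
  (sum_vertex (p 0%N)) (sum_vertex (p 1%N)) (sum_vertex (p 2%N))) //.
rewrite (@maslov_cochainE _ _ _ _ _ (simplex_map (@proj1_adj _ _ _ h1 h2) s)
  (p 0%N).1 (p 1%N).1 (p 2%N).1) //.
rewrite (@maslov_cochainE _ _ _ _ _ (simplex_map (@proj2_adj _ _ _ h1 h2) s)
  (p 0%N).2 (p 1%N).2 (p 2%N).2) //.
have degenerate : p 0%N = p 1%N \/ p 0%N = p 2%N \/ p 1%N = p 2%N ->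
    maslov_value J eps (sum_vertex (p 0%N)) (sum_vertex (p 1%N)) (sum_vertex (p 2%N)) =
    maslov_value J eps (p 0%N).1 (p 1%N).1 (p 2%N).1 +
    maslov_value J eps (p 0%N).2 (p 1%N).2 (p 2%N).2.
  move=> E; rewrite (maslov_value_eq0 D_division eps_sign hH frame); last first.
    by case: E => [->|[->|->]]; [left | right; left | right; right].
  rewrite (maslov_value_eq0 D_division eps_sign hH1 frame1); last first.
    by case: E => [->|[->|->]]; [left | right; left | right; right].
  rewrite (maslov_value_eq0 D_division eps_sign hH2 frame2) ?addr0 //.
  by case: E => [->|[->|->]]; [left | right; left | right; right].
have [E|[o01 p01]] := eqadj 0%N 1%N; first by apply: degenerate; left.
have [E|[o02 p02]] := eqadj 0%N 2%N; first by apply: degenerate; right; left.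
have [E|[o12 p12]] := eqadj 1%N 2%N; first by apply: degenerate; right; right.
exact: (maslov_value_osum D_division eps_sign hH1 hH2 frame1 frame2).
Qed.

End SumMap.

Theorem theorem6p7 (D : unitRingType) (D_division : GRing.field_axiom D)
    (J : involution D) (eps : D) (eps_sign : eps = 1 \/ eps = -1)
    (Deps_infinite : infinite_set [set a : D | a - J a * eps = 0]%classic)
    (M1 M2 : rmodType D) (h1 : M1 -> M1 -> D) (h2 : M2 -> M2 -> D)
    (hyp1 : hyperbolic J (- eps) h1) (hyp2 : hyperbolic J (- eps) h2)
    (P : resolution (unitary (osum h1 h2))) (P1 : resolution (unitary h1))
    (phi : gchain_map (unitary_incl h1 h2) P1 P) (phi_aug : res_map phi) :
  restriction phi (maslov_class J eps P) = maslov_class J eps P1.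
Proof.
have [n1 [fx1 [fy1 frame1]]] := hyperbolic_frame hyp1.
have [n2 [fx2 [fy2 frame2]]] := hyperbolic_frame hyp2.
have [[hH1 _] [hH2 _]] := (hyp1, hyp2).
have hH := osum_hermitian hH1 hH2.
have [fx [fy frame]] := osum_frame hH1 hH2 frame1 frame2.
have cn1 := opp_graph_common_neighbours D_division Deps_infinite hH1 frame1.
have cn2 := opp_graph_common_neighbours D_division Deps_infinite hH2 frame2.
have cn12 := prod_graph_common_neighbours cn1 cn2.
have [u uZ [-> [k kn ku]]] := maslov_class_spec D_division eps_sign Deps_infinite hH frame P.
have [u1 u1Z [-> [k1 k1n k1u]]] :=
  maslov_class_spec D_division eps_sign Deps_infinite hH1 frame1 P1.
rewrite /restriction coh_pull_class //.
set v := bc_pull phi _ u.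
have vZ : v \in cocycles P1 (Z_complex _) (witt J eps) 2 by exact: bc_pull_cocycle.
apply/coh_classP => //.
pose aug12 := fl_aug_map (prod_graph h1 h2).
pose m := maslov_cochain J eps (h := osum h1 h2).
pose m1 := maslov_cochain J eps (h := h1).
pose m2 := maslov_cochain J eps (h := h2).
pose sum := fl_chain_map (sum_vertex_adj hH1 hH2) (sum_vertex_act hH1 hH2).
pose pr1 := fl_chain_map (@proj1_adj _ _ _ h1 h2) (@proj1_act _ _ _ h1 h2).
pose pr2 := fl_chain_map (@proj2_adj _ _ _ h1 h2) (@proj2_act _ _ _ h1 h2).
have vE : bc_pull (id_chain_map P1) aug12 v =
    inflate2 P1 (fun s => m (simplex_map (sum_vertex_adj hH1 hH2) s)) + total_d (bc_pull phi sum k).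
  rewrite -(inflate2_pull _ (sum_vertex_act hH1 hH2) m phi_aug) -bc_pull_d.
  transitivity (bc_pull phi sum (bc_pull (id_chain_map P) (fl_aug_map _) u)); last by rewrite ku.
  apply: bicochain_eq => p q x z; rewrite /bc_pull /=; congr (u _ _ _ _).
  exact/esym/(fl_aug_map_natural (unitary_incl h1 h2)).
have Zid q (y : Z_complex (unitary h1) q) : Z_chain_map id q y = y by case: q y.
have u1E : bc_pull (id_chain_map P1) aug12 u1 =
    inflate2 P1 (fun s => m1 (simplex_map (@proj1_adj _ _ _ h1 h2) s)) +
    total_d (bc_pull (id_chain_map P1) pr1 k1).
  rewrite -(inflate2_pull (phi := id_chain_map P1) _ (@proj1_act _ _ _ h1 h2) m1) // -bc_pull_d.
  transitivity (bc_pull (id_chain_map P1) pr1 (bc_pull (id_chain_map P1) (fl_aug_map _) u1));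
    last by rewrite k1u.
  apply: bicochain_eq => p q x z; rewrite /bc_pull /=; congr (u1 _ _ _ _).
  transitivity (Z_chain_map id q (aug12 q z)); first by rewrite Zid.
  exact/esym/(fl_aug_map_natural id).
(* The Maslov cocycle of M_2 is the coboundary of n, with no equivariance; the
   pullback of n along pr2 is invariant since pr2 lies over the trivial action. *)
have [|n nD nE] := flag_coexact cn2 (fgextD m2).
  move=> z; move: z; apply: (additive_freeg_eq (f := fun z => fgext m2 (boundary z))
    (g := fun=> 0)) => [x y|x y|s]; rewrite /boundary ?fgextD ?addr0 //.
  exact: (maslov_cochain_cocycle D_division eps_sign hH2 frame2).
have [||s|l ln lE] := @inflate2_coboundary _ (prod_graph h1 h2) P1 _
  (fun s => m2 (simplex_map (@proj2_adj _ _ _ h1 h2) s)) (fun z => n (pr2 1%N z)).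
- by move=> x y; rewrite cm_D nD.
- by move=> g z; rewrite cm_act /= chain_act1.
- rewrite -[boundary _]/(gc_d (fl_complex (prod_graph h1 h2)) _) -cm_d -nE.
  by rewrite /= /fl_map fgextU fgextU.
have mE := inflate2D P1 (maslov_cochain_sum hH1 hH2 D_division eps_sign frame1 frame2).
(* The difference v - u1 becomes a coboundary on the product graph, where the
   augmentation is injective on cohomology. *)
apply: (flag_aug_pull_inj cn12 (k := l + bc_pull phi sum k - bc_pull (id_chain_map P1) pr1 k1)).
- exact: rpredB.
- apply: is_cochainB; last exact: bc_pull_cochain.
  by apply: is_cochainD => //; exact: bc_pull_cochain.
transitivity (bc_pull (id_chain_map P1) aug12 v - bc_pull (id_chain_map P1) aug12 u1) => //.
rewrite vE u1E mE total_dB total_dD -lE -[X in X - _]addrA opprD /m1 /m2.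
by rewrite addrACA subrr add0r addrA.
Qed.
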